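(* (a) For any even $k\geq 6$, the group $\Gamma$ generated by reflections in the sides of a convex right-angled $k$-gon in $\mathbb{H}^2$ admits properly discontinuous actions on $G=\mathrm{O}(3,1)$ by right-and-left multiplication via pairs $(\rho,\rho')\in\mathrm{Hom}(\Gamma,G)^2$ with $\rho,\rho'$ both faithful and discrete. (b) The group $\Gamma$ generated by reflections in the faces of a $4$-dimensional regular right-angled $120$-cell admits properly discontinuous actions on $G=\mathrm{O}(8,1)$ by right-and-left multiplication via pairs $(\rho,\rho')\in\mathrm{Hom}(\Gamma,G)^2$ with $\rho,\rho'$ both faithful and discrete.
   Context: In (a) the $k$-gon is a compact convex polygon of the hyperbolic plane with $k$ sides and all angles equal to $\pi/2$; in (b) the $120$-cell is the compact regular $120$-cell of the hyperbolic space $\mathbb{H}^4$ all of whose dihedral angles are $\pi/2$, and its faces are its $120$ dodecahedral (codimension-one) facets. The action of $\Gamma$ on $G$ by right-and-left multiplication via $(\rho,\rho')$ is $\gamma\bullet g=\rho'(\gamma)g\rho(\gamma)^{-1}$. It is properly discontinuous if for every compact $\mathscr{C}\subset G$ only finitely many $\gamma$ satisfy $\gamma\bullet\mathscr{C}\cap\mathscr{C}\neq\varnothing$. A representation is faithful and discrete if it is injective with discrete image. *)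

(* Defs.v *)
From mathcomp Require Import all_boot all_order all_algebra.
From mathcomp Require Import all_classical all_reals all_analysis.

Set Implicit Arguments.
Unset Strict Implicit.
Unset Printing Implicit Defensive.

Import Order.TTheory GRing.Theory Num.Theory.
Import numFieldNormedType.Exports.

Local Open Scope classical_set_scope.
Local Open Scope ring_scope.
Local Open Scope card_scope.

Section HyperbolicSpace.
Variables (R : realType) (n : nat).
Implicit Types (x y u : 'cV[R]_n.+1) (A : set 'cV[R]_n.+1) (g : 'M[R]_n.+1).

(* The Lorentzian form x_0 y_0 + ... + x_(n-1) y_(n-1) - x_n y_n. *)
Definition lorentz_mx : 'M[R]_n.+1 :=
  diag_mx (\row_i (if i == ord_max then -1 else 1)).

Definition lorentz x y : R := (x^T *m lorentz_mx *m y) 0 0.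

(* The group O(n,1). *)
Definition On1 : set 'M[R]_n.+1 :=
  [set g | g^T *m lorentz_mx *m g = lorentz_mx].

(* The hyperboloid model of the hyperbolic space of dimension n; its isometries
   are the elements of O(n,1) that preserve it. *)
Definition hyperbolic : set 'cV[R]_n.+1 :=
  [set x | lorentz x x = -1 /\ 0 < x ord_max 0].

(* For lorentz u u = 1, this is x |-> x - 2 <x, u> u, the reflection of the
   hyperbolic space in the hyperplane orthogonal to u. *)
Definition reflection u : 'M[R]_n.+1 :=
  1%:M - 2%:R *: (u *m u^T *m lorentz_mx).

(* A subset of the hyperboloid has hyperbolic dimension d when its linear span
   has dimension d + 1; the columns of B are a basis of the span taken in A. *)
Definition has_hdim A (d : nat) : Prop :=
  exists B : 'M[R]_(n.+1, d.+1),
    [/\ \rank B = d.+1, forall j, A (col j B)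
      & forall x, A x -> exists c : 'cV[R]_d.+1, x = B *m c].

End HyperbolicSpace.

Section Polytopes.
Variables (R : realType) (n m : nat).
(* v i is the outward normal of the i-th facet. *)
Implicit Types v : 'I_m -> 'cV[R]_n.+1.

Definition poly_of v : set 'cV[R]_n.+1 :=
  [set x | hyperbolic x /\ forall i, lorentz x (v i) <= 0].

Definition face v (I : set 'I_m) : set 'cV[R]_n.+1 :=
  [set x | poly_of v x /\ forall i, I i -> lorentz x (v i) = 0].

Definition is_face v (d : nat) (F : set 'cV[R]_n.+1) : Prop :=
  (exists I : set 'I_m, F = face v I) /\ has_hdim F d.

(* poly_of v is a compact convex polytope of dimension n with exactly m facets
   (sides, if n = 2), which are the face v [set i]. *)
Definition compact_polytope v : Prop :=
  [/\ forall i, lorentz (v i) (v i) = 1,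
      injective v,
      compact (poly_of v),
      has_hdim (poly_of v) n
    & forall i, has_hdim (face v [set i]) n.-1].

(* The dihedral angle t at the face common to two facets is the interior one;
   the normals pointing outwards, cos t = - <v i, v j>. For n = 2, this is the
   angle of the polygon at a vertex. *)
Definition right_angled v : Prop :=
  forall i j, i != j -> has_hdim (face v [set i; j]) (n - 2) ->
    acos (- lorentz (v i) (v j)) = pi / 2%:R.

Definition is_flag v (F : 'I_n -> set 'cV[R]_n.+1) : Prop :=
  (forall d : 'I_n, is_face v d (F d)) /\
  (forall d e : 'I_n, (d <= e)%N -> F d `<=` F e).

Definition symmetry v (g : 'M[R]_n.+1) : Prop :=
  On1 g /\ mulmx g @` poly_of v = poly_of v.

Definition regular v : Prop :=
  forall F F', is_flag v F -> is_flag v F' ->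
    exists g, symmetry v g /\ forall d, mulmx g @` F d = F' d.

End Polytopes.

(* Schlafli symbol {p, q, r} of a 4-dimensional polytope: the 2-faces have p
   sides, q of the 2-faces of a facet meet at each of its vertices, and r
   facets meet along each edge. *)
Definition schlafli4 (R : realType) (m : nat) (v : 'I_m -> 'cV[R]_5)
    (p q r : nat) : Prop :=
  [/\ forall F, is_face v 2 F ->
        [set E | is_face v 1 E /\ E `<=` F] #= `I_p,
      forall V F, is_face v 0 V -> is_face v 3 F -> V `<=` F ->
        [set D | [/\ is_face v 2 D, V `<=` D & D `<=` F]] #= `I_q
    & forall E, is_face v 1 E ->
        [set F | is_face v 3 F /\ E `<=` F] #= `I_r].

Definition right_angled_polygon (R : realType) (k : nat)
    (v : 'I_k -> 'cV[R]_3) : Prop :=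
  compact_polytope v /\ right_angled v.

(* The facets of a regular polytope of type {5, 3, 3} are of type {5, 3}, that
   is, they are dodecahedra. *)
Definition right_angled_120cell (R : realType)
    (v : 'I_120 -> 'cV[R]_5) : Prop :=
  [/\ compact_polytope v, regular v, schlafli4 v 5 3 3 & right_angled v].

Section Groups.
Variable R : realType.

Definition is_matrix_group (n : nat) (H : set 'M[R]_n) : Prop :=
  [/\ H 1%:M, forall g h, H g -> H h -> H (g *m h)
    & forall g, H g -> H (invmx g)].

Definition reflection_group (n m : nat) (v : 'I_m -> 'cV[R]_n.+1) :
    set 'M[R]_n.+1 :=
  smallest (@is_matrix_group n.+1) (range (fun i => reflection (v i))).

Variables (p n : nat) (Gamma : set 'M[R]_p).
Implicit Types rho : 'M[R]_p -> 'M[R]_n.+1.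

(* Elements of Hom(Gamma, O(n,1)); only the values on Gamma matter. *)
Definition representation rho : Prop :=
  (forall g, Gamma g -> On1 (rho g)) /\
  (forall g h, Gamma g -> Gamma h -> rho (g *m h) = rho g *m rho h).

Definition faithful_discrete rho : Prop :=
  set_inj Gamma rho /\ rho @` Gamma `<=` isolated (rho @` Gamma).

Definition right_left_action rho rho' (g : 'M[R]_p) (x : 'M[R]_n.+1) :=
  rho' g *m x *m invmx (rho g).

(* Compactness in O(n,1) is compactness in the space of matrices. *)
Definition properly_discontinuous rho rho' : Prop :=
  forall C : set 'M[R]_n.+1, C `<=` @On1 R n -> compact C ->
    finite_set [set g | Gamma g /\
      (right_left_action rho rho' g @` C) `&` C !=set0].

End Groups.

Definition admits_proper_action (R : realType) (p : nat)
    (Gamma : set 'M[R]_p) (n : nat) : Prop :=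
  exists rho rho' : 'M[R]_p -> 'M[R]_n.+1,
    [/\ representation Gamma rho, representation Gamma rho',
        faithful_discrete Gamma rho, faithful_discrete Gamma rho'
      & properly_discontinuous Gamma rho rho'].

(* Main.v *)
Require Import Defs.
From mathcomp Require Import all_boot all_order all_algebra.
From mathcomp Require Import all_classical all_reals all_analysis.
From mathcomp Require Import ring lra zify.

Set Implicit Arguments.
Unset Strict Implicit.
Unset Printing Implicit Defensive.

Import Order.TTheory GRing.Theory Num.Theory.
Import numFieldNormedType.Exports.

Local Open Scope classical_set_scope.
Local Open Scope ring_scope.

(** Let Gamma be generated by the reflections in the facets of a right-angled
   polytope with outward normals v_i, so that <v_i, v_j> is 0 if the facets i
   and j meet, and at most -1 otherwise. Every family a_i of spacelike unit
   vectors of R^(N,1) with the same property (<a_i, a_j> = 0 if i and j commute,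
   <a_i, a_j> <= -1 otherwise) and a nonempty chamber defines a faithful and
   discrete representation of Gamma, v_i being sent to the reflection in a_i.
   This is Tits' theorem, and all that is used of it is [root_dichotomy]: a root
   is positive or negative, and it is negative only if the length of the word
   can be reduced.

   Two such families a and b give an action on O(N,1). It is properly
   discontinuous if some map f of the hyperbolic space of dimension N sends the
   wall of a_i to the wall of b_i and is k-Lipschitz with k < 1. Indeed, f
   restricted to the chamber of a extends to an equivariant map, which is
   k-Lipschitz because geodesics can be cut at the walls
   ([equivariant_lipschitz]); thus g moves the base point k times less by the
   second representation than by the first, while the two displacements differ
   by a bounded amount if g moves a point of a given compact set into this set
   ([proper_of_contraction]).

   Such families are provided by [admits_of_model]. Given unit vectors x_i of
   R^n whose products are a constant sg if i and j commute and are small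
   otherwise, the hyperplanes orthogonal to the directions x_i, at a well-chosen
   common distance from the base point, form a family a. If the commutation
   graph has moreover a vertex colouring s with values in a simplex of R^c,
   adding small components s_i to the directions makes room for moving the
   hyperplanes closer to the base point while keeping the right angles: this is
   b. The map f is a homothety of the projective model, whose ratio is less than
   one. Here N = n + c.

   For a polygon with an even number k of sides, n = 2 and c = 1: the x_i are
   the directions of the vertices of a regular k-gon, and s is an alternating
   sign. Only the combinatorics of the polygon is used: sides which do not meet
   satisfy <v_i, v_j> < -1 ([disjoint_facets_lt]), and the others form a cycle of
   length k ([polygon_connected], [cycle_labelling]).

   For the 120-cell, n = c = 4: the x_i are the vertices of the 600-cell, which
   is the union of five 24-cells without edges, and so has a colouring with
   values in the vertices of a 4-dimensional simplex. It has to be shown that the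
   normals of the facets are arranged in this way. At a vertex there are four
   pairwise orthogonal facets ([vertex_structure]); by regularity all edges have
   the same length, and as the 2-faces are pentagons, its hyperbolic cosine is
   the golden ratio ([golden_cross]). Thus the facets at one end of an edge
   determine those at the other end. Following the edges, all normals are
   expressed in terms of four of them, by the formulas that produce the 600-cell
   from a tetrahedron by reflections ([all_realized]). The 120 vertices and their
   products are found by computing with exact coordinates in Z[phi]
   ([cell600_exists]). *)

Section LorentzianForm.
Variables (R : realType) (n : nat).
Implicit Types (x y z u : 'cV[R]_n.+1) (g : 'M[R]_n.+1) (t : R).
Local Notation J := (lorentz_mx R n).
Local Notation e := (delta_mx (ord_max : 'I_n.+1) (0 : 'I_1) : 'cV[R]_n.+1).

Lemma lorentzDl x y z : lorentz (x + y) z = lorentz x z + lorentz y z.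
Proof. by rewrite /lorentz linearD /= !mulmxDl mxE. Qed.

Lemma lorentzDr x y z : lorentz z (x + y) = lorentz z x + lorentz z y.
Proof. by rewrite /lorentz mulmxDr mxE. Qed.

Lemma lorentzZl t x y : lorentz (t *: x) y = t * lorentz x y.
Proof. by rewrite /lorentz linearZ /= -!scalemxAl mxE. Qed.

Lemma lorentzZr t x y : lorentz x (t *: y) = t * lorentz x y.
Proof. by rewrite /lorentz -scalemxAr mxE. Qed.

Lemma lorentzNl x y : lorentz (- x) y = - lorentz x y.
Proof. by rewrite -scaleN1r lorentzZl mulN1r. Qed.

Lemma lorentzNr x y : lorentz x (- y) = - lorentz x y.
Proof. by rewrite -scaleN1r lorentzZr mulN1r. Qed.

Lemma lorentz0l x : lorentz 0 x = 0.
Proof. by rewrite -(scale0r 0) lorentzZl mul0r. Qed.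

Definition lorentz_lin :=
  (lorentzDl, lorentzDr, lorentzNl, lorentzNr, lorentzZl, lorentzZr).

Lemma lorentz_suml (I : finType) (P : pred I) (F : I -> 'cV[R]_n.+1) y :
  lorentz (\sum_(i | P i) F i) y = \sum_(i | P i) lorentz (F i) y.
Proof.
by apply: (big_morph (fun x => lorentz x y)) => [? ?|];
  rewrite ?lorentzDl ?lorentz0l.
Qed.

Lemma lorentzE x y :
  lorentz x y = \sum_(i < n) x (widen_ord (leqnSn n) i) 0
                           * y (widen_ord (leqnSn n) i) 0
                - x ord_max 0 * y ord_max 0.
Proof.
rewrite /lorentz mxE big_ord_recr /=; congr (_ + _).
  apply: eq_bigr => i _; rewrite mul_mx_diag !mxE.
  case: eqP => [/(congr1 val)/= E|_]; last by rewrite mulr1.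
  by have := ltn_ord i; rewrite E ltnn.
by rewrite mul_mx_diag !mxE eqxx mulrN1 mulNr.
Qed.

Lemma lorentzC x y : lorentz x y = lorentz y x.
Proof.
rewrite !lorentzE [y ord_max 0 * _]mulrC; congr (_ - _).
by apply: eq_bigr => i _; rewrite mulrC.
Qed.

Lemma lorentz_mxK : J *m J = 1%:M.
Proof.
rewrite /lorentz_mx mulmx_diag -[RHS]diag_const_mx; congr diag_mx.
by apply/rowP => i; rewrite !mxE; case: eqP => _; rewrite ?mulr1 ?mulrNN ?mulr1.
Qed.

Lemma lorentz_nondeg x : (forall y, lorentz x y = 0) -> x = 0.
Proof.
move=> x0.
suff xJ0 : x^T *m J = 0.
  apply: trmx_inj; rewrite trmx0 -[x^T]mulmx1 -lorentz_mxK mulmxA xJ0.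
  by rewrite mul0mx.
apply/rowP => i; have := x0 (delta_mx i 0); rewrite /lorentz -colE.
by rewrite !mxE.
Qed.

Lemma On1P g : On1 g <-> forall x y, lorentz (g *m x) (g *m y) = lorentz x y.
Proof.
have E x y : lorentz (g *m x) (g *m y) = (x^T *m (g^T *m J *m g) *m y) 0 0.
  by rewrite /lorentz trmx_mul !mulmxA.
split=> [gO x y|gO]; first by rewrite E gO.
apply/matrixP => i j; have := gO (delta_mx i 0) (delta_mx j 0).
rewrite E /lorentz.
by rewrite -!colE !trmx_delta -!rowE !mxE.
Qed.

Lemma lorentz_sumr (I : finType) (P : pred I) (F : I -> 'cV[R]_n.+1) y :
  lorentz y (\sum_(i | P i) F i) = \sum_(i | P i) lorentz y (F i).
Proof. by rewrite lorentzC lorentz_suml; apply: eq_bigr => i _; rewrite lorentzC. Qed.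

Lemma lorentz_self x : lorentz x x =
  \sum_(i < n) x (widen_ord (leqnSn n) i) 0 ^+ 2 - x ord_max 0 ^+ 2.
Proof. by rewrite lorentzE; congr (_ - _); apply: eq_bigr => i _; rewrite expr2. Qed.

End LorentzianForm.

(** * Hyperbolic distance *)

Lemma cauchy_schwarz_sum (R : realFieldType) (I : finType) (a b : I -> R) :
  (\sum_i a i * b i) ^+ 2 <= (\sum_i a i ^+ 2) * (\sum_i b i ^+ 2).
Proof.
set A := \sum_i a i ^+ 2; set B := \sum_i b i ^+ 2; set C := \sum_i a i * b i.
have B0 : 0 <= B by apply: sumr_ge0 => i _; exact: sqr_ge0.
have [B_gt0|B_le0] := ltP 0 B; last first.
  have b0 i : b i = 0.
    have /eqP : B = 0 by apply/eqP; rewrite eq_le B_le0 B0.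
    rewrite psumr_eq0; last by move=> j _; exact: sqr_ge0.
    by move=> /allP/(_ i); rewrite mem_index_enum sqrf_eq0 => /(_ isT)/eqP.
  rewrite /C big1 ?expr0n ?mulr_ge0 //; last by move=> i _; rewrite b0 mulr0.
  by apply: sumr_ge0 => i _; exact: sqr_ge0.
suff : 0 <= B * (A * B - C ^+ 2) by rewrite pmulr_rge0 // subr_ge0.
have -> : B * (A * B - C ^+ 2) = \sum_i (B * a i - C * b i) ^+ 2.
  rewrite (eq_bigr (fun i => (B ^+ 2 * a i ^+ 2 + C ^+ 2 * b i ^+ 2)
    - 2 * B * C * (a i * b i))); last by move=> i _; ring.
  rewrite sumrB big_split /= -!mulr_sumr -/A -/B -/C; ring.
by apply: sumr_ge0 => i _; exact: sqr_ge0.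
Qed.

Section Acosh.
Variable R : realType.
Implicit Types c t : R.

Definition acosh c : R := ln (c + Num.sqrt (c ^+ 2 - 1)).

Lemma sqrt_coshK c : 1 <= c -> Num.sqrt (c ^+ 2 - 1) ^+ 2 = c ^+ 2 - 1.
Proof. by move=> c1; rewrite sqr_sqrtr // subr_ge0 expr_ge1 //; lra. Qed.

Lemma acosh_arg_ge1 c : 1 <= c -> 1 <= c + Num.sqrt (c ^+ 2 - 1).
Proof. by move=> c1; rewrite ler_wpDr ?sqrtr_ge0. Qed.

Lemma acosh_ge0 c : 1 <= c -> 0 <= acosh c.
Proof. by move=> c1; rewrite ln_ge0 // acosh_arg_ge1. Qed.

Lemma acosh1 : acosh 1 = 0.
Proof. by rewrite /acosh expr1n subrr sqrtr0 addr0 ln1. Qed.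

Lemma expR_acosh c : 1 <= c -> expR (acosh c) = c + Num.sqrt (c ^+ 2 - 1).
Proof. by move=> c1; rewrite lnK // posrE (lt_le_trans ltr01) // acosh_arg_ge1. Qed.

Lemma cosh_acosh c : 1 <= c -> expR (acosh c) + expR (- acosh c) = 2 * c.
Proof.
move=> c1; have := sqrt_coshK c1; have := acosh_arg_ge1 c1.
rewrite expRN expR_acosh //; set s := Num.sqrt _ => cs1 sE.
have -> : (c + s)^-1 = c - s; last by ring.
apply: (mulfI (x := c + s)); first by apply: lt0r_neq0; lra.
by rewrite divff; [nra|apply: lt0r_neq0; lra].
Qed.

Lemma ler_acosh c c' : 1 <= c -> c <= c' -> acosh c <= acosh c'.
Proof.
move=> c1 cc'; have c'1 := le_trans c1 cc'.
rewrite ler_ln ?posrE ?(lt_le_trans ltr01) ?acosh_arg_ge1 //.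
by rewrite lerD // ler_wsqrtr // lerD2r lerXn2r // nnegrE; lra.
Qed.

(** The addition formula for the hyperbolic cosine, of which the square root is
   the hyperbolic sine. *)
Lemma acoshD c c' : 1 <= c -> 1 <= c' ->
  acosh (c * c' + Num.sqrt (c ^+ 2 - 1) * Num.sqrt (c' ^+ 2 - 1))
  = acosh c + acosh c'.
Proof.
move=> c1 c'1; have := sqrt_coshK c1; have := sqrt_coshK c'1.
rewrite /acosh; set s := Num.sqrt (c ^+ 2 - 1).
set s' := Num.sqrt (c' ^+ 2 - 1) => s'E sE.
have s0 : 0 <= s by rewrite sqrtr_ge0.
have s'0 : 0 <= s' by rewrite sqrtr_ge0.
have -> : (c * c' + s * s') ^+ 2 - 1 = (c * s' + s * c') ^+ 2.
  have -> : (c * c' + s * s') ^+ 2 - 1 =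
     c ^+ 2 * c' ^+ 2 + s ^+ 2 * s' ^+ 2 + 2 * c * c' * s * s' - 1 by ring.
  have -> : (c * s' + s * c') ^+ 2 =
     c ^+ 2 * s' ^+ 2 + s ^+ 2 * c' ^+ 2 + 2 * c * c' * s * s' by ring.
  by rewrite sE s'E; ring.
rewrite sqrtr_sqr ger0_norm; last by rewrite addr_ge0 ?mulr_ge0 //; lra.
rewrite -lnM ?posrE; [|lra|lra].
by congr ln; ring.
Qed.

(** The half-angle formula: the square of the hyperbolic sine of half of [acosh c]
   is (c - 1) / 2. *)
Lemma sinh_half_acosh c : 1 <= c ->
  (expR (acosh c / 2) - expR (- (acosh c / 2))) ^+ 2 = 2 * (c - 1).
Proof.
move=> c1; have := cosh_acosh c1; set d := acosh c => dE.
have := expRxMexpNx_1 (d / 2).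
have -> : 2 * (c - 1) = expR d + expR (- d) - 2 by rewrite dE; ring.
have -> : expR d = expR (d / 2) ^+ 2 by rewrite expr2 -expRD; congr expR; field.
have -> : expR (- d) = expR (- (d / 2)) ^+ 2.
  by rewrite expr2 -expRD; congr expR; field.
by nra.
Qed.

Lemma sinh_ge t : 0 <= t <= 1 -> t * (2 - t) <= expR t - expR (- t).
Proof.
move=> /andP[t0 t1]; have := expR_ge1Dx t; have := expR_ge1Dx (- t).
have := expRxMexpNx_1 t; have := expR_gt0 (- t).
set a := expR t; set b := expR (- t) => b0 ab1 b1 a1.
have : (a - 1) * b >= t * b by rewrite ler_wpM2r //; lra.
nra.
Qed.

Lemma sinh_le t : 0 <= t < 1 -> (1 - t) * (expR t - expR (- t)) <= t * (2 - t).
Proof.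
move=> /andP[t0 t1]; have := expR_ge1Dx (- t).
have := expRxMexpNx_1 t; have := expR_gt0 t.
set a := expR t; set b := expR (- t) => a0 ab1 b1.
have : (1 - t) * a <= 1 by nra.
nra.
Qed.

(** An inequality between chords c - 1 becomes, for small distances, an
   inequality between distances; the constant al degrades to (1 + al) / 2
   because the hyperbolic sine is linear only to first order. *)
Lemma acosh_contract_small (al c c' : R) : 0 <= al < 1 -> 1 <= c -> 1 <= c' ->
  c' - 1 <= al ^+ 2 * (c - 1) -> acosh c <= 2 * ((1 - al) / 3) ->
  acosh c' <= (1 + al) / 2 * acosh c.
Proof.
move=> /andP[al0 al1] c1 c'1 ch small.
have dd' : acosh c' <= acosh c.
  apply: ler_acosh => //.
  have al2 : al ^+ 2 <= 1 by rewrite expr_le1 // ltW.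
  by nra.
have d0 := acosh_ge0 c1; have d'0 := acosh_ge0 c'1.
have := sinh_half_acosh c1; have := sinh_half_acosh c'1.
set t := acosh c / 2; set t' := acosh c' / 2.
have tE : acosh c = 2 * t by rewrite /t; field.
have t'E : acosh c' = 2 * t' by rewrite /t'; field.
rewrite tE t'E in small dd' d0 d'0 * => sE' sE.
set S := expR t - expR (- t) in sE; set S' := expR t' - expR (- t') in sE'.
have t01 : 0 <= t <= 1 by lra.
have t'01 : 0 <= t' <= 1 by lra.
have S0 : 0 <= S by have := sinh_ge t01; rewrite -/S; nra.
have S'0 : 0 <= S' by have := sinh_ge t'01; rewrite -/S'; nra.
have SS : S' <= al * S.
  rewrite -ler_sqr ?nnegrE ?mulr_ge0 // exprMn sE sE'; nra.
have l1 := sinh_ge t'01; rewrite -/S' in l1.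
have l2 : (1 - t) * S <= t * (2 - t) by apply: sinh_le; lra.
have l3 : (1 - t) * S' <= al * ((1 - t) * S).
  by rewrite mulrCA ler_wpM2l //; lra.
have l4 : (1 - t) * (t' * (2 - t')) <= (1 - t) * S' by rewrite ler_wpM2l //; lra.
have l5 : al * ((1 - t) * S) <= al * (t * (2 - t)) by rewrite ler_wpM2l.
have l6 : t' * ((1 - t) * (2 - t)) <= (1 - t) * (t' * (2 - t')).
  by rewrite mulrCA !ler_wpM2l //; lra.
have l7 : al * (t * (2 - t)) <= 2 * al * t.
  by have : 0 <= al * t ^+ 2 by [rewrite mulr_ge0 ?sqr_ge0]; nra.
have l8 : t' * (2 - 3 * t) <= t' * ((1 - t) * (2 - t)).
  by rewrite ler_wpM2l //; nra.
have l9 : t' * (1 + al) <= t' * (2 - 3 * t) by rewrite ler_wpM2l //; lra.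
have l10 : t' * (1 + al) <= 2 * al * t by lra.
rewrite -(ler_pM2r (x := 1 + al)); last by lra.
have : (1 - al) ^+ 2 * t >= 0 by rewrite mulr_ge0 ?sqr_ge0; lra.
nra.
Qed.

End Acosh.

Section HyperbolicGeometry.
Variables (R : realType) (n : nat).
Implicit Types (x y z u : 'cV[R]_n.+1) (g : 'M[R]_n.+1) (t : R).
Local Notation H := (@hyperbolic R n).

Definition future x := lorentz x x < 0 /\ 0 < x ord_max 0.

Lemma hyperbolic_future x : H x -> future x.
Proof. by move=> [xx x0]; split=> //; rewrite xx; lra. Qed.

Lemma future_lorentz_lt0 x y : future x -> future y -> lorentz x y < 0.
Proof.
move=> [xx x0] [yy y0]; move: xx yy; rewrite !lorentz_self lorentzE.
have := cauchy_schwarz_sum (fun i : 'I_n => x (widen_ord (leqnSn n) i) 0)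
                           (fun i : 'I_n => y (widen_ord (leqnSn n) i) 0).
set A := \sum_(i < n) _; set B := \sum_(i < n) x _ _ ^+ 2.
set C := \sum_(i < n) y _ _ ^+ 2.
have B0 : 0 <= B by apply: sumr_ge0 => i _; exact: sqr_ge0.
have C0 : 0 <= C by apply: sumr_ge0 => i _; exact: sqr_ge0.
set a := x ord_max 0 in x0 *; set b := y ord_max 0 in y0 * => ABC Ba Cb.
have : A ^+ 2 < (a * b) ^+ 2.
  apply: (le_lt_trans ABC); rewrite exprMn; nra.
rewrite -subr_gt0 subr_sqr => h.
have [|AB0] := ltP A (a * b); first by lra.
have ab0 : 0 < a * b by rewrite mulr_gt0.
nra.
Qed.

Lemma futureD x y : future x -> future y -> future (x + y).
Proof.
move=> fx fy; have xy := future_lorentz_lt0 fx fy.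
case: fx fy => [xx x0] [yy y0]; split; last by rewrite mxE addr_gt0.
by rewrite !lorentz_lin [lorentz y x]lorentzC; lra.
Qed.

Lemma futureZ t x : 0 < t -> future x -> future (t *: x).
Proof.
move=> t0 [xx x0]; split; last by rewrite mxE mulr_gt0.
by rewrite !lorentz_lin mulrA pmulr_rlt0 // mulr_gt0.
Qed.

(** The radial projection of the future cone onto the hyperboloid. *)
Definition normalize x := (Num.sqrt (- lorentz x x))^-1 *: x.

Lemma normalize_factor_gt0 x : future x -> 0 < (Num.sqrt (- lorentz x x))^-1.
Proof. by move=> [xx _]; rewrite invr_gt0 sqrtr_gt0 oppr_gt0. Qed.

Lemma normalize_hyperbolic x : future x -> H (normalize x).
Proof.
move=> fx; have s0 := normalize_factor_gt0 fx; have [xx x0] := fx.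
split; last by rewrite mxE mulr_gt0.
rewrite !lorentz_lin mulrA -expr2 exprVn sqr_sqrtr ?oppr_ge0 ?ltW //.
by rewrite invrN mulNr mulVf // lt_eqF.
Qed.

Lemma normalize_id x : H x -> normalize x = x.
Proof. by move=> [xx _]; rewrite /normalize xx opprK sqrtr1 invr1 scale1r. Qed.

Lemma lorentz_normalize_le0 x u : future x ->
  (lorentz (normalize x) u <= 0) = (lorentz x u <= 0).
Proof. by move=> fx; rewrite lorentzZl pmulr_rle0 // normalize_factor_gt0. Qed.

Lemma lorentz_normalize_eq0 x u : future x ->
  lorentz x u = 0 -> lorentz (normalize x) u = 0.
Proof. by move=> fx xu; rewrite lorentzZl xu mulr0. Qed.

(** The vectors orthogonal to a timelike one, the tangent vectors of the
   hyperboloid, form a Euclidean space: by the Cauchy-Schwarz inequality the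
   last coordinate of y is too small to make its norm negative. *)
Lemma tangent_ge0 z y : future z -> lorentz y z = 0 -> 0 <= lorentz y y.
Proof.
move=> [zz z0] /eqP; move: zz; rewrite !lorentz_self lorentzE subr_eq0 => zz /eqP yz.
have := cauchy_schwarz_sum (fun i : 'I_n => y (widen_ord (leqnSn n) i) 0)
                           (fun i : 'I_n => z (widen_ord (leqnSn n) i) 0).
rewrite yz.
set B := \sum_(i < n) z _ _ ^+ 2 in zz *.
set C := \sum_(i < n) y _ _ ^+ 2.
have C0 : 0 <= C by apply: sumr_ge0 => i _; exact: sqr_ge0.
set a := z ord_max 0 in zz z0 *; set b := y ord_max 0; rewrite exprMn => h.
have a2 : 0 < a ^+ 2 by rewrite exprn_gt0.
rewrite -(pmulr_rge0 _ a2); nra.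
Qed.

Lemma tangent_eq0 z y : future z -> lorentz y z = 0 -> lorentz y y = 0 -> y = 0.
Proof.
move=> [zz z0] /eqP; move: zz; rewrite !lorentz_self lorentzE subr_eq0 => zz /eqP yz.
have := cauchy_schwarz_sum (fun i : 'I_n => y (widen_ord (leqnSn n) i) 0)
                           (fun i : 'I_n => z (widen_ord (leqnSn n) i) 0).
rewrite yz.
set B := \sum_(i < n) z _ _ ^+ 2 in zz *.
have C0 : 0 <= \sum_(i < n) y (widen_ord (leqnSn n) i) 0 ^+ 2.
  by apply: sumr_ge0 => i _; exact: sqr_ge0.
have CE : (\sum_(i < n) y (widen_ord (leqnSn n) i) 0 ^+ 2 == 0) ->
    forall i : 'I_n, y (widen_ord (leqnSn n) i) 0 = 0.
  rewrite psumr_eq0; last by move=> j _; exact: sqr_ge0.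
  move=> /allP C0' i; apply/eqP.
  by have := C0' i; rewrite mem_index_enum sqrf_eq0 => /(_ isT).
set C := \sum_(i < n) y _ _ ^+ 2 in CE C0 *.
set a := z ord_max 0 in zz z0 *; set b := y ord_max 0 => h1 h2.
have C00 : C = 0.
  apply/eqP; rewrite eq_le C0 andbT.
  have : C * (a ^+ 2 - B) <= 0.
    have bC : b ^+ 2 = C by lra.
    by move: h1; rewrite exprMn bC; lra.
  by rewrite pmulr_lle0 //; lra.
have b0 : b = 0 by apply/eqP; rewrite -sqrf_eq0; apply/eqP; lra.
apply/colP => i; rewrite mxE; have [->//|ne] := eqVneq i ord_max.
have lt_in : (i < n)%N.
  rewrite ltn_neqAle -ltnS ltn_ord andbT.
  by apply: contra ne => /eqP E; apply/eqP/val_inj.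
rewrite -(CE _ (Ordinal lt_in)); first by congr (y _ _); exact: val_inj.
by apply/eqP.
Qed.

Lemma tangent_gt0 z y : future z -> lorentz y z = 0 -> y != 0 -> 0 < lorentz y y.
Proof.
move=> fz yz y0; rewrite lt_neqAle (tangent_ge0 fz yz) andbT.
by apply: contraNneq y0 => /esym/(tangent_eq0 fz yz)/eqP.
Qed.

Lemma tangent_cauchy_schwarz z x y : future z -> lorentz x z = 0 ->
  lorentz y z = 0 -> lorentz x y ^+ 2 <= lorentz x x * lorentz y y.
Proof.
move=> fz xz yz; have [->|x0] := eqVneq x 0.
  by rewrite !lorentz0l expr0n mul0r.
have xx : 0 < lorentz x x by apply: tangent_gt0 xz x0.
have := @tangent_ge0 z (lorentz x x *: y - lorentz x y *: x) fz.
rewrite !lorentz_lin xz yz !mulr0 oppr0 addr0 => /(_ erefl).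
rewrite [lorentz y x]lorentzC.
set a := lorentz x x in xx *; set b := lorentz x y; set c := lorentz y y => h.
have : 0 <= a * (a * c - b ^+ 2) by nra.
by rewrite pmulr_rge0 // subr_ge0.
Qed.

Lemma tangent_unit_le1 z x y : future z -> lorentz x z = 0 -> lorentz y z = 0 ->
  lorentz x x = 1 -> lorentz y y = 1 -> -1 <= lorentz x y <= 1.
Proof.
move=> fz xz yz xx yy; have := tangent_cauchy_schwarz fz xz yz.
by rewrite xx yy mulr1 => h; apply/andP; split; nra.
Qed.

Lemma hyperbolic_lorentz_le x y : H x -> H y -> lorentz x y <= -1.
Proof.
move=> hx hy; have xy := future_lorentz_lt0 (hyperbolic_future hx)
  (hyperbolic_future hy).
have [[xx _] [yy _]] := (hx, hy).
have := @tangent_ge0 x (y + lorentz x y *: x) (hyperbolic_future hx).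
rewrite !lorentz_lin xx yy [lorentz y x]lorentzC => /(_ _)/wrap[]; first by lra.
by nra.
Qed.

Lemma negative_hyperbolic x y : H x -> lorentz y y = -1 -> lorentz x y < 0 -> H y.
Proof.
move=> hx yy xy; split=> //; rewrite ltNge; apply/negP => y0.
have [y0'|y0'] := eqVneq (y ord_max 0) 0.
  move: yy; rewrite lorentz_self y0' expr0n subr0 => yy.
  have : 0 <= \sum_(i < n) y (widen_ord (leqnSn n) i) 0 ^+ 2.
    by apply: sumr_ge0 => i _; exact: sqr_ge0.
  by rewrite yy; lra.
have hy : H (- y).
  split; first by rewrite !lorentz_lin opprK.
  by rewrite mxE oppr_gt0 lt_neqAle y0' y0.
by have := hyperbolic_lorentz_le hx hy; rewrite lorentz_lin; lra.
Qed.

(** ** Reflections *)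

Lemma reflectionE u x : reflection u *m x = x - (2 * lorentz u x) *: u.
Proof.
rewrite /reflection mulmxBl mul1mx -scalemxAl -!mulmxA.
by rewrite [u^T *m _]mx11_scalar mul_mx_scalar scalerA /lorentz mulmxA.
Qed.

Lemma lorentz_reflection u x y : lorentz u u = 1 ->
  lorentz (reflection u *m x) (reflection u *m y) = lorentz x y.
Proof.
move=> uu; rewrite !reflectionE !lorentz_lin uu [lorentz x u]lorentzC.
by ring.
Qed.

Lemma reflectionK u x : lorentz u u = 1 ->
  reflection u *m (reflection u *m x) = x.
Proof.
move=> uu; rewrite !reflectionE !lorentz_lin uu -addrA -opprD -scalerDl.
by rewrite [X in X *: _](_ : _ = 0) ?scale0r ?subr0 //; ring.
Qed.

Lemma lorentz_reflection_adj u x y : lorentz u u = 1 ->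
  lorentz (reflection u *m x) y = lorentz x (reflection u *m y).
Proof. by move=> uu; rewrite -(lorentz_reflection x (reflection u *m y) uu) reflectionK. Qed.

Lemma reflection_fix u x : lorentz u x = 0 -> reflection u *m x = x.
Proof. by move=> ux; rewrite reflectionE ux mulr0 scale0r subr0. Qed.

Lemma reflection_hyperbolic u x : lorentz u u = 1 -> H x -> H (reflection u *m x).
Proof.
move=> uu hx; apply: (negative_hyperbolic hx).
  by rewrite lorentz_reflection //; case: hx.
rewrite reflectionE !lorentz_lin; case: hx => -> _.
by rewrite [lorentz x u]lorentzC; have := sqr_ge0 (lorentz u x); nra.
Qed.

(** ** The distance *)

Definition hdist x y := acosh (- lorentz x y).

Lemma hdist_ge0 x y : H x -> H y -> 0 <= hdist x y.
Proof. by move=> hx hy; apply: acosh_ge0; have := hyperbolic_lorentz_le hx hy; lra. Qed.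

Lemma hdistxx x : H x -> hdist x x = 0.
Proof. by move=> [xx _]; rewrite /hdist xx opprK acosh1. Qed.

Lemma hdist_triangle x y z : H x -> H y -> H z ->
  hdist x z <= hdist x y + hdist y z.
Proof.
move=> hx hy hz; have fy := hyperbolic_future hy.
have xy := hyperbolic_lorentz_le hx hy; have yz := hyperbolic_lorentz_le hy hz.
have xz := hyperbolic_lorentz_le hx hz.
rewrite /hdist -acoshD; [|lra|lra].
apply: ler_acosh; first by lra.
have [[[xx _] [yy _]] [zz _]] := (hx, hy, hz).
have := @tangent_cauchy_schwarz y (x + lorentz x y *: y) (z + lorentz y z *: y) fy.
rewrite !lorentz_lin xx yy zz [lorentz z y]lorentzC [lorentz y x]lorentzC.
move=> /(_ _ _)/wrap[]; [by lra|by lra|].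
set a := lorentz x y in xy *; set b := lorentz y z in yz *.
set c := lorentz x z in xz * => h.
have a1 : 1 <= - a by lra.
have b1 : 1 <= - b by lra.
have sa := sqrt_coshK a1; have sb := sqrt_coshK b1.
set s := Num.sqrt _ in sa *; set s' := Num.sqrt _ in sb *.
have s0 : 0 <= s by exact: sqrtr_ge0.
have s'0 : 0 <= s' by exact: sqrtr_ge0.
have : `|c + a * b| <= s * s'.
  rewrite -ler_sqr ?nnegrE ?normr_ge0 ?mulr_ge0 // real_normK ?num_real //.
  by rewrite exprMn sa sb; nra.
by rewrite ler_norml => /andP[]; nra.
Qed.

(** The point z, having nonnegative coefficients s and t, lies on the geodesic
   segment from x to y. *)
Lemma hdist_segment x y z s t : H x -> H y -> H z -> 0 <= s -> 0 <= t ->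
  z = s *: x + t *: y -> hdist x z + hdist z y = hdist x y.
Proof.
move=> hx hy hz s0 t0 zE; have xy := hyperbolic_lorentz_le hx hy.
have xz := hyperbolic_lorentz_le hx hz; have zy := hyperbolic_lorentz_le hz hy.
have [[[xx _] [yy _]] [zz _]] := (hx, hy, hz).
rewrite /hdist -acoshD; [|lra|lra].
move: zz xz zy; rewrite zE !lorentz_lin xx yy [lorentz y x]lorentzC.
move: xy; set c := lorentz x y => xy zz xz zy.
have -> : (- (s * -1 + t * c)) ^+ 2 - 1 = t ^+ 2 * ((- c) ^+ 2 - 1) by nra.
have -> : (- (s * c + t * -1)) ^+ 2 - 1 = s ^+ 2 * ((- c) ^+ 2 - 1) by nra.
rewrite [Num.sqrt (t ^+ 2 * _)]sqrtrM ?sqr_ge0 //.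
rewrite [Num.sqrt (s ^+ 2 * _)]sqrtrM ?sqr_ge0 // !sqrtr_sqr !ger0_norm //.
have c1 : 1 <= - c by lra.
have := sqrt_coshK c1; set r := Num.sqrt _ => rr.
congr acosh.
have -> : t * r * (s * r) = s * t * r ^+ 2 by ring.
rewrite rr; nra.
Qed.

Definition midpoint x y := normalize (x + y).

Lemma midpoint_hyperbolic x y : H x -> H y -> H (midpoint x y).
Proof.
by move=> hx hy; apply: normalize_hyperbolic; apply: futureD;
  exact: hyperbolic_future.
Qed.

Lemma hdist_midpoint x y : H x -> H y ->
  hdist x (midpoint x y) = hdist x y / 2 /\ hdist (midpoint x y) y = hdist x y / 2.
Proof.
move=> hx hy; have hm := midpoint_hyperbolic hx hy.
set s := (Num.sqrt (- lorentz (x + y) (x + y)))^-1.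
have s0 : 0 <= s by rewrite invr_ge0 sqrtr_ge0.
have := hdist_segment hx hy hm s0 s0 (scalerDr _ _ _).
have -> : hdist (midpoint x y) y = hdist x (midpoint x y).
  rewrite /hdist /midpoint /normalize !lorentz_lin; case: hx hy => -> _ [-> _].
  by congr (acosh (- (_ * _))); rewrite addrC.
by move=> E; split; lra.
Qed.

End HyperbolicGeometry.

(** A map of the hyperboloid which shrinks chords by a factor al is Lipschitz
   with constant (1 + al) / 2 at small scale, hence at every scale, as any two
   points can be joined through midpoints. *)
Lemma lipschitz_of_chords (R : realType) (n N : nat) (al : R)
    (f : 'cV[R]_n.+1 -> 'cV[R]_N.+1) :
  0 <= al < 1 -> (forall x, hyperbolic x -> hyperbolic (f x)) ->
  (forall x y, hyperbolic x -> hyperbolic y ->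
     - lorentz (f x) (f y) - 1 <= al ^+ 2 * (- lorentz x y - 1)) ->
  forall x y, hyperbolic x -> hyperbolic y ->
    hdist (f x) (f y) <= (1 + al) / 2 * hdist x y.
Proof.
move=> al01 fH chord.
set e := 2 * ((1 - al) / 3).
have e0 : 0 < e by case/andP: al01; rewrite /e; lra.
have step p x y : hyperbolic x -> hyperbolic y -> hdist x y <= 2 ^+ p * e ->
    hdist (f x) (f y) <= (1 + al) / 2 * hdist x y.
  elim: p x y => [|p IH] x y hx hy.
    rewrite expr0 mul1r => small; apply: acosh_contract_small => //.
    - by have := hyperbolic_lorentz_le hx hy; lra.
    - by have := hyperbolic_lorentz_le (fH _ hx) (fH _ hy); lra.
    - exact: chord.
  rewrite exprS => small; have [xm my] := hdist_midpoint hx hy.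
  have hm := midpoint_hyperbolic hx hy.
  have := hdist_triangle (fH _ hx) (fH _ hm) (fH _ hy).
  have := IH _ _ hx hm; have := IH _ _ hm hy; rewrite xm my.
  by move=> /(_ _)/wrap[|h1 /(_ _)/wrap[|h2]]; [lra|lra|lra].
move=> x y hx hy; pose p := Num.truncn (hdist x y / e).
apply: (step p.+1) => //; rewrite -ler_pdivrMr //.
have h0 : 0 <= hdist x y / e by rewrite divr_ge0 ?hdist_ge0 // ltW.
have := truncnS_gt (hdist x y / e); rewrite -/p => /ltW /le_trans; apply.
by rewrite -natrX ler_nat ltnW // ltn_expl.
Qed.

(** * Right-angled Coxeter groups generated by reflections *)

Lemma mulmx_ext (R : pzSemiRingType) (p q : nat) (A B : 'M[R]_(p, q)) :
  (forall x : 'cV_q, A *m x = B *m x) -> A = B.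
Proof.
move=> AB; apply/matrixP => i j; have := AB (delta_mx j 0).
by rewrite -!colE => /matrixP/(_ i 0); rewrite !mxE.
Qed.

Section Words.
Variables (m : nat) (E : rel 'I_m).
Hypothesis Esym : symmetric E.
Implicit Types (i j : 'I_m) (u w : seq 'I_m).

(** Rewriting in the right-angled Coxeter group of the graph [E].  Orienting
   the relation i i = 1 makes each step preserve or shorten the length. *)
Inductive coxeter_step : seq 'I_m -> seq 'I_m -> Prop :=
| CoxRefl u : coxeter_step u u
| CoxTrans u w u' : coxeter_step u w -> coxeter_step w u' -> coxeter_step u u'
| CoxCons i u w : coxeter_step u w -> coxeter_step (i :: u) (i :: w)
| CoxSquare i u : coxeter_step [:: i, i & u] u
| CoxCommute i j u : E i j -> coxeter_step [:: i, j & u] [:: j, i & u].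

Definition reduced u := forall w, coxeter_step u w -> (size u <= size w)%N.

Lemma reduced_exists u : exists2 w, coxeter_step u w & reduced w.
Proof.
have [k] := ubnP (size u); elim: k u => // k IH u uk.
have [ru|] := pselect (reduced u); first by exists u => //; exact: CoxRefl.
move=> /existsNP[w /not_implyP[uw /negP]]; rewrite -ltnNge => wu.
have [w' ww' rw'] := IH w (leq_trans wu uk).
by exists w' => //; exact: CoxTrans ww'.
Qed.

Lemma reduced_behead i u : reduced (i :: u) -> reduced u.
Proof. by move=> ru w uw; have := ru (i :: w) (CoxCons _ uw). Qed.

Section Config.
Variables (R : realType) (n : nat).
Implicit Types (x y z : 'cV[R]_n.+1) (a : 'I_m -> 'cV[R]_n.+1).

Definition coxeter_config a :=
  [/\ forall i, lorentz (a i) (a i) = 1,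
      forall i j, E i j -> lorentz (a i) (a j) = 0
    & forall i j, i != j -> E i j \/ lorentz (a i) (a j) <= -1].

Variable a : 'I_m -> 'cV[R]_n.+1.
Hypothesis aC : coxeter_config a.

Definition act u : 'M[R]_n.+1 :=
  foldr (fun i g => reflection (a i) *m g) 1%:M u.

(** The action of the inverse of [act u], which by [lorentz_pull] is its adjoint;
   it is applied to the normals of the walls. *)
Definition pull u z := foldl (fun y i => reflection (a i) *m y) z u.

Let a1 i : lorentz (a i) (a i) = 1. Proof. by case: aC. Qed.
Let aE i j : E i j -> lorentz (a i) (a j) = 0. Proof. by case: aC => _ + _; apply. Qed.

Lemma act_cons i u x : act (i :: u) *m x = reflection (a i) *m (act u *m x).
Proof. by rewrite /= mulmxA. Qed.

Lemma act_cat u w : act (u ++ w) = act u *m act w.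
Proof. by elim: u => [|i u IH] /=; rewrite ?mul1mx // IH mulmxA. Qed.

Lemma lorentz_act u x y : lorentz (act u *m x) (act u *m y) = lorentz x y.
Proof.
by elim: u => [|i u IH]; rewrite ?mul1mx // !act_cons lorentz_reflection.
Qed.

Lemma act_On1 u : On1 (act u).
Proof. by apply/On1P => x y; exact: lorentz_act. Qed.

Lemma act_hyperbolic u x : hyperbolic x -> hyperbolic (act u *m x).
Proof.
move=> hx; elim: u => [|i u IH]; rewrite ?mul1mx // act_cons.
exact: reflection_hyperbolic.
Qed.

Lemma reflection_mxK i : reflection (a i) *m reflection (a i) = 1%:M.
Proof.
by apply: mulmx_ext => x; rewrite mul1mx -mulmxA reflectionK.
Qed.

Lemma act_rcons u i : act (rcons u i) = act u *m reflection (a i).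
Proof. by rewrite -cats1 act_cat /= mulmx1. Qed.

Lemma act_revl u : act (rev u) *m act u = 1%:M.
Proof.
elim: u => [|i u IH]; first by rewrite mulmx1.
rewrite rev_cons act_rcons /= mulmxA -[act (rev u) *m _ *m _]mulmxA.
by rewrite reflection_mxK mulmx1.
Qed.

Lemma act_revr u : act u *m act (rev u) = 1%:M.
Proof. by have := act_revl (rev u); rewrite revK. Qed.

Lemma act_step u w : coxeter_step u w -> act u = act w.
Proof.
elim=> {u w} [//|u w u' _ -> _ -> //|i u w _ IH|i u|i j u /aE ij].
- by rewrite /= IH.
- by rewrite /= mulmxA reflection_mxK mul1mx.
apply: mulmx_ext => x; rewrite !act_cons.
rewrite !reflectionE !lorentz_lin [lorentz (a j) (a i)]lorentzC ij !mulr0 !subr0.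
by rewrite -!addrA [- _ - _]addrC.
Qed.

Lemma lorentz_pull u z y : lorentz (pull u z) y = lorentz z (act u *m y).
Proof.
elim: u z => [|i u IH] z /=; first by rewrite mul1mx.
by rewrite IH -mulmxA lorentz_reflection_adj.
Qed.

Lemma pull_step u w z : coxeter_step u w -> pull u z = pull w z.
Proof.
move=> /act_step uw; apply/eqP; rewrite -subr_eq0; apply/eqP.
apply: lorentz_nondeg => y.
by rewrite !lorentz_lin !lorentz_pull uw subrr.
Qed.

Lemma pullD u x y t : pull u (x + t *: y) = pull u x + t *: pull u y.
Proof.
elim: u x y => [//|i u IH] x y /=.
by rewrite mulmxDr -scalemxAr IH.
Qed.

Section Dichotomy.
Variable N : 'cV[R]_n.+1 -> Prop.
Hypothesis Na : forall i, N (a i).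
Hypothesis ND : forall x y t, N x -> N y -> 0 <= t -> N (x + t *: y).

(** Every root is positive or negative, and it is negative only if the word
   can be rewritten to begin with the corresponding letter.  Here the positive
   roots are those in [N], an arbitrary convex cone (or translate of one)
   containing the simple roots; the usual choice is the cone they span, but
   sharper conclusions come from other choices of [N].
   In the induction, the positivity of the sums of two simple roots generating
   an infinite dihedral group replaces the reduction to dihedral subgroups:
   applying s_j to a_i gives a_i + 2 X a_j = (a_i + a_j) + (2 X - 1) a_j, where
   X = - <a_i, a_j> is at least 1. *)
Lemma root_dichotomy u :
  (forall i, N (pull u (a i)) \/
     exists2 w, coxeter_step u (i :: w) & (size w < size u)%N) /\
  (forall i j, lorentz (a i) (a j) <= -1 -> N (pull u (a i + a j))).
Proof.
have [k] := ubnP (size u); elim: k u => // k IH u; rewrite ltnS => uk.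
have ind w : (size w < size u)%N ->
  (forall i, N (pull w (a i)) \/
     exists2 w', coxeter_step w (i :: w') & (size w' < size w)%N) /\
  (forall i j, lorentz (a i) (a j) <= -1 -> N (pull w (a i + a j))).
  by move=> wu; apply: IH; exact: leq_trans wu uk.
have signs i : N (pull u (a i)) \/
    exists2 w, coxeter_step u (i :: w) & (size w < size u)%N.
  case: u uk ind => [|j u1] uk ind; first by left; exact: Na.
  have [R1 Q1] := ind u1 (ltnSn _).
  have [->|ij] := eqVneq i j; first by right; exists u1 => //; exact: CoxRefl.
  have [_ _ /(_ i j ij)[Eij|gij]] := aC.
    have fix_i : reflection (a j) *m a i = a i.
      by rewrite reflection_fix // lorentzC aE.
    rewrite /= fix_i; have [|[w u1w wu1]] := R1 i; first by left.
    right; exists (j :: w) => //.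
    by apply: CoxTrans (CoxCons _ u1w) _; apply: CoxCommute; rewrite Esym.
  have reflE : reflection (a j) *m a i
      = (a i + a j) + (- 2 * lorentz (a i) (a j) - 1) *: a j.
    rewrite reflectionE [lorentz (a j) _]lorentzC -addrA; congr (_ + _).
    by rewrite -[X in X + _]scale1r -scalerDl -scaleNr; congr (_ *: _); ring.
  have [Nj|[w u1w wu1]] := R1 j.
    left; rewrite /= reflE pullD; apply: ND => //; first exact: Q1.
    by lra.
  have uw : coxeter_step (j :: u1) w.
    by apply: CoxTrans (CoxCons _ u1w) _; exact: CoxSquare.
  have wu : (size w < size (j :: u1))%N by exact: ltnW.
  have [Rw _] := ind w wu.
  rewrite (pull_step _ uw); have [|[w' ww' w'w]] := Rw i; first by left.
  right; exists w'; first exact: CoxTrans uw ww'.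
  exact: ltn_trans w'w wu.
split=> //.
(* if the word begins with j, removing j changes a_i + a_j into
   (a_i + a_j) + (2 X - 2) a_j *)
have key i j : lorentz (a i) (a j) <= -1 ->
    (exists2 w, coxeter_step u (j :: w) & (size w < size u)%N) ->
    N (pull u (a i + a j)).
  move=> gij [w uw wu]; rewrite (pull_step _ uw) /=.
  have [Rw Qw] := ind w wu.
  have -> : reflection (a j) *m (a i + a j)
      = (a i + a j) + (- 2 * lorentz (a i) (a j) - 2) *: a j.
    rewrite reflectionE lorentz_lin a1 [lorentz (a j) _]lorentzC -addrA -scaleNr.
    by rewrite -addrA; congr (_ + (_ + _ *: _)); ring.
  have [Nj|[w' ww' w'w]] := Rw j.
    by rewrite pullD; apply: ND => //; [exact: Qw|lra].
  rewrite -[_ + _ *: _](_ : reflection (a j) *m (a i + a j) = _); last first.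
    rewrite reflectionE lorentz_lin a1 [lorentz (a j) _]lorentzC -addrA -scaleNr.
    by rewrite -addrA; congr (_ + (_ + _ *: _)); ring.
  rewrite -[pull w _]/(pull (j :: w) (a i + a j)).
  have jww' : coxeter_step (j :: w) w'.
    by apply: CoxTrans (CoxCons _ ww') _; exact: CoxSquare.
  rewrite (pull_step _ jww'); apply: (ind w' (ltn_trans w'w wu)).2 => //.
move=> i j gij.
have [Ni|negi] := signs i; last by rewrite addrC; apply: key => //; rewrite lorentzC.
have [Nj|negj] := signs j; last exact: key.
rewrite -[a j]scale1r pullD; apply: ND => //; exact: ler01.
Qed.

End Dichotomy.

Lemma reduced_negative_root i u x e : reduced (i :: u) ->
  (forall j, lorentz x (a j) <= - e) -> 0 <= e -> lorentz (act u *m x) (a i) <= - e.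
Proof.
move=> ru xa e0; rewrite lorentzC -lorentz_pull.
pose N z := lorentz z x <= - e.
have Na j : N (a j) by rewrite /N lorentzC.
have ND y z t : N y -> N z -> 0 <= t -> N (y + t *: z).
  by rewrite /N !lorentz_lin => yx zx t0; nra.
have [//|[w uw wu]] := (root_dichotomy Na ND u).1 i.
have := ru w; rewrite leqNgt ltnS (ltnW wu) => /(_ _)/wrap[] //.
by apply: CoxTrans (CoxCons _ uw) _; exact: CoxSquare.
Qed.

(** A nonempty reduced word would begin with a letter whose root is negative at
   x, by [reduced_negative_root], so that the image of x would be beyond the
   wall of this letter, by at least e. *)
Lemma trivial_of_chamber u x e : 0 < e -> (forall j, lorentz x (a j) <= - e) ->
  (forall j, lorentz (act u *m x) (a j) < e) -> coxeter_step u [::].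
Proof.
move=> e0 xa ux; have [w uw rw] := reduced_exists u.
case: w uw rw => [//|i w] uw rw.
have := reduced_negative_root rw xa (ltW e0); have := ux i.
rewrite (act_step uw) act_cons lorentz_reflection_adj //.
rewrite reflectionE a1 mulr1 !lorentz_lin.
by lra.
Qed.

(** A letter i prepended to a word adds -2 <x, a_i> <g x, a_i>, where both
   products are at most -e, the second by [reduced_negative_root]. *)
Lemma reduced_growth u x e : reduced u -> 0 <= e -> hyperbolic x ->
  (forall j, lorentz x (a j) <= - e) ->
  1 + 2 * e ^+ 2 * (size u)%:R <= - lorentz x (act u *m x).
Proof.
move=> + e0 hx xa; elim: u => [|i u IH] ru.
  by rewrite mul1mx mulr0 addr0; case: hx => -> _; rewrite opprK.
have := IH (reduced_behead ru); have := reduced_negative_root ru xa e0.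
rewrite act_cons reflectionE !lorentz_lin [lorentz (a i) _]lorentzC /= => h1 h2.
rewrite -natr1; have := xa i; nra.
Qed.

End Config.
End Words.

(** * A contraction criterion for proper actions *)

Lemma finite_uniform (R : realFieldType) (m : nat) (F : 'I_m -> R) :
  (forall i, F i < 0) -> exists2 e, 0 < e & forall i, F i <= - e.
Proof.
elim: m F => [|m IH] F F0; first by exists 1 => // -[].
have [e e0 eF] := IH (fun i => F (lift ord0 i)) (fun i => F0 _).
exists (Num.min e (- F ord0)); first by rewrite lt_min e0 oppr_gt0 F0.
move=> i; case: (unliftP ord0 i) => [j ->|->]; rewrite lerNr ge_min.
  by rewrite -lerNr eF.
by rewrite lexx orbT.
Qed.

Section Contraction.
Variables (R : realType) (m n N : nat) (E : rel 'I_m).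
Hypothesis Esym : symmetric E.
Variables (a : 'I_m -> 'cV[R]_n.+1) (b : 'I_m -> 'cV[R]_N.+1).
Hypotheses (aC : coxeter_config E a) (bC : coxeter_config E b).

(** The geodesic from x to y leaves the chamber through one of the walls that
   separate y from x, the one that minimizes the ratio r. *)
Lemma exit_segment x y i0 : poly_of a x -> hyperbolic y ->
  0 < lorentz y (a i0) -> exists i z, [/\ poly_of a z, lorentz z (a i) = 0,
    0 < lorentz y (a i) & hdist x z + hdist z y = hdist x y].
Proof.
move=> [hx xa] hy y0; pose r i := - lorentz x (a i) / lorentz y (a i).
case: (Order.TotalTheory.arg_minP r (P := fun i => 0 < lorentz y (a i)) y0) => i yi ri.
have ri0 : 0 <= r i by rewrite divr_ge0 ?oppr_ge0 // ltW.
have fw : future (x + r i *: y).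
  have [->|rne] := eqVneq (r i) 0.
    by rewrite scale0r addr0; exact: hyperbolic_future.
  apply: futureD; first exact: hyperbolic_future.
  by apply: futureZ; [rewrite lt_neqAle eq_sym rne|exact: hyperbolic_future].
have wj j : lorentz (x + r i *: y) (a j) <= 0.
  rewrite !lorentz_lin; have [yj|yj] := ltP 0 (lorentz y (a j)); last first.
    by rewrite -[leRHS]addr0 lerD // mulr_ge0_le0.
  by have := ri j yj; rewrite ler_pdivlMr //; lra.
have wi : lorentz (x + r i *: y) (a i) = 0.
  by rewrite !lorentz_lin divfK ?subrr // lt0r_neq0.
exists i, (normalize (x + r i *: y)); split=> //.
- by split; [exact: normalize_hyperbolic|move=> j; rewrite lorentz_normalize_le0].
- exact: lorentz_normalize_eq0.
have s0 := ltW (normalize_factor_gt0 fw).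
have hz := normalize_hyperbolic fw.
apply: (hdist_segment hx hy hz s0 (mulr_ge0 s0 ri0)).
by rewrite /normalize scalerDr scalerA.
Qed.

Variables (f : 'cV[R]_n.+1 -> 'cV[R]_N.+1) (k : R).
Hypothesis fH : forall x, hyperbolic x -> hyperbolic (f x).
Hypothesis fa : forall x i, hyperbolic x -> lorentz x (a i) = 0 ->
  lorentz (f x) (b i) = 0.
Hypothesis fL : forall x y, hyperbolic x -> hyperbolic y ->
  hdist (f x) (f y) <= k * hdist x y.

(** The equivariant extension of [f] from the chamber to its whole orbit is
   Lipschitz with the same constant: a geodesic is cut at the wall where it
   leaves the chamber, and the rest of it is reflected; by
   [root_dichotomy] this shortens the word relating its ends. *)
Lemma equivariant_lipschitz u x y : poly_of a x -> poly_of a y ->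
  hdist (f x) (act b u *m f y) <= k * hdist x (act a u *m y).
Proof.
have [l] := ubnP (size u); elim: l u x => // l IH u x; rewrite ltnS => ul px py.
have hx := px.1; have hy := py.1.
have hay := act_hyperbolic aC u hy.
have hbfy := act_hyperbolic bC u (fH hy).
pose Ny z := lorentz z y <= 0.
have Na j : Ny (a j) by rewrite /Ny lorentzC; exact: py.2.
have ND z w t : Ny z -> Ny w -> 0 <= t -> Ny (z + t *: w).
  by rewrite /Ny !lorentz_lin => zy wy t0; nra.
have dich w i := (root_dichotomy Esym aC Na ND w).1 i.
(* a point z of the chamber on the wall i, with a shorter word for the rest *)
have step i z w : poly_of a z -> lorentz z (a i) = 0 ->
    hdist x z + hdist z (act a u *m y) = hdist x (act a u *m y) ->
    coxeter_step E u (i :: w) -> (size w < size u)%N ->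
    hdist (f x) (act b u *m f y) <= k * hdist x (act a u *m y).
  move=> pz zi xzy uw wu; have hz := pz.1.
  have bzi : reflection (b i) *m f z = f z.
    by rewrite reflection_fix // lorentzC fa.
  have azi : reflection (a i) *m z = z by rewrite reflection_fix // lorentzC.
  have h1 := hdist_triangle (fH hx) (fH hz) hbfy.
  have h2 : hdist (f z) (act b u *m f y) <= k * hdist z (act a u *m y).
    rewrite (act_step bC uw) (act_step aC uw) !act_cons.
    have b1 : lorentz (b i) (b i) = 1 by case: bC.
    have a1 : lorentz (a i) (a i) = 1 by case: aC.
    rewrite /hdist -lorentz_reflection_adj // bzi -lorentz_reflection_adj // azi.
    by apply: IH => //; exact: leq_trans wu ul.
  by rewrite -xzy mulrDr; have := fL hx hz; lra.
have [[i0 y0]|] := pselect (exists i, 0 < lorentz (act a u *m y) (a i)).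
  have [i [z [pz zi yi xzy]]] := exit_segment px hay y0.
  have [|[w uw wu]] := dich u i; last exact: step zi xzy uw wu.
  by rewrite /Ny (lorentz_pull aC) lorentzC => yi'; move: yi; rewrite ltNge yi'.
move=> /forallNP yle0.
have pay : poly_of a (act a u *m y).
  by split=> // i; rewrite leNgt; apply/negP.
case: u ul hay hbfy step pay {yle0} => [|i u] ul hay hbfy step pay.
  by rewrite !mul1mx fL.
have a1 : lorentz (a i) (a i) = 1 by case: aC.
have [|[w uw wu]] := dich u i; last first.
  have iw : coxeter_step E (i :: u) w.
    by apply: CoxTrans (CoxCons _ uw) _; exact: CoxSquare.
  rewrite (act_step bC iw) (act_step aC iw).
  by apply: IH => //; apply: leq_trans ul; rewrite ltnS ltnW.
rewrite /Ny (lorentz_pull aC) lorentzC => yi.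
have wall : lorentz (act a (i :: u) *m y) (a i) = 0.
  apply/eqP; rewrite eq_le; apply/andP; split; first exact: pay.2.
  rewrite act_cons lorentz_reflection_adj // reflectionE a1 !lorentz_lin.
  by move: yi; rewrite lorentzC; lra.
apply: (step i _ u pay wall) => //; last exact: CoxRefl.
by rewrite hdistxx // addr0.
Qed.

End Contraction.

(** ** Representations of the reflection group *)

Section ReflectionGroup.
Variables (R : realType) (m p : nat) (E : rel 'I_m).
Hypothesis Esym : symmetric E.
Variable v : 'I_m -> 'cV[R]_p.+1.
Hypothesis vC : coxeter_config E v.

Lemma is_matrix_group_act : is_matrix_group [set g | exists u, g = act v u].
Proof.
have actV := act_revr vC.
split.
- by exists [::].
- by move=> _ _ [u ->] [w ->]; exists (u ++ w); rewrite act_cat.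
- move=> _ [u ->]; exists (rev u).
  have /mulmx1_unit[uU _] := actV u.
  by rewrite -[LHS]mulmx1 -(actV u) mulmxA mulVmx // mul1mx.
Qed.

Lemma reflection_groupE : reflection_group v = [set g | exists u, g = act v u].
Proof.
apply/seteqP; split.
  apply: smallest_sub; first exact: is_matrix_group_act.
  by move=> _ [i _ <-]; exists [:: i]; rewrite /= mulmx1.
move=> _ [u ->] G /= [[G1 GM _] Gv]; elim: u => [//|i u IH].
by apply: GM => //; apply: Gv; exists i.
Qed.

Variable ov : 'cV[R]_p.+1.
Hypothesis ovP : forall i, lorentz ov (v i) < 0.

Section Transfer.
Variables (N : nat) (a : 'I_m -> 'cV[R]_N.+1).
Hypothesis aC : coxeter_config E a.

(** Words acting equally in one configuration with a nonempty chamber are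
   equal in the Coxeter group, hence act equally in every configuration. *)
Lemma act_transfer u w : act v u = act v w -> act a u = act a w.
Proof.
move=> uw; have [e e0 oe] := finite_uniform ovP.
have E0 : act v (rev w ++ u) = 1%:M by rewrite act_cat uw (act_revl vC).
have : coxeter_step E (rev w ++ u) [::].
  apply: (trivial_of_chamber Esym vC e0 oe) => j.
  by rewrite E0 mul1mx (le_lt_trans (oe j)) //; lra.
move=> /(act_step aC); rewrite act_cat /= => wu.
have wV := act_revr aC w.
by rewrite -[LHS]mul1mx -wV -mulmxA wu mulmx1.
Qed.

(** The representation of the group generated by the reflections in the v_i
   which sends each of them to the reflection in a_i. *)
Definition transfer (g : 'M[R]_p.+1) : 'M[R]_N.+1 :=
  act a (xget [::] [set u | act v u = g]).

Lemma transferE u : transfer (act v u) = act a u.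
Proof. by apply: act_transfer; apply: (@xgetPex _ _ [set w | act v w = _]); exists u. Qed.

Lemma transfer_representation :
  Defs.representation (reflection_group v) transfer.
Proof.
rewrite reflection_groupE; split.
  by move=> _ [u ->]; rewrite transferE; apply: act_On1 aC _.
by move=> _ _ [u ->] [w ->]; rewrite -act_cat !transferE act_cat.
Qed.

Variable oa : 'cV[R]_N.+1.
Hypothesis oaP : forall i, lorentz oa (a i) < 0.

Lemma continuous_bigsum (T : topologicalType) (I : finType) (F : I -> T -> R) :
  (forall i, continuous (F i)) -> continuous (fun x => \sum_i F i x).
Proof.
move=> cF x; rewrite (_ : (fun y => _) = \sum_i F i); last first.
  by apply/funext => y; rewrite fct_sumE.
elim/big_ind: _ => [|g h cg ch|i _]; first exact: cst_continuous.
- exact: continuousD.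
- exact: cF.
Qed.

Lemma continuous_lorentz_mulmx x y :
  continuous (fun M : 'M[R]_N.+1 => lorentz (M *m x) y).
Proof.
rewrite (_ : (fun M => _) = fun M : 'M[R]_N.+1 =>
    \sum_i \sum_j (M i j * (x j 0 * (lorentz_mx R N *m y) i 0))); last first.
  apply/funext => M; rewrite /lorentz -mulmxA mxE; apply: eq_bigr => i _.
  by rewrite !mxE mulr_suml; apply: eq_bigr => j _; rewrite mulrA.
apply: continuous_bigsum => i; apply: continuous_bigsum => j M.
apply: (continuousM (@coord_continuous R _ _ i j M)); exact: cst_continuous.
Qed.

(** A neighbourhood of [act a w] is given by the strict inequalities which say
   that the base point is sent inside the chamber of w; by
   [trivial_of_chamber] no other element of the group satisfies them. *)
Lemma transfer_faithful_discrete :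
  faithful_discrete (reflection_group v) transfer.
Proof.
have [e e0 oe] := finite_uniform oaP.
have sep u w : (forall j, lorentz (act a u *m oa) (act a w *m a j) < 0) ->
    act v u = act v w.
  move=> uw; have : coxeter_step E (rev w ++ u) [::].
    apply: (trivial_of_chamber Esym aC e0 oe) => j; apply: lt_trans e0.
    rewrite act_cat -mulmxA -(lorentz_act aC w (act a (rev w) *m _)) mulmxA.
    by rewrite (act_revr aC) mul1mx; exact: uw.
  move=> /(act_step vC); rewrite act_cat /= => wu.
  have wV := act_revr vC w.
  by rewrite -[LHS]mul1mx -wV -mulmxA wu mulmx1.
rewrite reflection_groupE; split.
  move=> g h /set_mem[u ->] /set_mem[w ->]; rewrite !transferE => uw.
  by apply: sep => j; rewrite uw (lorentz_act aC).
move=> _ [_ [w ->] <-]; rewrite transferE; split.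
  by apply/mem_set; exists (act v w); [exists w|rewrite transferE].
exists [set M | forall j, lorentz (M *m oa) (act a w *m a j) < 0].
  apply: (@filter_forall _ _
    (fun j (M : 'M[R]_N.+1) => lorentz (M *m oa) (act a w *m a j) < 0)
    (nbhs (act a w)) (nbhs_filter _)) => j.
  have neg : nbhs (lorentz (act a w *m oa) (act a w *m a j)) [set r | r < 0].
    apply: open_nbhs_nbhs; split; first exact: open_lt.
    by rewrite /= (lorentz_act aC).
  exact: (@continuous_lorentz_mulmx oa (act a w *m a j) (act a w) _ neg).
apply/seteqP; split=> [M [Mo [_ [u ->] uM]]|_ ->].
  by move: Mo; rewrite -uM transferE => /sep /act_transfer.
split; last by exists (act v w); [exists w|rewrite transferE].
by move=> j; rewrite (lorentz_act aC).
Qed.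

End Transfer.
End ReflectionGroup.

(** If the displacements da and db satisfy db <= k da with k < 1 while their
   hyperbolic cosines are comparable, then da is bounded. *)
Lemma bounded_displacement (R : realType) (k K da db A B : R) :
  0 <= k < 1 -> 0 <= K -> 0 <= da -> 0 <= db -> db <= k * da ->
  expR da + expR (- da) = 2 * A -> expR db + expR (- db) = 2 * B ->
  A <= K * (1 + B) -> A <= expR (4 * K / (1 - k)).
Proof.
move=> /andP[k0 k1] K0 da0 db0 dba EA EB AB.
have ea : 0 < expR (- da) by exact: expR_gt0.
have eb : expR (- db) <= 1 by rewrite -expR0 ler_expR oppr_le0.
have eb1 : 1 <= expR db by rewrite -expR0 ler_expR.
have ekd : expR db <= expR (k * da) by rewrite ler_expR.
have da_le : (1 - k) * da <= 4 * K.
  have h1 : expR da <= 4 * K * expR (k * da).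
    have h : 1 + B <= 2 * expR (k * da) by lra.
    have := ler_wpM2l K0 h; lra.
  have h2 : expR ((1 - k) * da) <= 4 * K.
    by rewrite mulrBl mul1r expRD expRN ler_pdivrMr ?expR_gt0.
  by have := expR_ge1Dx ((1 - k) * da); lra.
have dD : expR da <= expR (4 * K / (1 - k)).
  by rewrite ler_expR ler_pdivlMr; lra.
have : expR (- da) <= expR da by rewrite ler_expR; lra.
lra.
Qed.

Section Proper.
Variables (R : realType) (N : nat).
Local Notation O := (delta_mx ord_max 0 : 'cV[R]_N.+1).

Lemma base_hyperbolic : hyperbolic O.
Proof.
split; last by rewrite mxE !eqxx ltr01.
rewrite lorentz_self big1 ?sub0r ?mxE ?eqxx ?expr1n // => i _.
rewrite mxE eqxx andbT; case: eqP => [/(congr1 val)/= E|_]; last by rewrite expr0n.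
by have := ltn_ord i; rewrite E ltnn.
Qed.

Lemma lorentz_basel x : lorentz O x = - x ord_max 0.
Proof.
rewrite lorentzE big1 ?sub0r ?mxE ?eqxx ?mul1r // => i _.
rewrite mxE eqxx andbT; case: eqP => [/(congr1 val)/= E|_]; last by rewrite mul0r.
by have := ltn_ord i; rewrite E ltnn.
Qed.

Lemma lorentz_base_act (g : 'M[R]_N.+1) : - lorentz O (g *m O) = g ord_max ord_max.
Proof. by rewrite lorentz_basel opprK -colE mxE. Qed.

Lemma On1V (g : 'M[R]_N.+1) : On1 g ->
  g *m (lorentz_mx R N *m g^T *m lorentz_mx R N) = 1%:M.
Proof.
move=> gO; apply: mulmx1C; rewrite -!mulmxA [g^T *m _]mulmxA gO.
exact: lorentz_mxK.
Qed.

Lemma On1_tr (g : 'M[R]_N.+1) : On1 g -> On1 g^T.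
Proof.
move=> /On1V gV; rewrite /On1 /= trmxK.
rewrite -[LHS]mulmx1 -lorentz_mxK mulmxA -[RHS]mul1mx; congr (_ *m _).
by rewrite -gV !mulmxA.
Qed.

(** The columns of an element of O(N,1) have norm 1 or -1, and so do its rows.
   Hence its last column and its last row are bounded by their common entry,
   the hyperbolic cosine of the displacement of the base point, and then every
   column is bounded by its last entry. *)
Lemma On1_entry (g : 'M[R]_N.+1) i j : On1 g ->
  g i j ^+ 2 <= 1 + g ord_max ord_max ^+ 2.
Proof.
have lastcol (h : 'M[R]_N.+1) l : On1 h -> h l ord_max ^+ 2 <= h ord_max ord_max ^+ 2.
  move=> /On1P/(_ O O); rewrite base_hyperbolic.1 -colE lorentz_self !mxE => hl.
  have [->//|lne] := eqVneq l ord_max.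
  have lt_lN : (l < N)%N.
    rewrite ltn_neqAle -ltnS ltn_ord andbT.
    by apply: contra lne => /eqP E; apply/eqP/val_inj.
  have -> : l = widen_ord (leqnSn N) (Ordinal lt_lN) by exact: val_inj.
  have : h (widen_ord (leqnSn N) (Ordinal lt_lN)) ord_max ^+ 2 <=
      \sum_(i < N) col ord_max h (widen_ord (leqnSn N) i) 0 ^+ 2.
    rewrite (bigD1 (Ordinal lt_lN)) //= mxE lerDl.
    by apply: sumr_ge0 => t _; exact: sqr_ge0.
  by lra.
move=> gO; have [->|jne] := eqVneq j ord_max.
  by have := lastcol g i gO; lra.
have lastrow := lastcol g^T j (On1_tr gO); rewrite !mxE in lastrow.
have [->|ine] := eqVneq i ord_max; first by lra.
have lt_iN : (i < N)%N.
  rewrite ltn_neqAle -ltnS ltn_ord andbT.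
  by apply: contra ine => /eqP E; apply/eqP/val_inj.
have := (On1P g).1 gO (delta_mx j 0) (delta_mx j 0).
rewrite -!colE !lorentz_self !mxE.
rewrite [\sum_(i < N) delta_mx _ _ _ _ ^+ 2](_ : _ = 1); last first.
  have lt_jN : (j < N)%N.
    rewrite ltn_neqAle -ltnS ltn_ord andbT.
    by apply: contra jne => /eqP E; apply/eqP/val_inj.
  rewrite (bigD1 (Ordinal lt_jN)) //= big1 ?addr0.
    by rewrite mxE eqxx andbT (_ : _ == _ = true) ?expr1n //; apply/eqP/val_inj.
  move=> t tne; rewrite mxE eqxx andbT; case: eqP => [/(congr1 val)/= E|_]; last by rewrite expr0n.
  by case/eqP: tne; apply: val_inj.
rewrite eq_sym (negbTE jne) expr0n subr0 => gj.
have : g i j ^+ 2 <= \sum_(i < N) col j g (widen_ord (leqnSn N) i) 0 ^+ 2.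
  rewrite (bigD1 (Ordinal lt_iN)) //= mxE.
  have -> : widen_ord (leqnSn N) (Ordinal lt_iN) = i by exact: val_inj.
  by rewrite lerDl; apply: sumr_ge0 => t _; exact: sqr_ge0.
lra.
Qed.

Lemma mx_entry_le_norm (M : 'M[R]_N.+1) i j : `|M i j| <= `|M|.
Proof. by rewrite /Num.norm /= mx_normrE (le_bigmax _ _ (i, j)). Qed.

Variables (m p : nat) (E : rel 'I_m).
Hypothesis Esym : symmetric E.
Variables (v : 'I_m -> 'cV[R]_p.+1) (a b : 'I_m -> 'cV[R]_N.+1).
Hypotheses (vC : coxeter_config E v) (aC : coxeter_config E a)
  (bC : coxeter_config E b).
Variable ov : 'cV[R]_p.+1.
Hypothesis ovP : forall i, lorentz ov (v i) < 0.
Hypothesis oaP : forall i, lorentz O (a i) < 0.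
Hypothesis obP : forall i, lorentz O (b i) < 0.
Variables (f : 'cV[R]_N.+1 -> 'cV[R]_N.+1) (k : R).
Hypothesis k01 : 0 <= k < 1.
Hypothesis fH : forall x, hyperbolic x -> hyperbolic (f x).
Hypothesis fO : f O = O.
Hypothesis fa : forall x i, hyperbolic x -> lorentz x (a i) = 0 ->
  lorentz (f x) (b i) = 0.
Hypothesis fL : forall x y, hyperbolic x -> hyperbolic y ->
  hdist (f x) (f y) <= k * hdist x y.

(** If the action of u moves x to y, both in a bounded set, then [act a u] is a
   product of [act b u] with bounded matrices. *)
Lemma bounded_comparison (K : R) u (x y : 'M[R]_N.+1) :
  1 <= K -> On1 y -> `|x| <= K -> `|y| <= K -> act b u *m x = y *m act a u ->
  act a u ord_max ord_max <=
    (N.+1)%:R ^+ 2 * K ^+ 2 * (1 + act b u ord_max ord_max).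
Proof.
move=> K1 yO xK yK uxy.
have hO := base_hyperbolic; have hb := act_hyperbolic bC u hO.
have bl : 1 <= act b u ord_max ord_max.
  by rewrite -lorentz_base_act; have := hyperbolic_lorentz_le hO hb; lra.
have -> : act a u = lorentz_mx R N *m y^T *m lorentz_mx R N *m act b u *m x.
  by rewrite -[_ *m act b u *m x]mulmxA uxy mulmxA (mulmx1C (On1V yO)) mul1mx.
set Y := lorentz_mx R N *m y^T *m lorentz_mx R N.
have Yij i j : `|Y i j| <= K.
  rewrite /Y mul_mx_diag mul_diag_mx !mxE !normrM.
  have n1 l : `|if l == ord_max :> 'I_N.+1 then -1 else 1 : R| = 1.
    by case: ifP => _; rewrite ?normrN normr1.
  by rewrite !n1 mul1r mulr1 (le_trans (mx_entry_le_norm _ _ _)).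
have Xij i j : `|x i j| <= K by rewrite (le_trans (mx_entry_le_norm _ _ _)).
set B := act b u in bl *.
have Bij i j : `|B i j| <= 1 + B ord_max ord_max.
  rewrite -ler_sqr ?nnegrE ?normr_ge0 //; last by lra.
  rewrite real_normK ?num_real //.
  by have := On1_entry i j (act_On1 bC u); rewrite -/B; nra.
have -> : (N.+1)%:R ^+ 2 * K ^+ 2 * (1 + B ord_max ord_max) =
    \sum_(j < N.+1) \sum_(i < N.+1) K * (1 + B ord_max ord_max) * K.
  rewrite !sumr_const card_ord -[RHS]mulr_natr -[_ *+ _]mulr_natr.
  by ring.
rewrite mxE; apply: ler_sum => j _; rewrite mxE mulr_suml; apply: ler_sum => i _.
apply: le_trans (ler_norm _) _; rewrite !normrM.
by rewrite !ler_pM ?mulr_ge0.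
Qed.

(** An element g moves a point of C into C only if the displacements of the base
   point under the two representations differ by a bounded amount. As the
   second is at most k < 1 times the first, both are bounded, and finitely many
   reduced words remain by [reduced_growth]. *)
Theorem proper_of_contraction : admits_proper_action (reflection_group v) N.
Proof.
exists (transfer v a), (transfer v b); split.
- exact: (transfer_representation Esym vC ovP aC).
- exact: (transfer_representation Esym vC ovP bC).
- exact: (transfer_faithful_discrete Esym vC ovP aC oaP).
- exact: (transfer_faithful_discrete Esym vC ovP bC obP).
move=> C CO cC.
have [M0 [_ /= CM]] := compact_bounded cC.
pose K := Num.max 1 (M0 + 1).
have K1 : 1 <= K by rewrite le_max lexx.
have CK x : C x -> `|x| <= K.
  by move=> Cx; apply: CM => //; rewrite lt_max ltrDl ltr01 orbT.
have hO := base_hyperbolic.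
have [e e0 oe] := finite_uniform oaP.
pose K2 : R := (N.+1)%:R ^+ 2 * K ^+ 2.
have K20 : 0 <= K2 by rewrite mulr_ge0 ?sqr_ge0.
pose D := expR (4 * K2 / (1 - k)).
pose L := Num.truncn (D / e ^+ 2).
apply: (@sub_finite_set _ _ [set act v u | u in [set u | (size u <= L)%N]]);
  last first.
  apply: finite_image.
  apply: (@sub_finite_set _ _ (range (fun w : L.-bseq 'I_m => val w))).
    by move=> u /= uL; exists (Bseq uL).
  by apply: finite_image; exact: finite_finset.
move=> g [/=]; rewrite (reflection_groupE vC) => -[u' ->] [y [[x Cx xy] Cy]].
have [u uu' ru] := reduced_exists E u'.
exists u => /=; last by rewrite -(act_step vC uu').
move: xy; rewrite /right_left_action (act_step vC uu').
rewrite (transferE Esym vC ovP aC) (transferE Esym vC ovP bC) => xy.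
have uxy : act b u *m x = y *m act a u.
  rewrite -xy -[RHS]mulmxA mulVmx ?mulmx1 //.
  by have /mulmx1_unit[] := act_revr aC u.
have cmp := bounded_comparison K1 (CO _ Cy) (CK _ Cx) (CK _ Cy) uxy.
have grow := reduced_growth Esym aC ru (ltW e0) hO oe.
have pO : poly_of a O by split=> // i; exact: ltW.
have lip := equivariant_lipschitz Esym aC bC fH fa fL u pO pO.
rewrite fO in lip; rewrite lorentz_base_act in grow.
have ha := act_hyperbolic aC u hO; have hb := act_hyperbolic bC u hO.
have acoshE h : hyperbolic (h *m O) ->
    expR (hdist O (h *m O)) + expR (- hdist O (h *m O)) = 2 * h ord_max ord_max.
  move=> hh; rewrite -lorentz_base_act cosh_acosh //.
  by rewrite lerNr; exact: hyperbolic_lorentz_le.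
have aD : act a u ord_max ord_max <= D.
  exact: (bounded_displacement k01 K20 (hdist_ge0 hO ha) (hdist_ge0 hO hb) lip
    (acoshE _ ha) (acoshE _ hb) cmp).
rewrite -ltnS -(ltr_nat R); apply: le_lt_trans (truncnS_gt (D / e ^+ 2)).
rewrite ler_pdivlMr ?exprn_gt0 // mulrC.
have {}grow := le_trans grow aD; apply: le_trans grow.
have t0 : 0 <= e ^+ 2 * (size u)%:R by rewrite mulr_ge0 ?sqr_ge0.
by rewrite -mulrA mulr_natl mulr2n addrA lerDr addr_ge0.
Qed.

End Proper.

(** * Centred configurations and their contraction *)

Section Coordinates.
Variables (R : realType) (n c : nat).
Implicit Types (x : 'I_n -> R) (s : 'I_c -> R) (t : R) (z : 'cV[R]_(n + c).+1).

Definition dot (q : nat) (x y : 'I_q -> R) := \sum_i x i * y i.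

Definition mkvec x s t : 'cV[R]_(n + c).+1 :=
  \col_(k < (n + c).+1) (if unlift ord_max k is Some l then
            match fintype.split l with inl i => x i | inr j => s j end
          else t).

Definition xpart z : 'I_n -> R := fun i => z (lift ord_max (lshift c i)) 0.
Definition spart z : 'I_c -> R := fun j => z (lift ord_max (rshift n j)) 0.

Lemma xpart_mkvec x s t : xpart (mkvec x s t) = x.
Proof.
apply/funext => i; rewrite /xpart mxE liftK.
by rewrite -[lshift c i]/(unsplit (inl i)) unsplitK.
Qed.

Lemma spart_mkvec x s t : spart (mkvec x s t) = s.
Proof.
apply/funext => i; rewrite /spart mxE liftK.
by rewrite -[rshift n i]/(unsplit (inr i)) unsplitK.
Qed.

Lemma last_mkvec x s t : mkvec x s t ord_max 0 = t.
Proof. by rewrite mxE unlift_none. Qed.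

Lemma lorentz_parts z w : lorentz z w =
  dot (xpart z) (xpart w) + dot (spart z) (spart w) - z ord_max 0 * w ord_max 0.
Proof.
have W l : widen_ord (leqnSn (n + c)) l = lift ord_max l.
  by apply: ord_inj; rewrite lift_max.
rewrite lorentzE big_split_ord /=; congr (_ + _ - _).
  by apply: eq_bigr => i _; rewrite W.
by apply: eq_bigr => i _; rewrite W.
Qed.

Lemma lorentz_mkvec x s t x' s' t' :
  lorentz (mkvec x s t) (mkvec x' s' t') = dot x x' + dot s s' - t * t'.
Proof. by rewrite lorentz_parts !xpart_mkvec !spart_mkvec !last_mkvec. Qed.

Lemma dotZl q (x y : 'I_q -> R) k : dot (fun i => k * x i) y = k * dot x y.
Proof. by rewrite /dot mulr_sumr; apply: eq_bigr => i _; rewrite mulrA. Qed.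

Lemma dotZr q (x y : 'I_q -> R) k : dot x (fun i => k * y i) = k * dot x y.
Proof. by rewrite /dot mulr_sumr; apply: eq_bigr => i _; rewrite mulrCA. Qed.

Lemma dot0l q (y : 'I_q -> R) : dot (fun=> 0) y = 0.
Proof. by rewrite /dot big1 // => i _; rewrite mul0r. Qed.

Lemma dot_ge0 q (x : 'I_q -> R) : 0 <= dot x x.
Proof. by apply: sumr_ge0 => i _; rewrite -expr2 sqr_ge0. Qed.

Lemma dot_cauchy q (x y : 'I_q -> R) : dot x y ^+ 2 <= dot x x * dot y y.
Proof. by have := cauchy_schwarz_sum x y; rewrite /dot; under [\sum_i x i ^+ 2]eq_bigr do rewrite expr2; under [\sum_i y i ^+ 2]eq_bigr do rewrite expr2. Qed.

Lemma dot_unit_le1 q (x y : 'I_q -> R) : dot x x = 1 -> dot y y = 1 -> dot x y <= 1.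
Proof.
by move=> x1 y1; have := dot_cauchy x y; rewrite x1 y1 mulr1; nra.
Qed.

(** Scaling the ball model by [al] towards its centre (after projecting away
   the last [c] spatial coordinates). *)
Definition shrink al z := mkvec (fun i => al * xpart z i) (fun=> 0) (z ord_max 0).

Lemma lorentz_shrink al z w : lorentz (shrink al z) (shrink al w) =
  al ^+ 2 * dot (xpart z) (xpart w) - z ord_max 0 * w ord_max 0.
Proof. by rewrite lorentz_mkvec dotZl dotZr dot0l addr0 mulrA. Qed.

Lemma shrink_future al z : 0 <= al < 1 -> hyperbolic z -> future (shrink al z).
Proof.
move=> /andP[al0 al1] [zz z0]; split; last by rewrite last_mkvec.
rewrite lorentz_shrink; move: zz; rewrite lorentz_parts.
have := dot_ge0 (xpart z); have := dot_ge0 (spart z).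
have : al ^+ 2 <= 1 by rewrite expr_le1 // ltW.
set X := dot _ _; set S := dot _ _; set t := z _ _; nra.
Qed.

(** With u = sqrt (1 + S), and likewise u', the norm t ^ 2 - al ^ 2 X is a convex
   combination of u ^ 2 and t ^ 2; by the Cauchy-Schwarz inequality the product
   of the two norms is at least D ^ 2, where D is the same combination of u u'
   and t t'. *)
Lemma shrink_chord_real (al t t' X X' P S S' Q : R) : 0 <= al < 1 ->
  0 < t -> 0 < t' -> 0 <= X -> 0 <= X' -> 0 <= S -> 0 <= S' ->
  X + S - t ^+ 2 = -1 -> X' + S' - t' ^+ 2 = -1 ->
  Q ^+ 2 <= S * S' -> 1 <= t * t' - P - Q ->
  (Num.sqrt (t ^+ 2 - al ^+ 2 * X))^-1 * (Num.sqrt (t' ^+ 2 - al ^+ 2 * X'))^-1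
    * (t * t' - al ^+ 2 * P) - 1 <= al ^+ 2 * (t * t' - P - Q - 1).
Proof.
move=> /andP[al0 al1] t0 t'0 X0 X'0 S0 S'0 XS XS' QSS ch.
have u2 : Num.sqrt (1 + S) ^+ 2 = 1 + S by rewrite sqr_sqrtr; lra.
have u'2 : Num.sqrt (1 + S') ^+ 2 = 1 + S' by rewrite sqr_sqrtr; lra.
have u1 : 1 <= Num.sqrt (1 + S) by rewrite -[leLHS]sqrtr1 ler_wsqrtr; lra.
have u'1 : 1 <= Num.sqrt (1 + S') by rewrite -[leLHS]sqrtr1 ler_wsqrtr; lra.
set u := Num.sqrt _ in u2 u1; set u' := Num.sqrt _ in u'2 u'1.
have uu1 : 1 <= u * u' by nra.
have uuQ : 1 + Q <= u * u'.
  have [|Q0] := lerP (1 + Q) 0; first by lra.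
  rewrite -ler_sqr ?nnegrE; [|lra|lra].
  rewrite exprMn u2 u'2.
  have h1 : (2 * Q) ^+ 2 <= (S + S') ^+ 2.
    by have := sqr_ge0 (S - S'); rewrite exprMn sqrrB sqrrD; lra.
  have h2 : 2 * Q <= S + S'.
    have [|Q1] := lerP Q 0; first by lra.
    by rewrite -ler_sqr ?nnegrE; lra.
  lra.
have tt1 : 1 <= t * t'.
  have t1 : 1 <= t by rewrite -(@ler_sqr _ 1) ?nnegrE ?expr1n; lra.
  have t'1 : 1 <= t' by rewrite -(@ler_sqr _ 1) ?nnegrE ?expr1n; lra.
  by nra.
have al2 : 0 <= al ^+ 2 <= 1 by rewrite sqr_ge0 expr_le1 // ltW.
set b := al ^+ 2 in al2 *.
have qE : t ^+ 2 - b * X = b * u ^+ 2 + (1 - b) * t ^+ 2 by rewrite u2; nra.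
have q'E : t' ^+ 2 - b * X' = b * u' ^+ 2 + (1 - b) * t' ^+ 2 by rewrite u'2; nra.
have b0 : 0 <= b by case/andP: al2.
have b1 : 0 <= 1 - b by case/andP: al2; lra.
have q0 : 0 <= t ^+ 2 - b * X by rewrite qE; apply: addr_ge0; apply: mulr_ge0 => //; exact: sqr_ge0.
have q'0 : 0 <= t' ^+ 2 - b * X' by rewrite q'E; apply: addr_ge0; apply: mulr_ge0 => //; exact: sqr_ge0.
set D := b * (u * u') + (1 - b) * (t * t').
have D1 : 1 <= D by rewrite /D; nra.
set r := Num.sqrt (t ^+ 2 - b * X) * Num.sqrt (t' ^+ 2 - b * X').
have rD : D <= r.
  rewrite -ler_sqr ?nnegrE /r ?mulr_ge0 ?sqrtr_ge0 //; last by lra.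
  rewrite exprMn !sqr_sqrtr // qE q'E -subr_ge0.
  have -> : (b * u ^+ 2 + (1 - b) * t ^+ 2) * (b * u' ^+ 2 + (1 - b) * t' ^+ 2)
    - D ^+ 2 = b * (1 - b) * (u * t' - u' * t) ^+ 2 by rewrite /D; ring.
  by apply: mulr_ge0; [exact: mulr_ge0|exact: sqr_ge0].
rewrite -invfM -/r lerBlDr mulrC ler_pdivrMr; last by lra.
set h := b * (t * t' - P - Q - 1).
have h0 : 0 <= h by rewrite mulr_ge0 //; lra.
have : t * t' - b * P <= D + h by rewrite /D /h; nra.
have : h <= h * r by rewrite ler_peMr //; lra.
rewrite mulrDl mul1r; lra.
Qed.

Lemma shrink_chord al z w : 0 <= al < 1 -> hyperbolic z -> hyperbolic w ->
  - lorentz (normalize (shrink al z)) (normalize (shrink al w)) - 1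
    <= al ^+ 2 * (- lorentz z w - 1).
Proof.
move=> al01 hz hw; have zw := hyperbolic_lorentz_le hz hw.
rewrite /normalize !lorentz_lin !lorentz_shrink.
have [[zz z0] [ww w0]] := (hz, hw); move: zw zz ww; rewrite !lorentz_parts.
rewrite -!expr2 => zw zz ww.
have ch : 1 <= z ord_max 0 * w ord_max 0 - dot (xpart z) (xpart w)
    - dot (spart z) (spart w) by lra.
have := shrink_chord_real al01 z0 w0 (dot_ge0 (xpart z)) (dot_ge0 (xpart w))
  (dot_ge0 (spart z)) (dot_ge0 (spart w)) zz ww (dot_cauchy _ _) ch.
move: (dot (xpart z) (xpart w)) (dot (spart z) (spart w)) => P Q.
move: (z ord_max 0) (w ord_max 0) => t t'.
rewrite ![- (_ - _ ^+ 2)]opprB.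
move: (_^-1) (Num.sqrt (t' ^+ 2 - _))^-1 => r1 r2 h.
rewrite (_ : - (P + Q - t * t') = t * t' - P - Q); last by ring.
by rewrite (_ : - (r1 * _) = r1 * r2 * (t * t' - al ^+ 2 * P)) //; ring.
Qed.

End Coordinates.

Section Model.
Variables (R : realType) (p m n c : nat) (v : 'I_m -> 'cV[R]_p.+1).
Variables (x : 'I_m -> 'I_n -> R) (s : 'I_m -> 'I_c -> R) (sg s0 : R).
Hypothesis sg_bounds : 1 / 2 <= sg < 1.
Hypothesis s0_neg : s0 < 0.
Hypotheses (x1 : forall i, dot (x i) (x i) = 1) (s1 : forall i, dot (s i) (s i) = 1).
Hypothesis v1 : forall i, lorentz (v i) (v i) = 1.
Hypothesis pairs : forall i j, i != j ->
  [/\ lorentz (v i) (v j) = 0, dot (x i) (x j) = sg & dot (s i) (s j) = s0] \/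
  lorentz (v i) (v j) <= -1 /\ 1 - (1 - dot (x i) (x j)) / (1 - sg) <= - (3 / 2).
Variable ov : 'cV[R]_p.+1.
Hypothesis ovP : forall i, lorentz ov (v i) < 0.

(** The directions x i define hyperplanes at a common distance from the base
   point O. The distance is such that they are orthogonal when i and j commute:
   this is the configuration a. It can be reduced if the angles are corrected
   by the new components s i: this is the configuration b, where the bound
   - 3 / 2 leaves enough room for the other pairs to remain disjoint. As [shrink]
   contracts and sends the walls of a into those of b, [proper_of_contraction]
   applies. *)
Theorem admits_of_model : admits_proper_action (reflection_group v) (n + c).
Proof.
have [sg2 sg1] := andP sg_bounds.
pose E := [rel i j : 'I_m | (i != j) && (lorentz (v i) (v j) == 0)].
have Esym : symmetric E by move=> i j /=; rewrite eq_sym lorentzC.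
have EP i j : E i j -> dot (x i) (x j) = sg /\ dot (s i) (s j) = s0.
  move=> /andP[ij /eqP vij]; have [[]//|[]] := pairs ij.
  by rewrite vij; lra.
have nEP i j : i != j -> E i j \/
    lorentz (v i) (v j) <= -1 /\ 1 - (1 - dot (x i) (x j)) / (1 - sg) <= - (3 / 2).
  move=> ij; have [[vij _ _]|h] := pairs ij; last by right.
  by left; rewrite /= ij vij eqxx.
have vC : coxeter_config E v.
  split=> // [i j /andP[_ /eqP]//|i j ij].
  by have [|[]] := nEP i j ij; [left|right].
pose A0 : R := (1 - sg)^-1; pose C0 := sg * A0.
(* of 1 - <b i, b j>, which is 1 when i and j commute, the components x
   contribute 7/8 and the components s the missing 1/8 *)
pose be : R := (8 * (1 - s0))^-1.
pose A := 7 / 8 * A0; pose C := A + be - 1.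
have A0_2 : 2 <= A0 by rewrite /A0 -div1r ler_pdivlMr; lra.
have A0sg : A0 * (1 - sg) = 1 by rewrite /A0 mulVf // lt0r_neq0 // subr_gt0.
have s01 : 0 < 1 - s0 by rewrite subr_gt0 (lt_trans s0_neg).
have be0 : 0 < be by rewrite invr_gt0 mulr_gt0.
have beE : be * (1 - s0) = 1 / 8.
  by rewrite /be; field; rewrite lt0r_neq0.
have be8 : be < 1 / 8 by have : 0 < be * - s0 by [rewrite mulr_gt0 ?oppr_gt0]; lra.
have C00 : 0 < C0 by rewrite /C0; apply: mulr_gt0; lra.
have A_0 : 0 < A by rewrite /A; lra.
have C_0 : 0 < C by rewrite /C /A; lra.
have sqE (y : R) : 0 < y -> Num.sqrt y * Num.sqrt y = y.
  by move=> y0; rewrite -expr2 sqr_sqrtr ?ltW.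
have sq0 (y : R) : 0 < y -> 0 < Num.sqrt y by rewrite sqrtr_gt0.
pose a i := mkvec (fun l => Num.sqrt A0 * x i l) (fun=> 0 : R) (Num.sqrt C0)
  : 'cV_(n + c).+1.
pose b i := mkvec (fun l => Num.sqrt A * x i l) (fun l => Num.sqrt be * s i l)
  (Num.sqrt C) : 'cV_(n + c).+1.
have aE i j : lorentz (a i) (a j) = A0 * dot (x i) (x j) - C0.
  by rewrite lorentz_mkvec dotZl dotZr dot0l addr0 mulrA !sqE //; lra.
have bE i j : lorentz (b i) (b j) =
    A * dot (x i) (x j) + be * dot (s i) (s j) - C.
  by rewrite lorentz_mkvec !dotZl !dotZr !mulrA !sqE.
have A0E i j : A0 * dot (x i) (x j) - C0 = 1 - (1 - dot (x i) (x j)) / (1 - sg).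
  by rewrite -/A0 /C0 -[X in _ = X - _]A0sg; ring.
have aC : coxeter_config E a.
  split=> [i|i j /EP[xij _]|i j /nEP[|[_]]]; rewrite ?aE.
  - by rewrite x1 /C0 mulr1 -[RHS]A0sg; ring.
  - by rewrite xij /C0; ring.
  - by left.
  - by rewrite -A0E; right; lra.
have bC : coxeter_config E b.
  split=> [i|i j /EP[xij sij]|i j /nEP[|[_]]]; rewrite ?bE.
  - by rewrite x1 s1 /C; ring.
  - by rewrite xij sij /C /A; nra.
  - by left.
  - rewrite -A0E => h; right; have := dot_unit_le1 (s1 i) (s1 j).
    move=> ss; have : be * dot (s i) (s j) <= be by rewrite ler_piMr // ltW.
    rewrite /C /A /C0 in h *; nra.
(* the ratio of the distances from the centre of the ball model at which the
   walls of b i and a i cut the line spanned by x i *)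
pose al := Num.sqrt C * Num.sqrt A0 / (Num.sqrt C0 * Num.sqrt A).
have sC := sq0 _ C_0; have sA := sq0 _ A_0; have sC0 := sq0 _ C00.
have sA0 : 0 < Num.sqrt A0 by apply: sq0; lra.
have al0 : 0 <= al by rewrite /al divr_ge0 ?mulr_ge0 // ltW.
have al1 : al < 1.
  rewrite /al ltr_pdivrMr ?mulr_gt0 // mul1r -ltr_sqr ?nnegrE ?mulr_ge0 ?ltW //.
  rewrite !exprMn !sqr_sqrtr ?ltW //; last by lra.
  by rewrite /C0 /C /A; nra.
have al01 : 0 <= al < 1 by rewrite al0.
pose f (z : 'cV_(n + c).+1) := normalize (shrink al z) : 'cV_(n + c).+1.
have fH z : hyperbolic z -> hyperbolic (f z).
  by move=> hz; apply: normalize_hyperbolic; exact: shrink_future.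
have k01 : 0 <= (1 + al) / 2 < 1 by lra.
have fL := lipschitz_of_chords al01 fH (fun z w hz hw => shrink_chord al01 hz hw).
apply: (proper_of_contraction Esym vC aC bC ovP _ _ k01 fH _ _ fL).
- by move=> i; rewrite lorentz_basel last_mkvec oppr_lt0.
- by move=> i; rewrite lorentz_basel last_mkvec oppr_lt0.
- have E0 : shrink al (delta_mx ord_max 0) = delta_mx ord_max 0 :> 'cV[R]_(n + c).+1.
    apply/colP => k; rewrite !mxE; case: unliftP => [l ->|->]; last by rewrite !eqxx.
    rewrite eq_sym eq_liftF /=; case: fintype.split => // i.
    by rewrite /xpart mxE eq_sym eq_liftF mulr0.
  by rewrite /f E0 normalize_id //; exact: base_hyperbolic.
move=> z i hz zi; apply: lorentz_normalize_eq0; first exact: shrink_future.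
move: zi; rewrite !lorentz_parts !xpart_mkvec !spart_mkvec !last_mkvec.
rewrite !dotZr dotZl dot0l mulr0 addr0 [dot (spart z) _]/dot big1 ?addr0; last first.
  by move=> l _; rewrite mulr0.
set d := dot _ _; set t := z _ _ => zi.
apply: (mulfI (x := Num.sqrt C0)); first by rewrite lt0r_neq0.
rewrite mulr0 /al.
have -> : Num.sqrt C0 * (Num.sqrt A * (Num.sqrt C * Num.sqrt A0 /
    (Num.sqrt C0 * Num.sqrt A) * d) - t * Num.sqrt C) =
  Num.sqrt C * (Num.sqrt A0 * d - t * Num.sqrt C0).
  by field; rewrite !lt0r_neq0.
by rewrite zi mulr0.
Qed.

End Model.

(** * Compact hyperbolic polytopes *)

Lemma lorentz_continuous (R : realType) n (y : 'cV[R]_n.+1) :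
  continuous (fun x : 'cV[R]_n.+1 => lorentz x y).
Proof.
rewrite (_ : (fun x => _) = fun x : 'cV[R]_n.+1 =>
    \sum_i (x i 0 * (lorentz_mx R n *m y) i 0)); last first.
  apply/funext => x; rewrite /lorentz -mulmxA mxE.
  by apply: eq_bigr => i _; rewrite mxE.
apply: continuous_bigsum => i x.
by apply: (continuousM (@coord_continuous R _ _ i 0 x)); exact: cst_continuous.
Qed.

Lemma finite_eps (R : realType) (m : nat) (Q : 'I_m -> R -> Prop) :
  (forall i, exists2 e, 0 < e & forall t, 0 < t <= e -> Q i t) ->
  exists2 e, 0 < e & forall t, 0 < t <= e -> forall i, Q i t.
Proof.
move=> h; pose e i := s2val (cid2 (h i)).
have e0 i : 0 < e i by rewrite /e; case: cid2.
have eQ i t : 0 < t <= e i -> Q i t by rewrite /e; case: cid2 => /= e' _; exact.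
have [d d0 dP] := finite_uniform (fun i => eq_ind_r is_true (e0 i) (oppr_lt0 (e i))).
exists d => // t /andP[t0 td] i; apply: eQ; rewrite t0 (le_trans td) //.
by have := dP i; rewrite lerN2.
Qed.

Lemma kernel_line (F : fieldType) (q r : nat) (A : 'M[F]_(q, r)) (w u : 'rV_q) :
  (\rank A).+1 = q -> w != 0 -> w *m A = 0 -> u *m A = 0 ->
  exists t, u = t *: w.
Proof.
move=> rA w0 wA uA.
have wk : (w <= kermx A)%MS by apply/sub_kermxP.
have uk : (u <= kermx A)%MS by apply/sub_kermxP.
have kw : (kermx A <= w)%MS.
  rewrite -(geq_leqif (mxrank_leqif_sup wk)) mxrank_ker rank_rV w0.
  by rewrite -{1}rA subSn // subnn.
by apply/sub_rVP; exact: submx_trans uk kw.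
Qed.

Section Polytope.
Variables (R : realType) (n m : nat) (v : 'I_m -> 'cV[R]_n.+1).
Hypothesis cv : compact_polytope v.
Implicit Types (x y z : 'cV[R]_n.+1) (i j l : 'I_m).
Local Notation P := (poly_of v).

Let v1 i : lorentz (v i) (v i) = 1. Proof. by case: cv. Qed.

Lemma poly_future x : P x -> future x.
Proof. by move=> [hx _]; exact: hyperbolic_future. Qed.

Lemma poly_bounded : exists M, forall x, P x -> x ord_max 0 <= M.
Proof.
case: cv => _ _ /compact_bounded[M [_ MP]] _ _.
exists (M + 1) => x Px; apply: le_trans (ler_norm _) _.
apply: le_trans (MP (M + 1) _ x Px); last by rewrite ltrDl.
by rewrite /Num.norm /= mx_normrE (le_bigmax _ _ (ord_max, 0)).
Qed.

(** The sum of points spanning the space: a facet containing it would contain all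
   of them. *)
Lemma poly_interior : exists o, forall i, lorentz o (v i) < 0.
Proof.
case: cv => _ _ _ [B [rB BP _]] _.
exists (\sum_j col j B) => i; rewrite lorentz_suml lt_neqAle; apply/andP; split.
  rewrite -oppr_eq0 -sumrN psumr_eq0; last first.
    by move=> j _; rewrite oppr_ge0; case: (BP j).
  apply/negP => /allP B0.
  have vB : (v i)^T *m lorentz_mx R n *m B = 0.
    apply/rowP => j; have := B0 j; rewrite mem_index_enum oppr_eq0 => /(_ isT)/eqP.
    by rewrite lorentzC /lorentz colE mulmxA -colE !mxE.
  have uB : B \in unitmx by rewrite -row_free_unit /row_free rB.
  have vJ : (v i)^T *m lorentz_mx R n = 0.
    by rewrite -[LHS](mulmxK uB) vB mul0mx.
  by have := v1 i; rewrite /lorentz vJ mul0mx mxE => /esym/eqP; rewrite oner_eq0.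
by apply: sumr_le0 => j _; case: (BP j).
Qed.

Lemma facet_nonempty i : exists x, P x /\ lorentz x (v i) = 0.
Proof.
case: cv => _ _ _ _ /(_ i)[B [_ Bi _]]; exists (col ord0 B).
by have [Px] := Bi ord0; move=> /(_ i erefl).
Qed.

(** The points of a facet span a hyperplane, so that their orthogonal complement
   is a line. *)
Lemma facet_span i y : (0 < n)%N ->
  (forall x, P x -> lorentz x (v i) = 0 -> lorentz x y = 0) ->
  exists t, y = t *: v i.
Proof.
move=> n0 iy; case: cv => _ _ _ _ /(_ i)[B [rB Bi _]].
have B0 u : (forall x, P x -> lorentz x (v i) = 0 -> lorentz x u = 0) ->
    u^T *m (lorentz_mx R n *m B) = 0.
  move=> iu; rewrite mulmxA; apply/rowP => j; have [Px /(_ i erefl) xi] := Bi j.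
  by have := iu _ Px xi; rewrite lorentzC /lorentz colE mulmxA -colE !mxE.
have uJ : lorentz_mx R n \in unitmx.
  by have /mulmx1_unit[] := lorentz_mxK R n.
have rJB : (\rank (lorentz_mx R n *m B)).+1 = n.+1.
  by rewrite (eqmxMfull _ (A := lorentz_mx R n)) ?row_full_unit // rB prednK.
have vi0 : (v i)^T != 0.
  by apply: contra_eq_neq (v1 i) => vi; rewrite /lorentz vi !mul0mx mxE eq_sym oner_neq0.
have [t yt] := kernel_line rJB vi0 (B0 _ (fun _ _ => id)) (B0 _ iy).
by exists t; apply: trmx_inj; rewrite yt linearZ.
Qed.

Lemma facet_inj i j : (0 < n)%N ->
  (forall x, P x -> lorentz x (v i) = 0 -> lorentz x (v j) = 0) -> i = j.
Proof.
move=> n0 /(facet_span n0)[t vt]; case: (cv) => _ vinj _ _ _; apply: vinj.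
have := v1 j; rewrite vt !lorentz_lin v1 mulr1 => tt.
have [w wP] := poly_interior; have := wP j; have := wP i.
rewrite vt !lorentz_lin => oi oj.
have t0 : 0 < t by rewrite -(nmulr_llt0 _ oi).
have -> : t = 1 by nra.
by rewrite scale1r.
Qed.

(** ** Leaving a compact polytope along a ray *)

Lemma future_of_neg z w : future z -> lorentz w w < 0 -> lorentz z w < 0 -> future w.
Proof.
move=> fz ww zw; split=> //; rewrite ltNge; apply/negP => w0.
have fw : future (- w); last first.
  by have := future_lorentz_lt0 fz fw; rewrite lorentz_lin; lra.
split; first by rewrite !lorentz_lin opprK.
rewrite mxE oppr_gt0 lt_neqAle w0 andbT; apply: contraTneq ww => w00.
rewrite -leNgt lorentz_self w00 expr0n subr0.
by apply: sumr_ge0 => i _; exact: sqr_ge0.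
Qed.

Lemma future_tangent z y t : hyperbolic z -> lorentz y z = 0 ->
  t ^+ 2 * lorentz y y < 1 -> future (z + t *: y).
Proof.
move=> hz yz tY; apply: (future_of_neg (hyperbolic_future hz)).
  by rewrite !lorentz_lin yz [lorentz z y]lorentzC yz; case: hz => -> _; lra.
by rewrite !lorentz_lin [lorentz z y]lorentzC yz; case: hz => -> _; lra.
Qed.

Lemma lorentz_tangent_sq z y t : hyperbolic z -> lorentz y z = 0 ->
  - lorentz (z + t *: y) (z + t *: y) = 1 - t ^+ 2 * lorentz y y.
Proof.
by move=> [zz _] yz; rewrite !lorentz_lin [lorentz z y]lorentzC yz zz; ring.
Qed.

(** Towards the ideal point [z + t *: y], t ^ 2 <y, y> = 1, the last coordinate
   is unbounded on the hyperboloid. *)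
Lemma ray_leaves z y : P z -> lorentz y z = 0 -> y != 0 ->
  exists t j, [/\ 0 <= t, t ^+ 2 * lorentz y y < 1 & 0 < lorentz (z + t *: y) (v j)].
Proof.
move=> Pz yz y0; have hz := Pz.1; have fz := poly_future Pz.
have Y0 := tangent_gt0 fz yz y0; set Y := lorentz y y in Y0 *.
apply: contrapT => inside; have [M MP] := poly_bounded.
have inP t : 0 <= t -> t ^+ 2 * Y < 1 -> P (normalize (z + t *: y)).
  move=> t0 tY; have ft := future_tangent hz yz tY.
  split; first exact: normalize_hyperbolic.
  move=> j; rewrite lorentz_normalize_le0 // leNgt; apply/negP => tj.
  by apply: inside; exists t, j.
pose s := (Num.sqrt Y)^-1.
have sY0 : 0 < Num.sqrt Y by rewrite sqrtr_gt0.
have s0 : 0 < s by rewrite invr_gt0.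
have sY : s ^+ 2 * Y = 1 by rewrite exprVn sqr_sqrtr ?ltW // mulVf // lt0r_neq0.
set q := z ord_max 0 + s * y ord_max 0.
have bound d : 0 < d -> d <= 1 ->
    0 < (1 - d) * q + d * z ord_max 0 /\
    ((1 - d) * q + d * z ord_max 0) ^+ 2 <= M ^+ 2 * (2 * d - d ^+ 2).
  move=> d0 d1; set t := s * (1 - d).
  have t0 : 0 <= t by apply: mulr_ge0; [exact: ltW|lra].
  have tYE : t ^+ 2 * Y = (1 - d) ^+ 2 by rewrite exprMn mulrAC sY mul1r.
  have tY1 : t ^+ 2 * Y < 1 by rewrite tYE; nra.
  have ft := future_tangent hz yz tY1.
  have := MP _ (inP t t0 tY1); have := ft.2.
  rewrite /normalize [X in X <= M]mxE lorentz_tangent_sq // -/Y tYE !mxE.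
  have -> : z ord_max 0 + t * y ord_max 0 = (1 - d) * q + d * z ord_max 0.
    by rewrite /q /t; ring.
  set r := _ + _ => r0; have -> : 1 - (1 - d) ^+ 2 = 2 * d - d ^+ 2 by ring.
  have dd : 0 < 2 * d - d ^+ 2 by nra.
  have sd : 0 < Num.sqrt (2 * d - d ^+ 2) by rewrite sqrtr_gt0.
  rewrite mulrC ler_pdivrMr // => rM; split=> //.
  have := sqr_sqrtr (ltW dd); set k := Num.sqrt _ in sd rM *; nra.
have z0 : 0 < z ord_max 0 by case: hz.
have q0 : 0 <= q.
  rewrite leNgt; apply/negP => q0.
  have [d [d0 d1 dq]] : exists d, [/\ 0 < d, d <= 1 & (1 - d) * q + d * z ord_max 0 <= 0].
    exists (- q / (z ord_max 0 - q)); set e := _ / _.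
    have zq : 0 < z ord_max 0 - q by lra.
    have eE : e * (z ord_max 0 - q) = - q by rewrite /e divfK // lt0r_neq0.
    have e0 : 0 < e by rewrite divr_gt0 // oppr_gt0.
    split=> //; first by rewrite /e ler_pdivrMr //; lra.
    lra.
  by have [] := bound d d0 d1; lra.
have {}q0 : 0 < q.
  rewrite lt_neqAle q0 andbT; apply/eqP => qe.
  have : lorentz (z + s *: y) (z + s *: y) = 0.
    by apply/eqP; rewrite -oppr_eq0 lorentz_tangent_sq // -/Y sY subrr.
  rewrite lorentz_self !mxE -/q -qe expr0n subr0 => /eqP.
  rewrite psumr_eq0; last by move=> j _; exact: sqr_ge0.
  move=> /allP w0; have : lorentz (z + s *: y) z = 0.
    rewrite lorentzE !mxE -/q -qe mul0r subr0 big1 // => j _.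
    have := w0 j; rewrite mem_index_enum sqrf_eq0 => /(_ isT)/eqP ->.
    by rewrite mul0r.
  by rewrite !lorentz_lin yz mulr0 addr0; case: hz => -> _; lra.
have q2 : 0 < q ^+ 2 by rewrite exprn_gt0.
have M2 := sqr_ge0 M.
pose d := q ^+ 2 / (2 * q ^+ 2 + 16 * M ^+ 2).
have den : 0 < 2 * q ^+ 2 + 16 * M ^+ 2 by lra.
have dE : d * (2 * q ^+ 2 + 16 * M ^+ 2) = q ^+ 2 by rewrite divfK // lt0r_neq0.
have d0 : 0 < d by rewrite divr_gt0.
have d1 : d <= 1 / 2 by rewrite ler_pdivrMr //; lra.
have [r0 rM] := bound d d0 ltac:(lra).
have dz : 0 < d * z ord_max 0 by rewrite mulr_gt0.
have : ((1 - d) * q) ^+ 2 <= ((1 - d) * q + d * z ord_max 0) ^+ 2.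
  rewrite ler_sqr ?nnegrE; [by lra| |exact: ltW].
  by apply: mulr_ge0; [lra|exact: ltW].
rewrite exprMn => h.
have : 1 / 4 <= (1 - d) ^+ 2 by nra.
move=> h'; have : q ^+ 2 / 4 <= (1 - d) ^+ 2 * q ^+ 2 by nra.
have : 0 <= M ^+ 2 * d ^+ 2 by rewrite mulr_ge0 ?sqr_ge0.
have : 0 < d * q ^+ 2 by rewrite mulr_gt0.
nra.
Qed.

End Polytope.

Section PolytopeFaces.
Variables (R : realType) (n m : nat) (v : 'I_m -> 'cV[R]_n.+1).
Hypothesis cv : compact_polytope v.
Implicit Types (x y z : 'cV[R]_n.+1) (i j l : 'I_m).
Local Notation P := (poly_of v).

Let v1 i : lorentz (v i) (v i) = 1. Proof. by case: cv. Qed.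

(** By compactness the ray leaves the polytope before becoming lightlike,
   [ray_leaves]; it stops at the first of the walls that it crosses. *)
Lemma exit_ray z y : P z -> lorentz y z = 0 -> y != 0 ->
  exists t i, [/\ 0 <= t, P (normalize (z + t *: y)), future (z + t *: y),
    0 < lorentz y (v i) & lorentz (z + t *: y) (v i) = 0].
Proof.
move=> Pz yz y0; have hz := Pz.1.
have [t [j [t0 tY tj]]] := ray_leaves cv Pz yz y0.
have yj : 0 < lorentz y (v j).
  have := Pz.2 j; move: tj; rewrite !lorentz_lin => tj zj.
  have : 0 < t * lorentz y (v j) by lra.
  by move=> h; rewrite ltNge; apply/negP => yj0; move: h; rewrite ltNge mulr_ge0_le0.
pose r i := - lorentz z (v i) / lorentz y (v i).
case: (Order.TotalTheory.arg_minP r (P := fun i => 0 < lorentz y (v i)) yj) => i yi ri.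
have ri0 : 0 <= r i by rewrite divr_ge0 ?oppr_ge0 ?(ltW yi) //; exact: Pz.2.
have rt : r i <= t.
  apply: (le_trans (ri j yj)); rewrite /r ler_pdivrMr //.
  by move: tj; rewrite !lorentz_lin; lra.
have rY : r i ^+ 2 * lorentz y y < 1.
  apply: le_lt_trans tY; rewrite ler_wpM2r //.
    exact: tangent_ge0 (hyperbolic_future hz) yz.
  by rewrite lerXn2r // nnegrE.
have fr := future_tangent hz yz rY.
exists (r i), i; split=> //; last first.
  by rewrite !lorentz_lin divfK ?subrr // lt0r_neq0.
split; first exact: normalize_hyperbolic.
move=> l; rewrite lorentz_normalize_le0 // !lorentz_lin.
have [yl|yl] := ltP 0 (lorentz y (v l)).
  have : r i * lorentz y (v l) <= - lorentz z (v l).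
    by rewrite -ler_pdivlMr //; exact: ri.
  lra.
by rewrite -[leRHS]addr0 lerD ?mulr_ge0_le0 //; exact: Pz.2.
Qed.

(** An extreme point of the polytope, in terms of the facets through it. *)
Definition is_vertex z := P z /\ forall y, lorentz y z = 0 ->
  (forall i, lorentz z (v i) = 0 -> lorentz y (v i) = 0) -> y = 0.

(** Moving along the facets through z reaches a new facet, as long as z is not a
   vertex. *)
Lemma vertex_above z : P z -> exists z', is_vertex z' /\
  forall i, lorentz z (v i) = 0 -> lorentz z' (v i) = 0.
Proof.
have [k] := ubnP #|[pred i | lorentz z (v i) != 0]|.
elim: k z => // k IH z; rewrite ltnS => zk Pz.
have [zv|/not_andP[//|/existsNP[y /not_implyP[yz /not_implyP[yv /eqP y0]]]]] :=
  pselect (is_vertex z); first by exists z.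
have [t [i [t0 Pw fw yi wi]]] := exit_ray Pz yz y0.
set w := normalize _ in Pw; have zw l : lorentz z (v l) = 0 -> lorentz w (v l) = 0.
  move=> zl; apply: lorentz_normalize_eq0 => //.
  by rewrite !lorentz_lin zl (yv _ zl) mulr0 addr0.
have [|z' [vz' wz']] := IH w _ Pw; last by exists z'; split=> // l /zw/wz'.
apply: leq_trans zk; apply: proper_card; apply/properP; split.
  apply/fintype.subsetP => l; rewrite !inE; apply: contra => /eqP zl.
  by apply/eqP; exact: zw.
exists i; rewrite !inE; last by rewrite negbK lorentz_normalize_eq0.
by apply/eqP => /yv yi0; move: yi; rewrite yi0 ltxx.
Qed.

(** The facets through z are taken care of by the hypothesis on y, and the
   finitely many others do not contain the points close to z. *)
Lemma tangent_move z y : P z -> lorentz y z = 0 ->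
  (forall i, lorentz z (v i) = 0 -> lorentz y (v i) <= 0) ->
  exists2 e, 0 < e & forall t, 0 < t <= e ->
    [/\ t ^+ 2 * lorentz y y < 1, P (normalize (z + t *: y)) &
        forall i, lorentz z (v i) < 0 -> lorentz (z + t *: y) (v i) < 0].
Proof.
move=> Pz yz yv; have hz := Pz.1.
have Y0 := tangent_ge0 (hyperbolic_future hz) yz; set Y := lorentz y y in Y0 *.
have [i|e e0 eP] := @finite_eps R m (fun i t => lorentz (z + t *: y) (v i) <= 0 /\
    (lorentz z (v i) < 0 -> lorentz (z + t *: y) (v i) < 0)).
  have [zi|zi] := eqVneq (lorentz z (v i)) 0.
    exists 1 => // t /andP[t0 _]; rewrite !lorentz_lin zi add0r; split.
      by rewrite mulr_ge0_le0 ?yv // ltW.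
    by rewrite ltxx.
  have {}zi : lorentz z (v i) < 0 by rewrite lt_neqAle zi; exact: Pz.2.
  pose d := `|lorentz y (v i)| + 1.
  have d0 : 0 < d by rewrite ltr_wpDl.
  exists (- lorentz z (v i) / d); first by rewrite divr_gt0 ?oppr_gt0.
  move=> t /andP[t0]; rewrite ler_pdivlMr // => td.
  suff h : lorentz (z + t *: y) (v i) < 0 by split=> //; exact: ltW.
  rewrite !lorentz_lin.
  have : t * lorentz y (v i) <= t * `|lorentz y (v i)|.
    by rewrite ler_pM2l // ler_norm.
  by move: td; rewrite /d mulrDr mulr1; lra.
exists (Num.min e (Y + 1)^-1); first by rewrite lt_min e0 invr_gt0; lra.
move=> t /andP[t0]; rewrite le_min => /andP[te tY].
have {}tY : t ^+ 2 * Y < 1.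
  have tY1 : t * (Y + 1) <= 1 by rewrite -ler_pdivlMr ?div1r //; lra.
  nra.
have h i := eP t (introT andP (conj t0 te)) i.
have ft := future_tangent hz yz tY.
split=> //; last by move=> i; have [] := h i.
by split=> [|i]; [exact: normalize_hyperbolic|
  rewrite lorentz_normalize_le0 //; have [] := h i].
Qed.

(** The first order variation D cannot be compensated by the second order one. *)
Lemma descent_real (la D Y e : R) : 0 < la -> 0 < D -> 0 <= Y -> 0 < e ->
  (forall t, 0 < t <= e -> t ^+ 2 * Y < 1 ->
    (- la + t * D) <= - la * Num.sqrt (1 - t ^+ 2 * Y)) -> False.
Proof.
move=> la0 D0 Y0 e0 h.
have lY : 0 < 2 * (la * Y + 1) by have := mulr_ge0 (ltW la0) Y0; lra.
pose t := Num.min (Num.min e (Y + 1)^-1) (D / (2 * (la * Y + 1))).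
have t0 : 0 < t by rewrite !lt_min e0 invr_gt0 divr_gt0 // !andbT; lra.
have te : t <= e by rewrite /t !ge_min lexx.
have tD : t * (2 * (la * Y + 1)) <= D.
  by rewrite -ler_pdivlMr // /t ge_min lexx orbT.
have tY : t * (Y + 1) <= 1.
  by rewrite -ler_pdivlMr ?div1r; [rewrite /t !ge_min lexx orbT|lra].
have tY1 : t ^+ 2 * Y < 1 by nra.
have /h := tY1; rewrite t0 te => /(_ isT).
set r := Num.sqrt _ => hr.
have r0 : 0 <= r by exact: sqrtr_ge0.
have r2 : r ^+ 2 = 1 - t ^+ 2 * Y by rewrite sqr_sqrtr //; lra.
have tY0 : 0 <= t ^+ 2 * Y by rewrite mulr_ge0 ?sqr_ge0.
have r1 : r <= 1 by rewrite -(@ler_sqr _ r 1) ?nnegrE ?expr1n ?r2 //; lra.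
have rr : r ^+ 2 <= r by rewrite expr2 ler_piMr.
have : la * (1 - t ^+ 2 * Y) <= la * r by rewrite -r2 ler_wpM2l // ltW.
have : t * (la * Y) * 2 + t * 2 <= D by move: tD; lra.
have : t * (t * (la * Y) * 2 + t * 2) <= t * D by rewrite ler_pM2l //; lra.
have : 0 < t ^+ 2 by rewrite exprn_gt0.
have : 0 <= t ^+ 2 * (la * Y) by rewrite mulr_ge0 ?sqr_ge0 ?mulr_ge0 // ltW.
nra.
Qed.

Section Andreev.
Hypothesis orth : forall i j x, i != j -> P x -> lorentz x (v i) = 0 ->
  lorentz x (v j) = 0 -> lorentz (v i) (v j) = 0.
Hypothesis n0 : (0 < n)%N.

Lemma facet_max i j : exists z, [/\ P z, lorentz z (v j) = 0 &
  forall x, P x -> lorentz x (v j) = 0 -> lorentz x (v i) <= lorentz z (v i)].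
Proof.
pose F := P `&` [set x | lorentz x (v j) = 0].
have [x [Px xj]] := facet_nonempty cv j.
have [|||z /set_mem[Pz zj] zmax] :=
    @compact_EVT_max _ R (fun x => lorentz x (v i)) F.
- by exists x.
- apply: compact_closedI; first by case: cv.
  apply: (@closed_comp _ _ (fun x => lorentz x (v j)) [set 0]).
    by move=> y _; exact: lorentz_continuous.
  exact: closed_eq.
- by apply: continuous_subspaceT; exact: lorentz_continuous.
by exists z; split=> // y Py yj; apply: zmax; apply/mem_set.
Qed.

Lemma no_ascent i j z y : P z -> lorentz z (v j) = 0 ->
  (forall x, P x -> lorentz x (v j) = 0 -> lorentz x (v i) <= lorentz z (v i)) ->
  lorentz z (v i) < 0 -> lorentz y z = 0 -> lorentz y (v j) = 0 ->
  (forall l, lorentz z (v l) = 0 -> lorentz y (v l) <= 0) ->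
  lorentz y (v i) <= 0.
Proof.
move=> Pz zj zmax zi yz yj yt; rewrite leNgt; apply/negP => yi.
have hz := Pz.1; have Y0 := tangent_ge0 (hyperbolic_future hz) yz.
have [e e0 eP] := tangent_move Pz yz yt.
have la0 : 0 < - lorentz z (v i) by rewrite oppr_gt0.
apply: (descent_real la0 yi Y0 e0) => t te tY.
have [_ Pt _] := eP t te; have ft := future_tangent hz yz tY.
have := zmax _ Pt; rewrite /normalize lorentz_tangent_sq // !lorentz_lin.
rewrite zj yj mulr0 addr0 mulr0 => /(_ erefl).
rewrite opprK mulrC ler_pdivrMr // sqrtr_gt0; lra.
Qed.

(** Let z be the point of the facet j nearest to the hyperplane of the facet i.
   Optimality expresses v_i as a combination of z and of the normals of the
   facets through z, where only the coefficient of v_j may be negative. *)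
Lemma nearest_point i j : i != j ->
  (forall x, P x -> lorentz x (v i) = 0 -> lorentz x (v j) != 0) ->
  exists z, [/\ P z, lorentz z (v j) = 0, lorentz z (v i) < 0,
    forall l, l != j -> lorentz z (v l) = 0 -> 0 <= lorentz (v i) (v l) &
    v i = - lorentz z (v i) *: z +
          \sum_(l | lorentz z (v l) == 0) lorentz (v i) (v l) *: v l].
Proof.
move=> ij disj; have [z [Pz zj zmax]] := facet_max i j.
have zi : lorentz z (v i) < 0.
  rewrite lt_neqAle Pz.2 andbT; apply/eqP => zi.
  by have := disj z Pz zi; rewrite zj eqxx.
have zz : lorentz z z = -1 by case: Pz.1.
exists z; split=> //.
  move=> l lj zl; rewrite -oppr_le0 lorentzC -lorentz_lin.
  apply: (no_ascent Pz zj zmax zi); rewrite ?lorentz_lin.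
  - by rewrite lorentzC zl oppr0.
  - by rewrite (orth lj Pz zl zj) oppr0.
  move=> k zk; rewrite lorentz_lin; have [<-|lk] := eqVneq l k.
    by rewrite v1 oppr_le0.
  by rewrite (orth lk Pz zl zk) oppr0.
set w := \sum_(l | _) _.
have wk k : lorentz z (v k) = 0 -> lorentz w (v k) = lorentz (v i) (v k).
  move=> zk; rewrite lorentz_suml (bigD1 k) ?zk //= lorentz_lin v1 mulr1.
  rewrite big1 ?addr0 // => l /andP[/eqP zl lk].
  by rewrite lorentz_lin (orth lk Pz zl zk) mulr0.
have wz : lorentz w z = 0.
  rewrite lorentz_suml big1 // => l /eqP zl.
  by rewrite lorentz_lin [lorentz (v l) z]lorentzC zl mulr0.
have [y yE] : exists y, y = v i + lorentz z (v i) *: z - w by eexists.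
have yz : lorentz y z = 0.
  by rewrite yE !lorentz_lin wz zz [lorentz (v i) z]lorentzC; ring.
have yk k : lorentz z (v k) = 0 -> lorentz y (v k) = 0.
  by move=> zk; rewrite yE !lorentz_lin zk (wk _ zk); ring.
have yw : lorentz y w = 0.
  rewrite lorentzC lorentz_suml big1 // => l /eqP zl.
  by rewrite lorentz_lin [lorentz (v l) y]lorentzC (yk _ zl) mulr0.
have yy : lorentz y (v i) = lorentz y y.
  have -> : v i = y + w - lorentz z (v i) *: z by rewrite yE subrK addrK.
  by rewrite !lorentz_lin yz yw; ring.
have y0 : y = 0.
  apply: (tangent_eq0 (poly_future Pz) yz); apply/eqP.
  rewrite eq_le (tangent_ge0 (poly_future Pz) yz) andbT -yy.
  apply: (no_ascent Pz zj zmax zi yz (yk _ zj)) => l zl.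
  by rewrite yk.
by apply/eqP; rewrite -subr_eq0 -y0 yE scaleNr opprD opprK addrA.
Qed.

(** The coefficient of v_j is negative, since otherwise the halfspaces of the
   other vectors would make the facet i empty.  The same then holds for every
   facet disjoint from i, so that the other coefficients, being nonnegative,
   belong to facets meeting i and vanish. *)
Lemma disjoint_facets_lt0 i j : i != j ->
  (forall x, P x -> lorentz x (v i) = 0 -> lorentz x (v j) != 0) ->
  lorentz (v i) (v j) < 0.
Proof.
move=> ij disj; have [z [Pz zj zi zl vE]] := nearest_point ij disj.
rewrite ltNge; apply/negP => gij.
have [x [Px xi]] := facet_nonempty cv i.
have : lorentz x (v i) < 0; last by rewrite xi ltxx.
rewrite vE !lorentz_lin [lorentz x (\sum_(l | _) _)]lorentzC lorentz_suml.
have : lorentz x z < 0 by exact: future_lorentz_lt0 (poly_future Px) (poly_future Pz).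
move=> xz; have : - lorentz z (v i) * lorentz x z < 0.
  by rewrite nmulr_llt0 // oppr_gt0.
suff : \sum_(l | lorentz z (v l) == 0) lorentz (lorentz (v i) (v l) *: v l) x <= 0.
  lra.
apply: sumr_le0 => l /eqP zl0; rewrite lorentz_lin [lorentz (v l) x]lorentzC.
apply: mulr_ge0_le0; last exact: Px.2.
by have [->//|lj] := eqVneq l j; exact: zl.
Qed.

(** The sum of [nearest_point] reduces to its term v_j: a facet l through z other
   than j has a nonnegative coefficient, hence meets i by
   [disjoint_facets_lt0], so that its coefficient vanishes. The norm of v_i is
   then 1 = - a ^ 2 + b ^ 2, where a = <z, v_i> and b = <v_i, v_j> < 0. *)
Theorem disjoint_facets_lt i j : i != j ->
  (forall x, P x -> lorentz x (v i) = 0 -> lorentz x (v j) != 0) ->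
  lorentz (v i) (v j) < -1.
Proof.
move=> ij disj; have neg := disjoint_facets_lt0 ij disj.
have [z [Pz zj zi zl vE]] := nearest_point ij disj.
have zz : lorentz z z = -1 by case: Pz.1.
have vE2 : v i = - lorentz z (v i) *: z + lorentz (v i) (v j) *: v j.
  rewrite {1}vE; congr (_ + _); rewrite (bigD1 j) ?zj //= big1 ?addr0 //.
  move=> l /andP[/eqP zl0 lj]; have gl := zl l lj zl0.
  have il : i != l by apply: contraTneq zi => ->; rewrite zl0 ltxx.
  have [[x [Px xi xl]]|ndisj] :=
      pselect (exists x, [/\ P x, lorentz x (v i) = 0 & lorentz x (v l) = 0]).
    by rewrite (orth il Px xi xl) scale0r.
  have := @disjoint_facets_lt0 i l il.
  rewrite ltNge gl => /(_ _)/wrap[] // x Px xi; apply/eqP => xl.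
  by apply: ndisj; exists x.
have := v1 i; rewrite {1 2}vE2 !lorentz_lin zz v1 zj [lorentz (v j) z]lorentzC zj.
move: zi neg; set a := lorentz z (v i); set b := lorentz (v i) (v j).
move=> a0 b0 ab; have : 0 < a ^+ 2 by rewrite exprn_even_gt0 //= lt_eqF.
nra.
Qed.

End Andreev.
End PolytopeFaces.

(** * Linear algebra of the Lorentzian form *)

Section LinearAlgebra.
Variables (R : realType) (n : nat).
Implicit Types (x y z u : 'cV[R]_n.+1).

(** The Gram matrix of the family is diagonal and invertible. *)
Lemma orthogonal_basis (b : 'I_n.+1 -> 'cV[R]_n.+1) u :
  (forall i j, i != j -> lorentz (b i) (b j) = 0) ->
  (forall i, lorentz (b i) (b i) != 0) ->
  (forall i, lorentz u (b i) = 0) -> u = 0.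
Proof.
move=> b0 b1 ub; pose B := \matrix_(i, j) b j i 0.
have colB j : col j B = b j by apply/colP => i; rewrite !mxE.
have gram : B^T *m lorentz_mx R n *m B = diag_mx (\row_i lorentz (b i) (b i)).
  apply/matrixP => i j; rewrite !mxE -colB.
  transitivity (lorentz (b i) (b j)).
    rewrite /lorentz -!colB [(col i B)^T]tr_col -!row_mul colE mulmxA -colE.
    by rewrite !mxE; apply: eq_bigr => l _; rewrite !mxE.
  by rewrite colB; case: eqVneq => [->|/b0]; rewrite ?mulr1n ?mulr0n.
have uB : B \in unitmx.
  have : B^T *m lorentz_mx R n *m B \in unitmx.
    rewrite gram unitmxE det_diag unitfE; apply/prodf_neq0 => i _.
    by rewrite mxE.
  by rewrite unitmx_mul => /andP[].
have : u^T *m lorentz_mx R n *m B = 0.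
  apply/rowP => j; rewrite [RHS]mxE -(ub j) /lorentz -(colB j).
  by rewrite colE mulmxA -colE [RHS]mxE.
move=> /(congr1 (mulmx^~ (invmx B))); rewrite mulmxK // mul0mx => uJ.
by apply: lorentz_nondeg => y; rewrite /lorentz uJ mul0mx mxE.
Qed.

Lemma exists_orthogonal q (b : 'I_q -> 'cV[R]_n.+1) : (q <= n)%N ->
  exists2 u, u != 0 & forall i, lorentz u (b i) = 0.
Proof.
move=> qn; pose A := lorentz_mx R n *m \matrix_(i, j) b j i 0.
have : kermx A != 0.
  rewrite -mxrank_eq0 mxrank_ker subn_eq0 -ltnNge ltnS.
  exact: leq_trans (rank_leq_col A) qn.
case/rowV0Pn => w wk w0; exists w^T.
  by apply: contra_neq w0 => w0; apply: trmx_inj; rewrite w0 trmx0.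
move=> i; have wA : w *m A = 0 by apply/sub_kermxP.
have -> : b i = col i (\matrix_(i, j) b j i 0) by apply/colP => l; rewrite !mxE.
by rewrite /lorentz trmxK colE mulmxA -colE -[w *m _ *m _]mulmxA -/A wA !mxE.
Qed.

End LinearAlgebra.

Section DihedralAngles.
Variables (R : realType) (n m : nat) (v : 'I_m -> 'cV[R]_n.+1).
Hypothesis cv : compact_polytope v.
Local Notation P := (poly_of v).

Let v1 i : lorentz (v i) (v i) = 1. Proof. by case: cv. Qed.

Lemma facets_meet_lt1 i j x : i != j -> P x -> lorentz x (v i) = 0 ->
  lorentz x (v j) = 0 -> -1 < lorentz (v i) (v j) < 1.
Proof.
move=> ij Px xi xj; have fx := poly_future Px.
have vx l : lorentz x (v l) = 0 -> lorentz (v l) x = 0 by rewrite lorentzC.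
have /andP[ge le] := tangent_unit_le1 fx (vx _ xi) (vx _ xj) (v1 i) (v1 j).
rewrite !lt_neqAle ge le !andbT; apply/andP; split; apply/eqP => E.
  have := @tangent_eq0 _ _ x (v i + v j) fx.
  rewrite !lorentz_lin !vx // !v1 [lorentz (v j) _]lorentzC -E => /(_ _ _)/wrap[].
  - by rewrite addr0.
  - by ring.
  move=> /eqP; rewrite addr_eq0 => /eqP vij.
  have [w wP] := poly_interior cv; have := wP j; have := wP i.
  by rewrite vij lorentz_lin; lra.
have := @tangent_eq0 _ _ x (v i - v j) fx.
rewrite !lorentz_lin !vx // !v1 [lorentz (v j) _]lorentzC E => /(_ _ _)/wrap[].
- by rewrite subr0.
- by ring.
move=> /eqP; rewrite subr_eq0 => /eqP; case: (cv) => _ vinj _ _ _ /vinj vij.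
by rewrite vij eqxx in ij.
Qed.

Lemma right_angle i j x : right_angled v -> i != j -> P x ->
  lorentz x (v i) = 0 -> lorentz x (v j) = 0 ->
  has_hdim (face v [set i; j]) (n - 2) -> lorentz (v i) (v j) = 0.
Proof.
move=> ra ij Px xi xj /(ra _ _ ij) ang.
have /andP[g1 g2] := facets_meet_lt1 ij Px xi xj.
have : cos (acos (- lorentz (v i) (v j))) = - lorentz (v i) (v j).
  by apply: acosK; rewrite in_itv /=; apply/andP; split; lra.
by rewrite ang cos_pihalf; lra.
Qed.

End DihedralAngles.

(** * Right-angled polygons *)

Section Polygon.
Variables (R : realType) (k : nat) (v : 'I_k -> 'cV[R]_3).
Hypothesis rv : right_angled_polygon v.
Local Notation P := (poly_of v).

Let cv : compact_polytope v. Proof. by case: rv. Qed.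
Let v1 i : lorentz (v i) (v i) = 1. Proof. by case: cv. Qed.

Lemma orthogonal_frame (a b c u : 'cV[R]_3) :
  lorentz a a != 0 -> lorentz b b != 0 -> lorentz c c != 0 ->
  lorentz a b = 0 -> lorentz a c = 0 -> lorentz b c = 0 ->
  lorentz u a = 0 -> lorentz u b = 0 -> lorentz u c = 0 -> u = 0.
Proof.
move=> a0 b0 c0 ab ac bc ua ub uc.
apply: (@orthogonal_basis R 2 (fun i : 'I_3 => [:: a; b; c]`_i)).
- move=> i j; rewrite -val_eqE; move: i j.
  by move=> [[|[|[|//]]] ?] [[|[|[|//]]] ?] //= _; rewrite // lorentzC.
- by move=> [[|[|[|//]]] ?].
- by move=> [[|[|[|//]]] ?].
Qed.

Lemma sides_orthogonal i j x : i != j -> P x -> lorentz x (v i) = 0 ->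
  lorentz x (v j) = 0 -> lorentz (v i) (v j) = 0.
Proof.
move=> ij Px xi xj; apply: (right_angle cv rv.2 ij Px xi xj).
have xx : lorentz x x = -1 by case: Px.1.
have /andP[g1 g2] := facets_meet_lt1 cv ij Px xi xj.
exists x; split.
- rewrite -mxrank_tr rank_rV (_ : x^T != 0) //.
  apply: contra_eq_neq xx => x0; rewrite /lorentz x0 !mul0mx mxE.
  by rewrite eq_sym oppr_eq0 oner_neq0.
- move=> l; rewrite (_ : col l x = x); last first.
    by apply/colP => q; rewrite mxE ord1.
  by split=> // q [->|->].
move=> y [Py yI]; exists (- lorentz y x)%:M; rewrite mul_mx_scalar.
have yi : lorentz y (v i) = 0 by apply: yI; left.
have yj : lorentz y (v j) = 0 by apply: yI; right.
apply/eqP; rewrite -subr_eq0; apply/eqP.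
apply: (@orthogonal_frame x (v i) (v j - lorentz (v i) (v j) *: v i)).
- by rewrite xx oppr_eq0 oner_neq0.
- by rewrite v1 oner_neq0.
- rewrite !lorentz_lin !v1 [lorentz (v j) (v i)]lorentzC.
  by apply: lt0r_neq0; nra.
- exact: xi.
- by rewrite !lorentz_lin xi xj mulr0 subrr.
- by rewrite !lorentz_lin v1; ring.
- by rewrite !lorentz_lin xx; ring.
- by rewrite !lorentz_lin yi xi; ring.
- by rewrite !lorentz_lin yi yj xi xj; ring.
Qed.

Definition adjacent (i j : 'I_k) := (i != j) && (lorentz (v i) (v j) == 0).

Lemma adjacent_sym : symmetric adjacent.
Proof. by move=> i j; rewrite /adjacent eq_sym lorentzC. Qed.

Lemma adjacent_irr i : adjacent i i = false.
Proof. by rewrite /adjacent /= eqxx. Qed.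

Lemma adjacent_meet i j : adjacent i j ->
  exists x, [/\ P x, lorentz x (v i) = 0 & lorentz x (v j) = 0].
Proof.
move=> /andP[ij /eqP gij]; apply: contrapT => nomeet.
have := disjoint_facets_lt cv sides_orthogonal ij.
rewrite gij => /(_ _)/wrap[]; last by lra.
by move=> x Px xi; apply/eqP => xj; apply: nomeet; exists x.
Qed.

Lemma adjacent_or_lt i j : i != j -> adjacent i j \/ lorentz (v i) (v j) < -1.
Proof.
move=> ij; have [[x [Px xi xj]]|nomeet] :=
    pselect (exists x, [/\ P x, lorentz x (v i) = 0 & lorentz x (v j) = 0]).
  by left; rewrite /adjacent /= ij (sides_orthogonal ij Px xi xj) eqxx.
right; apply: (disjoint_facets_lt cv sides_orthogonal ij) => x Px xi.
by apply/eqP => xj; apply: nomeet; exists x.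
Qed.

Lemma exists_adjacent i : exists j, adjacent i j.
Proof.
have [x [Px xi]] := facet_nonempty cv i.
have [z [[Pz zv] /(_ i xi) zi]] := vertex_above cv Px.
apply: contrapT => /forallNP no.
have [u u0 uP] := @exists_orthogonal R 2 2 (fun l => if l == ord0 then z else v i) isT.
have uz := uP ord0; have ui : lorentz u (v i) = 0 := uP ord_max.
move/eqP: u0; apply; apply: zv => // l zl.
have [<-//|il] := eqVneq i l.
by case: (no l); rewrite /adjacent /= il (sides_orthogonal il Pz zi zl) eqxx.
Qed.

(** The side i is followed from its vertex on j to its other end. *)
Lemma exists_other_adjacent i j : adjacent i j ->
  exists2 l, l != j & adjacent i l.
Proof.
move=> ij; have [z [Pz zi zj]] := adjacent_meet ij.
have /andP[_ /eqP gij] := ij.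
have [||t [l [_ Pw fw jl wl]]] := @exit_ray _ _ _ _ cv z (- v j) Pz.
- by rewrite lorentz_lin lorentzC zj oppr0.
- rewrite oppr_eq0; apply: contra_eq_neq (v1 j) => ->.
  by rewrite lorentz0l eq_sym oner_neq0.
have il : i != l.
  by apply: contraTneq jl => <-; rewrite lorentz_lin lorentzC gij oppr0 ltxx.
exists l; first by apply: contraTneq jl => ->; rewrite lorentz_lin v1 oppr_gt0 ltr10.
rewrite /adjacent /= il; apply/eqP; apply: (sides_orthogonal il Pw).
  apply: lorentz_normalize_eq0 => //.
  by rewrite !lorentz_lin zi [lorentz (v j) _]lorentzC gij; ring.
exact: lorentz_normalize_eq0.
Qed.

(** On the geodesic carrying the side i, the normals of two other adjacent
   sides point away from each other. *)
Lemma adjacent_neighbours i j l : adjacent i j -> adjacent i l -> j != l ->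
  lorentz (v j) (v l) < -1.
Proof.
move=> ij il jl; have [/andP[_ /eqP gjl]|//] := adjacent_or_lt jl.
have [z [Pz zi zj]] := adjacent_meet ij.
have /andP[_ /eqP gij] := ij; have /andP[_ /eqP gil] := il.
have zz : lorentz z z = -1 by case: Pz.1.
have E : v l + lorentz (v l) z *: z = 0.
  apply: (@orthogonal_frame (v i) (v j) z); rewrite ?v1 ?zz ?oppr_eq0 ?oner_neq0 //.
  - by rewrite lorentzC.
  - by rewrite lorentzC.
  - by rewrite !lorentz_lin zi lorentzC gil; ring.
  - by rewrite !lorentz_lin zj lorentzC gjl; ring.
  - by rewrite !lorentz_lin zz; ring.
have : lorentz (v l + lorentz (v l) z *: z) (v l) = 0 by rewrite E lorentz0l.
by rewrite !lorentz_lin v1 [lorentz z _]lorentzC; nra.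
Qed.

(** On the geodesic carrying the side i, the sides j, l and q would point pairwise
   away from each other, [adjacent_neighbours]; a line has only two ends. *)
Lemma at_most_two_adjacent i j l q : adjacent i j -> adjacent i l ->
  adjacent i q -> [|| j == l, l == q | j == q].
Proof.
move=> ij il iq; apply/negPn; rewrite !negb_or.
apply/negP => /and3P[jl lq jq].
have gjl := adjacent_neighbours ij il jl.
have gjq := adjacent_neighbours ij iq jq.
have glq := adjacent_neighbours il iq lq.
have [z [Pz zi zj]] := adjacent_meet ij.
have /andP[_ /eqP gij] := ij; have /andP[_ /eqP gil] := il.
have /andP[_ /eqP giq] := iq.
have zz : lorentz z z = -1 by case: Pz.1.
have E r : lorentz (v i) (v r) = 0 ->
    v r + lorentz (v r) z *: z - lorentz (v j) (v r) *: v j = 0.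
  move=> gir.
  apply: (@orthogonal_frame (v i) (v j) z); rewrite ?v1 ?zz ?oppr_eq0 ?oner_neq0 //.
  - by rewrite lorentzC.
  - by rewrite lorentzC.
  - by rewrite !lorentz_lin zi [lorentz (v r) (v i)]lorentzC [lorentz (v j) (v i)]lorentzC gir gij; ring.
  - by rewrite !lorentz_lin zj v1 [lorentz (v r) (v j)]lorentzC; ring.
  - by rewrite !lorentz_lin zz [lorentz (v j) z]lorentzC zj; ring.
have : lorentz (v l + lorentz (v l) z *: z - lorentz (v j) (v l) *: v j) (v l) = 0.
  by rewrite (E l gil) lorentz0l.
have : lorentz (v q + lorentz (v q) z *: z - lorentz (v j) (v q) *: v j) (v q) = 0.
  by rewrite (E q giq) lorentz0l.
have : lorentz (v l + lorentz (v l) z *: z - lorentz (v j) (v l) *: v j) (v q) = 0.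
  by rewrite (E l gil) lorentz0l.
rewrite !lorentz_lin !v1 [lorentz z (v l)]lorentzC [lorentz z (v q)]lorentzC.
have := Pz.2 l; have := Pz.2 q; rewrite ![lorentz z _]lorentzC.
move: gjl gjq glq.
move: (lorentz (v j) (v l)) (lorentz (v j) (v q)) (lorentz (v l) (v q)) => a b c.
move: (lorentz (v l) z) (lorentz (v q) z) => s t a1 b1 c1 t0 s0 h1 h2 h3.
have sa : - s < - a by nra.
have tb : - t < - b by nra.
nra.
Qed.

End Polygon.

Section PolygonConnected.
Variables (R : realType) (k : nat) (v : 'I_k -> 'cV[R]_3).
Hypothesis rv : right_angled_polygon v.
Local Notation P := (poly_of v).
Local Notation O := (delta_mx ord_max 0 : 'cV[R]_3).

Let cv : compact_polytope v. Proof. by case: rv. Qed.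
Let v1 i : lorentz (v i) (v i) = 1. Proof. by case: cv. Qed.

(** A side j outside a connected component of the adjacency graph stays at a
   definite distance from the vertices of that component.  In the affine chart
   dividing by the last coordinate, a vertex where v_j is maximal among those
   of the component is a local maximum of v_j on the polygon, hence a global
   one, although v_j vanishes on the side j. *)
Lemma polygon_connected i j : connect (adjacent v) i j.
Proof.
apply/negPn/negP => nij.
pose C a := connect (adjacent v) i a.
have Cclosed a b : C a -> adjacent v a b -> C b.
  by move=> Ca ab; apply: connect_trans Ca (connect1 ab).
pose zz (p : 'I_k * 'I_k) := xget 0
  [set x | [/\ P x, lorentz x (v p.1) = 0 & lorentz x (v p.2) = 0]].
have zzP p : adjacent v p.1 p.2 ->
    [/\ P (zz p), lorentz (zz p) (v p.1) = 0 & lorentz (zz p) (v p.2) = 0].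
  by move=> /(adjacent_meet rv) h; exact: (xgetPex 0 h).
have last_gt0 x : P x -> 0 < x ord_max 0 by case=> [[]].
pose phi p := lorentz (v j) (zz p) / zz p ord_max 0.
have [b0 ib0] := exists_adjacent rv i.
have init : C (i, b0).1 && adjacent v (i, b0).1 (i, b0).2.
  by rewrite /C /= connect0.
case: (Order.TotalTheory.arg_maxP phi (P := fun p => C p.1 && adjacent v p.1 p.2) init).
move=> [a b] /= /andP[Ca ab] pmax; set M := phi (a, b) in pmax.
have [/= Pz za zb] := zzP (a, b) ab; set z := zz (a, b) in Pz za zb.
have M0 : M < 0.
  rewrite /M /phi -/z pmulr_llt0 ?invr_gt0 ?last_gt0 //.
  rewrite lt_neqAle lorentzC Pz.2 andbT; apply/eqP => zj.
  have aj : a != j by apply: contraNneq nij => <-.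
  move/negP: nij; apply; apply: (Cclosed a) => //.
  by rewrite /adjacent aj (sides_orthogonal rv aj Pz za zj) eqxx.
have [xi xiE] : exists xi, xi = v j + M *: O by eexists.
have xiL x : lorentz xi x = lorentz (v j) x - M * x ord_max 0.
  by rewrite xiE !lorentz_lin lorentz_basel mulrN.
have xi_le p : C p.1 -> adjacent v p.1 p.2 -> lorentz xi (zz p) <= 0.
  move=> Cp pp; have [Pp _ _] := zzP p pp.
  rewrite xiL subr_le0 -ler_pdivrMr ?last_gt0 //.
  by apply: pmax; rewrite Cp.
have xiz : lorentz xi z = 0.
  by rewrite xiL /M /phi -/z divfK ?subrr // lt0r_neq0 // last_gt0.
have /andP[anb /eqP gab] := ab.
have zz1 : lorentz z z = -1 by case: Pz.1.
have E : xi - lorentz xi (v a) *: v a - lorentz xi (v b) *: v b = 0.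
  apply: (@orthogonal_frame R (v a) (v b) z);
    rewrite ?v1 ?zz1 ?oppr_eq0 ?oner_neq0 //.
  - by rewrite lorentzC.
  - by rewrite lorentzC.
  - by rewrite !lorentz_lin v1 [lorentz (v b) _]lorentzC gab; ring.
  - by rewrite !lorentz_lin v1 gab; ring.
  - by rewrite !lorentz_lin [lorentz (v b) z]lorentzC [lorentz (v a) z]lorentzC xiz za zb; ring.
have xiE2 x : lorentz xi x =
    lorentz xi (v a) * lorentz x (v a) + lorentz xi (v b) * lorentz x (v b).
  have : lorentz (xi - lorentz xi (v a) *: v a - lorentz xi (v b) *: v b) x = 0.
    by rewrite E lorentz0l.
  by rewrite !lorentz_lin [lorentz x (v a)]lorentzC [lorentz x (v b)]lorentzC; lra.
have coef c d : C c -> adjacent v c d ->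
    (forall x, lorentz x (v c) = 0 -> lorentz xi x = lorentz xi (v d) * lorentz x (v d)) ->
    0 <= lorentz xi (v d).
  move=> Cc cd xicd; have [d' d'd cd'] := exists_other_adjacent rv cd.
  have [/= Pw wc wd'] := zzP (c, d') cd'.
  have := xi_le (c, d') Cc cd'; rewrite (xicd _ wc) => h.
  have wd : lorentz (zz (c, d')) (v d) < 0.
    rewrite lt_neqAle Pw.2 andbT; apply/eqP => wd.
    have := adjacent_neighbours rv cd' cd d'd.
    by rewrite (sides_orthogonal rv d'd Pw wd' wd) ltr0N1.
  by rewrite leNgt; apply/negP => neg; move: h; rewrite leNgt nmulr_rgt0 // wd.
have beta0 : 0 <= lorentz xi (v b).
  by apply: (coef a b Ca ab) => x xa; rewrite xiE2 xa mulr0 add0r.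
have alpha0 : 0 <= lorentz xi (v a).
  have ba : adjacent v b a by rewrite adjacent_sym.
  apply: (coef b a (Cclosed _ _ Ca ab) ba) => x xb.
  by rewrite xiE2 xb mulr0 addr0.
have [y [Py yj]] := facet_nonempty cv j.
have : lorentz xi y <= 0.
  by rewrite xiE2 -[leRHS]addr0 lerD // mulr_ge0_le0 //; exact: Py.2.
rewrite xiL lorentzC yj sub0r oppr_le0 leNgt => /negP; apply.
by rewrite pmulr_llt0 // last_gt0.
Qed.

End PolygonConnected.

(** * Cyclic labelling of a connected 2-regular graph *)

Section CycleLabelling.
Variables (k : nat) (e : rel 'I_k) (i0 : 'I_k).
Hypotheses (esym : symmetric e) (eirr : irreflexive e).
Hypothesis e_some : forall i, exists j, e i j.
Hypothesis e_other : forall i j, e i j -> exists2 l, l != j & e i l.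
Hypothesis e_two : forall i j l q, e i j -> e i l -> e i q ->
  [|| j == l, l == q | j == q].
Hypothesis e_conn : forall i j, connect e i j.

(** A walk that never turns back repeats a vertex, and the first repetition is that
   of its origin, since another vertex would have three neighbours. The cycle
   thus obtained is closed under adjacency, hence contains all vertices. *)
Lemma cycle_labelling : exists pos : 'I_k -> nat,
  [/\ injective pos, forall i, (pos i < k)%N &
      forall i j, e i j = (pos j == (pos i).+1 %% k)%N || (pos i == (pos j).+1 %% k)%N].
Proof.
pose nx i j := odflt j [pick l | (l != i) && e j l].
have nxP i j : e i j -> (nx i j != i) && e j (nx i j).
  rewrite esym => ji; rewrite /nx; case: pickP => [l //|no].
  by have [l li jl] := e_other ji; have := no l; rewrite li jl.
have [b0 ib0] := e_some i0.
pose w t := iter t (fun p : 'I_k * 'I_k => (p.2, nx p.1 p.2)) (i0, b0).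
pose s t := (w t).1.
have sS t : s t.+1 = (w t).2 by [].
have we t : e (w t).1 (w t).2.
  by elim: t => [//|t IH]; have /andP[] := nxP _ _ IH.
have se t : e (s t) (s t.+1) by exact: we.
have sne t : s t.+2 != s t by have /andP[] := nxP _ _ (we t).
have sne1 t : s t.+1 != s t.
  by apply: contraTneq (se t) => ->; rewrite eirr.
have [|q qP qmin] := @ex_minnP (fun q => [exists r : 'I_q, s q == s r]).
  apply: contrapT => /forallNP no.
  have : injective (fun t : 'I_k.+1 => s t).
    suff h a b : (a < b)%N -> s a <> s b.
      move=> a b ab; apply: val_inj => /=.
      by case: (ltngtP a b) => // [/h//|/h]; rewrite ab.
    move=> ab sab; apply: (no b); apply/existsP; exists (Ordinal ab).
    by rewrite sab.
  by move=> /leq_card; rewrite !card_ord ltnn.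
have sinj a b : (a < q)%N -> (b < q)%N -> s a = s b -> a = b.
  suff h x y : (x < y)%N -> (y < q)%N -> s x <> s y.
    move=> aq bq ab; case: (ltngtP a b) => // [/h/(_ bq)//|/h/(_ aq)].
    by rewrite ab.
  move=> xy yq sxy; have := qmin y; rewrite leqNgt yq => /(_ _)/wrap[] //.
  by apply/existsP; exists (Ordinal xy); rewrite sxy.
have [r /eqP sqr] := existsP qP; have rq := ltn_ord r.
have q1 : q != r.+1.
  by apply: contra_neqN (sne1 r) => /eqP <-; rewrite sqr.
have q2 : q != r.+2 by apply: contra_neqN (sne r) => /eqP <-; rewrite sqr.
have q3 : (r.+2 < q)%N.
  by rewrite ltn_neqAle eq_sym q2 /= ltn_neqAle eq_sym q1.
have r0 : r = 0%N :> nat.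
  case: (nat_of_ord r) sqr rq q1 q2 q3 => [//|r'] sqr rq q1 q2 q3.
  have qE : q = q.-1.+1 by rewrite prednK // (leq_ltn_trans _ rq).
  have E1 : e (s r'.+1) (s r') by rewrite esym.
  have E2 := se r'.+1.
  have E3 : e (s r'.+1) (s q.-1) by rewrite esym -sqr {2}qE.
  have [lt1 lt2 lt3] : [/\ (r' < q)%N, (r'.+2 < q)%N & (q.-1 < q)%N] by split; lia.
  have := e_two E1 E2 E3 => /or3P[] /eqP h.
  - by have := sinj _ _ lt1 lt2 h; lia.
  - by have := sinj _ _ lt2 lt3 h; lia.
  - by have := sinj _ _ lt1 lt3 h; lia.
rewrite r0 in sqr q3.
have q0 : (0 < q)%N by exact: ltn_trans q3.
have smod a : (a < q)%N -> s (a.+1 %% q)%N = s a.+1.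
  move=> aq; have [aq1|aq1] := ltnP a.+1 q; first by rewrite modn_small.
  have -> : a.+1 = q by apply/eqP; rewrite eqn_leq aq.
  by rewrite modnn sqr.
pose pr a := ((a + q.-1) %% q)%N.
have prq a : (pr a < q)%N by rewrite ltn_mod.
have prS a : (a < q)%N -> ((pr a).+1 %% q = a)%N.
  move=> aq; rewrite /pr -addn1 modnDml -addnA addn1 prednK //.
  by rewrite modnDr modn_small.
have nbr a j : (a < q)%N -> e (s a) j -> j = s a.+1 \/ j = s (pr a).
  move=> aq aj; have E1 := se a.
  have E2 : e (s a) (s (pr a)).
    by rewrite esym -{2}(prS a aq) smod.
  have ne : s a.+1 != s (pr a).
    rewrite -smod //; apply/eqP => /sinj h.
    have {}h := h (ltn_pmod _ q0) (prq a).
    have : (pr a).+1 = a.+2 %[mod q].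
      by rewrite -h -addn1 modnDml addn1.
    rewrite prS // => E; have : (0 = 2 %[mod q])%N.
      by apply/eqP; rewrite -(eqn_modDl a) addn0 addn2 -E modn_small.
    by rewrite mod0n modn_small.
  have := e_two E1 E2 aj; rewrite (negbTE ne) /= => /orP[] /eqP <-; by [right|left].
have surj j : exists a : 'I_q, s a = j.
  have := e_conn i0 j; case/connectP => p; elim/last_ind: p j => [|p x IH] j.
    by move=> _ ->; exists (Ordinal q0).
  rewrite rcons_path last_rcons => /andP[pp px] ->.
  have [a sa] := IH _ pp erefl; rewrite -sa in px.
  have [->|->] := nbr a x (ltn_ord a) px.
    by exists (Ordinal (ltn_pmod a.+1 q0)); rewrite /= smod.
  by exists (Ordinal (prq a)).
pose h (a : 'I_q) := s a.
have hinj : injective h.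
  by move=> a b /sinj ab; apply: val_inj; apply: ab; exact: ltn_ord.
have /choice[g gP] := surj.
have ginj : injective g by move=> i j ij; rewrite -(gP i) -(gP j) ij.
have kq : k = q.
  apply/eqP; rewrite eqn_leq; have := leq_card _ ginj; have := leq_card _ hinj.
  by rewrite !card_ord => -> ->.
exists (fun i => g i); split.
- by move=> i j /val_inj/ginj.
- by move=> i; rewrite [X in (_ < X)%N]kq ltn_ord.
have kmod a : (a %% k)%N = (a %% q)%N by rewrite [X in (_ %% X)%N = _]kq.
move=> i j; rewrite !kmod; have gi := ltn_ord (g i); have gj := ltn_ord (g j).
apply/idP/orP => [|[]/eqP E].
- rewrite -{1}(gP i) => ij; have [jE|jE] := nbr _ _ gi ij.
    left; apply/eqP; apply: sinj => //; first exact: ltn_pmod.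
    by rewrite gP smod.
  right; apply/eqP; rewrite (_ : g j = pr (g i) :> nat) ?prS //.
  by apply: sinj; rewrite ?gP ?prq.
- by rewrite -(gP i) -(gP j) E smod // se.
- by rewrite -(gP i) -(gP j) E smod // esym se.
Qed.
End CycleLabelling.

(** ** The regular model of a right-angled polygon *)

Section RegularPolygon.
Variables (R : realType) (k : nat).
Hypothesis k6 : (6 <= k)%N.
Local Notation theta := (2 * pi / k%:R : R).

Let k0 : (0 : R) < k%:R. Proof. by rewrite ltr0n (leq_trans _ k6). Qed.

Lemma cos_pi_third : cos (pi / 3 : R) = 1 / 2.
Proof.
set c := cos _; have c0 : 0 <= c.
  apply: cos_ge0_pihalf; have := pi_ge0 R; lra.
have : cos (pi / 3 *+ 2 + pi / 3) = -1 :> R.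
  by rewrite -cospi; congr cos; rewrite -mulr_natr; field.
rewrite cosD cos_mulr2n sin_mulr2n -/c.
have : cos (pi / 3 : R) ^+ 2 + sin (pi / 3 : R) ^+ 2 = 1 := cos2Dsin2 _.
rewrite -/c; set s := sin _ => cs h.
have {}h : (c + 1) * (2 * c - 1) ^+ 2 = 0.
  have -> : (c + 1) * (2 * c - 1) ^+ 2 = 4 * c ^+ 3 - 3 * c + 1 by ring.
  have s2 : s ^+ 2 = 1 - c ^+ 2 by lra.
  have -> : 4 * c ^+ 3 - 3 * c + 1
      = (c ^+ 2 *+ 2 - 1) * c - (c * (1 - c ^+ 2)) *+ 2 + 1 by ring.
  by rewrite -s2; lra.
move/eqP: h; rewrite mulf_eq0 expf_eq0 /= => /orP[] /eqP; lra.
Qed.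

Lemma theta_k : k%:R * theta = 2 * pi.
Proof. by rewrite mulrC divfK // lt0r_neq0. Qed.

Lemma theta_bounds : 0 < theta <= pi / 3.
Proof.
have p0 := pi_gt0 R; have k6' : (6 : R) <= k%:R by rewrite ler_nat.
rewrite divr_gt0 ?mulr_gt0 //= ler_pdivrMr //; nra.
Qed.

Lemma cos_theta_bounds : 1 / 2 <= cos theta < 1.
Proof.
have /andP[t0 t3] := theta_bounds; have p0 := pi_gt0 R.
apply/andP; split.
  rewrite -cos_pi_third leNgt; apply/negP.
  by rewrite ltr_cos ?in_itv /=; lra.
by rewrite -[ltRHS](@cos0 R) ltr_cos ?in_itv /=; lra.
Qed.

Lemma cos_theta_wrap d : (d <= k)%N -> cos ((k - d)%:R * theta) = cos (d%:R * theta).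
Proof.
move=> dk; rewrite natrB // mulrBl theta_k -cosN opprB -(cosD2pi (_ - _)).
by congr cos; rewrite -mulr_natl; ring.
Qed.

(** The worst case is d = 2, where 1 - cos (2 theta) is 2 (1 + cos theta)
   (1 - cos theta) and cos theta is at least 1 / 2. *)
Lemma cos_theta_le d : (2 <= d <= k - 2)%N ->
  1 - (1 - cos (d%:R * theta)) / (1 - cos theta) <= - (3 / 2).
Proof.
wlog dk : d / (d.*2 <= k)%N => [hw|].
  have [|dk] := leqP d.*2 k; first exact: hw.
  move=> /andP[d2 dk2]; have dk' : (d <= k)%N by lia.
  rewrite -(cos_theta_wrap dk'); apply: hw; lia.
move=> /andP[d2 _]; have /andP[t0 t3] := theta_bounds.
have /andP[c2 c1] := cos_theta_bounds; have p0 := pi_gt0 R.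
have dpi : d%:R * theta <= pi.
  have : (d.*2)%:R * theta <= 2 * pi by rewrite -[leRHS]theta_k ler_pM2r // ler_nat.
  by rewrite -mul2n natrM; lra.
have le2 : cos (d%:R * theta) <= 2 * cos theta ^+ 2 - 1.
  have -> : 2 * cos theta ^+ 2 - 1 = cos (2 * theta).
    by rewrite (_ : 2 * theta = theta *+ 2) ?cos_mulr2n ?mulr_natl // mulr_natl.
  rewrite leNgt; apply/negP.
  have : 2 * theta <= d%:R * theta by rewrite ler_pM2r // (ler_nat R 2).
  by move=> h; rewrite ltr_cos ?in_itv /=; lra.
have c10 : 0 < 1 - cos theta by lra.
have : 5 / 2 <= (1 - cos (d%:R * theta)) / (1 - cos theta).
  by rewrite ler_pdivlMr //; nra.
lra.
Qed.

Variable v : 'I_k -> 'cV[R]_3.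
Hypothesis kodd : ~~ odd k.
Hypothesis rv : right_angled_polygon v.

Let cv : compact_polytope v. Proof. by case: rv. Qed.

(** The sides of the polygon, in cyclic order, are sent to the directions of the
   vertices of a regular polygon. The number of sides being even, alternate
   signs give opposite components s to adjacent sides. *)
Theorem polygon_admits : admits_proper_action (reflection_group v) 3.
Proof.
have k_gt0 : (0 < k)%N by exact: leq_trans k6.
have [pos [pinj pk pe]] := cycle_labelling (Ordinal k_gt0)
  (adjacent_sym v) (adjacent_irr v) (exists_adjacent rv)
  (@exists_other_adjacent _ _ _ rv) (@at_most_two_adjacent _ _ _ rv)
  (polygon_connected rv).
pose x i (l : 'I_2) : R :=
  if l == ord0 then cos ((pos i)%:R * theta) else sin ((pos i)%:R * theta).
pose s i (l : 'I_1) : R := (-1) ^+ pos i.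
pose dist i j := (pos i - pos j + (pos j - pos i))%N.
have xE i j : dot (x i) (x j) = cos ((dist i j)%:R * theta).
  rewrite /dot big_ord_recl big_ord1 /x /= -cosB -mulrBl /dist.
  have [ij|ij] := leqP (pos i) (pos j).
    rewrite (_ : (pos i - pos j)%N = 0%N) ?add0n; last by apply/eqP.
    by rewrite natrB // -cosN -mulNr opprB.
  rewrite (_ : (pos j - pos i)%N = 0%N) ?addn0; last by apply/eqP; exact: ltnW.
  by rewrite natrB // ltnW.
have sE i j : dot (s i) (s j) = (-1) ^+ dist i j.
  have E : (pos i + pos j = dist i j + (minn (pos i) (pos j)).*2)%N.
    by rewrite /dist; lia.
  by rewrite /dot big_ord1 /s -exprD E exprD -mul2n exprM sqrrN !expr1n mulr1.
have [w wP] := poly_interior cv.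
apply: (@admits_of_model R 2 k 2 1 v x s (cos theta) (-1) cos_theta_bounds _ _ _ _ _ w wP).
- by rewrite ltrN10.
- by move=> i; rewrite xE /dist subnn mul0r cos0.
- by move=> i; rewrite sE /dist subnn expr0.
- by case: cv.
move=> i j ij; rewrite xE sE.
have pij : pos i <> pos j by move=> /pinj E; rewrite E eqxx in ij.
have pi_k := pk i; have pj_k := pk j.
have modS a : (a < k)%N -> ((a.+1 %% k)%N = if (a.+1 == k)%N then 0%N else a.+1).
  move=> ak; have [->|ne] := eqVneq a.+1 k; first by rewrite modnn.
  by rewrite modn_small // ltn_neqAle ne.
have [adj|nadj] := boolP (adjacent v i j); last first.
  have [|lt] := adjacent_or_lt rv ij; first by rewrite (negbTE nadj).
  right; split; first exact: ltW.
  apply: cos_theta_le; move: nadj; rewrite pe !modS // /dist.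
  by case: ((pos i).+1 =P k) => ?; case: ((pos j).+1 =P k) => ?; lia.
left; have /andP[_ /eqP gij] := adj.
have : dist i j = 1%N \/ dist i j = (k - 1)%N.
  by move: adj; rewrite pe !modS // /dist; case: ((pos i).+1 =P k) => ?; case: ((pos j).+1 =P k) => ?; lia.
case=> ->; first by rewrite mul1r expr1.
rewrite cos_theta_wrap ?mul1r //; split=> //.
by rewrite -signr_odd oddB // (negbTE kodd) expr1.
Qed.

End RegularPolygon.

(** * Vertices of a simple right-angled polytope of dimension four *)

Lemma card_eq_lt (T : Type) (A : set T) q (g : nat -> T) : (A #= `I_q)%card ->
  (forall i, (i <= q)%N -> A (g i)) ->
  (forall i j, (i < j <= q)%N -> g i <> g j) -> False.
Proof.
move=> Aq Ag ginj.
have inj : {in `I_q.+1 &, injective g}.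
  move=> i j /set_mem/= iq /set_mem/= jq gij.
  by case: (ltngtP i j) => // ij; [case: (ginj i j)|case: (ginj j i)];
    rewrite ?ij ?gij // -ltnS.
have : (`I_q.+1 #<= `I_q)%card.
  rewrite -(card_le_eqr Aq) -(card_le_eql (inj_card_eq inj)).
  by apply: subset_card_le => _ [i /= iq <-]; exact: Ag.
by rewrite card_le_II ltnn.
Qed.

Lemma hdimI (R : realType) n (A : set 'cV[R]_n.+1) d (b : 'I_d.+1 -> 'cV[R]_n.+1) :
  (forall j, A (b j)) ->
  (forall c : 'I_d.+1 -> R, \sum_j c j *: b j = 0 -> forall j, c j = 0) ->
  (forall x, A x -> exists c : 'I_d.+1 -> R, x = \sum_j c j *: b j) ->
  has_hdim A d.
Proof.
move=> Ab free span; pose B := \matrix_(i, j) b j i 0.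
have colB j : col j B = b j by apply/colP => i; rewrite !mxE.
have Bc (c : 'cV_d.+1) : B *m c = \sum_j c j 0 *: b j.
  apply/colP => i; rewrite mxE summxE; apply: eq_bigr => j _.
  by rewrite !mxE mulrC.
exists B; split; last 2 first.
- by move=> j; rewrite colB.
- move=> x /span[c ->]; exists (\col_j c j); rewrite Bc.
  by apply: eq_bigr => j _; rewrite mxE.
apply/eqP; rewrite -mxrank_tr -/(row_free _) -kermx_eq0.
apply/rowV0P => w /sub_kermxP wB; apply/rowP => j; rewrite mxE.
apply: (free (fun j => w 0 j)).
transitivity (B *m w^T); last by apply: trmx_inj; rewrite trmx_mul trmxK wB trmx0.
by rewrite Bc; apply: eq_bigr => l _; rewrite mxE.
Qed.

(** The dimension of a face, read off in its tangent space at a point. *)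
Lemma hdim_tangent (R : realType) n (A : set 'cV[R]_n.+1) z d
    (y : 'I_d -> 'cV[R]_n.+1) :
  hyperbolic z -> A z -> (forall k, lorentz (y k) z = 0) ->
  (forall k, exists t, [/\ 0 < t, t ^+ 2 * lorentz (y k) (y k) < 1 &
     A (normalize (z + t *: y k))]) ->
  (forall c : 'I_d -> R, \sum_k c k *: y k = 0 -> forall k, c k = 0) ->
  (forall x, A x -> exists c : 'I_d -> R, x + lorentz x z *: z = \sum_k c k *: y k) ->
  has_hdim A d.
Proof.
move=> hz Az yz /choice[t tP] free span.
pose s k := (Num.sqrt (- lorentz (z + t k *: y k) (z + t k *: y k)))^-1.
have s0 k : s k != 0.
  have [t0 tY _] := tP k.
  exact: lt0r_neq0 (normalize_factor_gt0 (future_tangent hz (yz k) tY)).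
have t0 k : t k != 0 by have [/lt0r_neq0] := tP k.
pose b (j : 'I_d.+1) := if unlift ord0 j is Some k then s k *: (z + t k *: y k) else z.
have bS k : b (lift ord0 k) = s k *: z + (s k * t k) *: y k.
  by rewrite /b liftK scalerDr scalerA.
have b0 : b ord0 = z by rewrite /b unlift_none.
have zz : lorentz z z = -1 by case: hz.
have sumE (c : 'I_d.+1 -> R) : \sum_j c j *: b j =
    (c ord0 + \sum_k c (lift ord0 k) * s k) *: z +
    \sum_k (c (lift ord0 k) * s k * t k) *: y k.
  rewrite big_ord_recl b0 scalerDl -addrA; congr (_ + _).
  rewrite scaler_suml -big_split /=; apply: eq_bigr => k _.
  by rewrite bS scalerDr !scalerA mulrA.
apply: (@hdimI _ _ _ _ b).
- move=> j; case: (unliftP ord0 j) => [k ->|->]; last by rewrite b0.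
  by rewrite /b liftK; have [] := tP k.
- move=> c; rewrite sumE => c0.
  have /eqP z0 : c ord0 + \sum_k c (lift ord0 k) * s k == 0.
    have := congr1 (fun w => lorentz w z) c0; rewrite /= lorentz0l.
    rewrite !lorentz_lin zz lorentz_suml [X in _ + X]big1; last first.
      by move=> k _; rewrite lorentz_lin yz mulr0.
    by rewrite addr0 mulrN1 => /eqP; rewrite oppr_eq0.
  move: c0; rewrite z0 scale0r add0r => /free cst.
  have cS k : c (lift ord0 k) = 0.
    have /eqP := cst k; rewrite !mulf_eq0 (negbTE (s0 k)) (negbTE (t0 k)) !orbF.
    by move/eqP.
  move=> j; case: (unliftP ord0 j) => [k ->//|->].
  by rewrite -z0 big1 ?addr0 // => k _; rewrite cS mul0r.
move=> x /span[c xE].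
pose c' j := if unlift ord0 j is Some k then c k / (s k * t k)
  else - lorentz x z - \sum_k c k / t k.
have c'S k : c' (lift ord0 k) = c k / (s k * t k) by rewrite /c' liftK.
exists c'; rewrite sumE.
have -> : \sum_k c' (lift ord0 k) * s k = \sum_k c k / t k.
  by apply: eq_bigr => k _; rewrite c'S; field; rewrite t0 s0.
have -> : \sum_k (c' (lift ord0 k) * s k * t k) *: y k = \sum_k c k *: y k.
  by apply: eq_bigr => k _; rewrite c'S; congr (_ *: _); field; rewrite t0 s0.
by rewrite /c' unlift_none subrK -xE scaleNr addrC addrK.
Qed.

Section Vertex.
Variables (R : realType) (m : nat) (v : 'I_m -> 'cV[R]_5).
Hypothesis cv : compact_polytope v.
Hypothesis rav : right_angled v.
Hypothesis sv : schlafli4 v 5 3 3.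
Implicit Types (x y z : 'cV[R]_5) (a b c d l : 'I_m).
Local Notation P := (poly_of v).

Let v1 l : lorentz (v l) (v l) = 1. Proof. by case: cv. Qed.

Lemma facet_face l : is_face v 3 (face v [set l]).
Proof. by split; [exists [set l]|case: cv]. Qed.

Lemma facet_eq a b : face v [set a] = face v [set b] -> a = b.
Proof.
move=> E; apply: (facet_inj cv) => // x Px xa.
have : face v [set a] x by split=> // _ ->.
by rewrite E => -[_]; exact.
Qed.

Variable z : 'cV[R]_5.
Hypothesis vz : is_vertex v z.

Let Pz : P z. Proof. by case: vz. Qed.
Let hz : hyperbolic z. Proof. by case: Pz. Qed.
Let fz : future z. Proof. exact: hyperbolic_future. Qed.

Definition tangent_cone y := lorentz y z = 0 /\
  forall l, lorentz z (v l) = 0 -> lorentz y (v l) <= 0.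

Definition extreme_ray y := [/\ tangent_cone y, y != 0 &
  forall u, lorentz u z = 0 -> (forall l, lorentz z (v l) = 0 ->
    lorentz y (v l) = 0 -> lorentz u (v l) = 0) -> exists t, u = t *: y].

(** The extreme rays of the tangent cone at a vertex are the directions of the
   edges there. One is found by moving within the cone until as many constraints
   as possible are tight. *)
Lemma extreme_above y : tangent_cone y -> y != 0 -> exists y', extreme_ray y'.
Proof.
pose free y := [pred l | (lorentz z (v l) == 0) && (lorentz y (v l) != 0)].
have [k] := ubnP #|free y|; elim: k y => // k IH y; rewrite ltnS => yk [yz yv] y0.
have [ext|next] := pselect (extreme_ray y); first by exists y.
have [u [uz uy nu]] : exists u, [/\ lorentz u z = 0,
    forall l, lorentz z (v l) = 0 -> lorentz y (v l) = 0 -> lorentz u (v l) = 0 &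
    forall t, u <> t *: y].
  apply: contrapT => no; apply: next; split=> // u uz uy.
  apply: contrapT => nu; apply: no; exists u; split=> // t E.
  by apply: nu; exists t.
have [l0 [zl0 ul0]] : exists l, lorentz z (v l) = 0 /\ lorentz u (v l) != 0.
  apply: contrapT => no; apply: (nu 0); rewrite scale0r; apply: vz.2 => // l zl.
  by apply/eqP/negPn/negP => ul; apply: no; exists l.
wlog {ul0} ul0 : u uz uy nu / 0 < lorentz u (v l0).
  move=> hw; have [ul|ul] := ltP 0 (lorentz u (v l0)); first exact: (hw u).
  apply: (hw (- u)) => [|l zl yl|t E|].
  - by rewrite lorentz_lin uz oppr0.
  - by rewrite lorentz_lin uy // oppr0.
  - by apply: (nu (- t)); rewrite scaleNr -E opprK.
  - by rewrite lorentz_lin oppr_gt0 lt_neqAle ul0.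
pose r l := - lorentz y (v l) / lorentz u (v l).
pose Q l := (lorentz z (v l) == 0) && (0 < lorentz u (v l)).
have Q0 : Q l0 by rewrite /Q zl0 eqxx.
case: (Order.TotalTheory.arg_minP r Q0) => i /andP[/eqP zi ui] ri.
have r0 : 0 <= r i by rewrite divr_ge0 ?(ltW ui) // oppr_ge0 yv.
have y'0 : y + r i *: u != 0.
  have [->|rne] := eqVneq (r i) 0; first by rewrite scale0r addr0.
  apply/eqP => E; apply: (nu (- (r i)^-1)).
  have -> : y = - (r i *: u) by apply/eqP; rewrite -addr_eq0 E.
  by rewrite scaleNr scalerN opprK scalerA mulVf // scale1r.
have y'i : lorentz (y + r i *: u) (v i) = 0.
  by rewrite !lorentz_lin divfK ?subrr // lt0r_neq0.
apply: (IH (y + r i *: u)) => //.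
  apply: leq_trans yk; apply: proper_card; apply/properP; split.
    apply/fintype.subsetP => l; rewrite !inE => /andP[/eqP zl y'l].
    rewrite zl eqxx /=; apply: contra y'l => /eqP yl.
    by rewrite !lorentz_lin yl uy // mulr0 addr0.
  exists i; rewrite !inE zi eqxx /= ?y'i ?eqxx //.
  by apply: contraTN ui => /eqP yi; rewrite uy // ltxx.
split; first by rewrite !lorentz_lin yz uz mulr0 addr0.
move=> l zl; rewrite !lorentz_lin; have [ul|ul] := ltP 0 (lorentz u (v l)).
  have : r i * lorentz u (v l) <= - lorentz y (v l).
    by rewrite -ler_pdivlMr //; apply: ri; rewrite /Q zl eqxx.
  lra.
by rewrite -[leRHS]addr0 lerD ?mulr_ge0_le0 // yv.
Qed.

Definition triple y a b c := [/\ extreme_ray y, uniq [:: a; b; c] &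
  forall l, l \in [:: a; b; c] <-> lorentz z (v l) = 0 /\ lorentz y (v l) = 0].

Lemma face_move (I : set 'I_m) y : tangent_cone y ->
  (forall l, I l -> lorentz z (v l) = 0 /\ lorentz y (v l) = 0) ->
  exists t, [/\ 0 < t, t ^+ 2 * lorentz y y < 1 & face v I (normalize (z + t *: y))].
Proof.
move=> [yz yv] Iy; have [t t0 tP] := tangent_move Pz yz yv.
have [|tY Pt _] := tP t; first by rewrite t0 lexx.
exists t; split=> //; split=> // l /Iy[zl yl].
apply: lorentz_normalize_eq0; first exact: future_tangent.
by rewrite !lorentz_lin zl yl mulr0 addr0.
Qed.

(** At most three facets contain an edge, and three are needed to determine
   it. *)
Lemma extreme_triple y : extreme_ray y -> exists a b c, triple y a b c.
Proof.
move=> ey; have [[yz yv] y0 yext] := ey.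
pose s := enum [pred l | (lorentz z (v l) == 0) && (lorentz y (v l) == 0)].
have sP l : l \in s <-> lorentz z (v l) = 0 /\ lorentz y (v l) = 0.
  rewrite mem_enum inE; split=> [/andP[/eqP ? /eqP ?] //|[-> ->]].
  by rewrite eqxx.
pose E := face v [set` s].
have Ez : E z by split=> // l /sP[].
have edge : is_face v 1 E.
  split; first by exists [set` s].
  apply: (@hdim_tangent _ _ _ z _ (fun=> y)) => //.
  - by move=> _; apply: face_move => // l /sP.
  - move=> c; rewrite big_ord1 => /eqP; rewrite scaler_eq0 (negbTE y0) orbF.
    by move=> /eqP c0 k; rewrite ord1.
  move=> x [Px xE]; have [||t xt] := yext (x + lorentz x z *: z).
  - by rewrite !lorentz_lin (_ : lorentz z z = -1) ?mulrN1 ?subrr //; case: hz.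
  - move=> l zl yl; rewrite !lorentz_lin zl mulr0 addr0.
    by apply: xE; apply/sP.
  by exists (fun=> t); rewrite big_ord1.
have us : uniq s by exact: enum_uniq.
have Y0 := tangent_gt0 fz yz y0.
case: sv => _ _ /(_ E edge) card3.
have EE : E = face v [set` s] by [].
case: s sP us E Ez edge card3 EE => [|a [|b [|c [|d s]]]] sP us E Ez edge card3 EE.
- have [u u0 uP] := @exists_orthogonal R 4 2 (fun i => [:: z; y]`_i) isT.
  have [||t ut] := yext u; first exact: (uP ord0).
    by move=> l zl yl; have /sP := conj zl yl.
  have := uP ord_max; rewrite /= ut lorentz_lin => /eqP.
  rewrite mulf_eq0 (gt_eqF Y0) orbF => /eqP t0.
  by rewrite ut t0 scale0r eqxx in u0.
- have [u u0 uP] := @exists_orthogonal R 4 3 (fun i => [:: z; y; v a]`_i) isT.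
  have [||t ut] := yext u; first exact: (uP ord0).
    move=> l zl yl; have /sP := conj zl yl; rewrite inE => /eqP ->.
    exact: (uP ord_max).
  have := uP (Ordinal (isT : (1 < 3)%N)); rewrite /= ut lorentz_lin => /eqP.
  rewrite mulf_eq0 (gt_eqF Y0) orbF => /eqP t0.
  by rewrite ut t0 scale0r eqxx in u0.
- have [u u0 uP] := @exists_orthogonal R 4 4 (fun i => [:: z; y; v a; v b]`_i) isT.
  have [||t ut] := yext u; first exact: (uP ord0).
    move=> l zl yl; have /sP := conj zl yl; rewrite !inE => /orP[]/eqP ->.
      exact: (uP (Ordinal (isT : (2 < 4)%N))).
    exact: (uP ord_max).
  have := uP (Ordinal (isT : (1 < 4)%N)); rewrite /= ut lorentz_lin => /eqP.
  rewrite mulf_eq0 (gt_eqF Y0) orbF => /eqP t0.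
  by rewrite ut t0 scale0r eqxx in u0.
- by exists a, b, c.
exfalso; apply: (card_eq_lt (g := fun i => face v [set nth a [:: a, b, c, d & s] i]) card3).
  move=> i i3; split; first exact: facet_face.
  move=> x; rewrite EE => -[Px xE]; split=> // _ ->; apply: xE; apply: mem_nth.
  by rewrite /= (leq_ltn_trans i3).
move=> i j /andP[ij j3] /facet_eq /eqP; rewrite nth_uniq //.
- by rewrite ltn_eqF.
- by rewrite /= (ltn_trans ij) // (leq_ltn_trans j3).
- by rewrite /= (leq_ltn_trans j3).
Qed.

Lemma neg_perturb (p q : R) : p < 0 ->
  exists2 e, 0 < e & forall t, 0 < t <= e -> p + t * q < 0.
Proof.
move=> p0; have d0 : 0 < `|q| + 1 by rewrite ltr_wpDl.
exists (- p / (`|q| + 1)); first by rewrite divr_gt0 ?oppr_gt0.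
move=> t /andP[t0]; rewrite ler_pdivlMr // => td.
have : t * q <= t * `|q| by rewrite ler_pM2l // ler_norm.
by move: td; rewrite mulrDr mulr1; lra.
Qed.

Lemma triple_sym1 y a b c : triple y a b c -> triple y b a c.
Proof.
move=> [ey u abc]; split=> // [|l]; last by rewrite -abc !inE orbCA.
by move: u; rewrite /= !inE !negb_or eq_sym => /and3P[/andP[-> ->] -> _].
Qed.

Lemma triple_sym2 y a b c : triple y a b c -> triple y a c b.
Proof.
move=> [ey u abc]; split=> // [|l]; last by rewrite -abc !inE [(l == b) || _]orbC.
by move: u; rewrite /= !inE !negb_or [b == c]eq_sym => /and3P[/andP[-> ->] -> _].
Qed.

(** At a vertex, the edge y is the intersection of three facets. Leaving the
   third one, c, sweeps out a 2-face, whose dihedral angle is right. *)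
Lemma triple_face y a b c : triple y a b c ->
  [/\ is_face v 2 (face v [set a; b]), lorentz (v a) (v b) = 0 &
    forall x : 'I_m, lorentz z (v x) = 0 ->
      face v [set a; b] `<=` face v [set x] -> x = a \/ x = b].
Proof.
move=> [[[yz yv] y0 yext] uabc abc].
have [[za ya] [zb yb] [zc yc]] : [/\ lorentz z (v a) = 0 /\ lorentz y (v a) = 0,
    lorentz z (v b) = 0 /\ lorentz y (v b) = 0 &
    lorentz z (v c) = 0 /\ lorentz y (v c) = 0].
  by split; apply/abc; rewrite !inE eqxx ?orbT.
have Y0 := tangent_gt0 fz yz y0.
have [e [ez ey ea eb ec]] : exists e, [/\ lorentz e z = 0, lorentz e y = 0,
    lorentz e (v a) = 0, lorentz e (v b) = 0 & lorentz e (v c) = -1].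
  have [u u0 uP] := @exists_orthogonal R 4 4 (fun i => [:: z; y; v a; v b]`_i) isT.
  have uz : lorentz u z = 0 := uP ord0.
  have uy : lorentz u y = 0 := uP (Ordinal (isT : (1 < 4)%N)).
  have ua : lorentz u (v a) = 0 := uP (Ordinal (isT : (2 < 4)%N)).
  have ub : lorentz u (v b) = 0 := uP ord_max.
  have uc : lorentz u (v c) != 0.
    apply/eqP => uc; have [//||t ut] := yext u.
      by move=> l zl yl; have /abc := conj zl yl; rewrite !inE => /or3P[]/eqP ->.
    move: uy; rewrite ut lorentz_lin => /eqP.
    rewrite mulf_eq0 (gt_eqF Y0) orbF => /eqP t0.
    by rewrite ut t0 scale0r eqxx in u0.
  exists (- (lorentz u (v c))^-1 *: u); rewrite !lorentz_lin uz uy ua ub !mulr0.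
  by split=> //; rewrite mulNr mulVf.
have [l|d d0 dP] := @finite_eps R m (fun l t => lorentz z (v l) = 0 ->
    lorentz (y + t *: e) (v l) <= 0).
  have [labc|] := boolP (l \in [:: a; b; c]).
    exists 1 => // t /andP[t0 _] _; rewrite !lorentz_lin.
    have /abc[_ ->] := labc; rewrite add0r; move: labc; rewrite !inE.
    by case/or3P=> /eqP ->; rewrite ?ea ?eb ?ec ?mulr0 // mulrN1 oppr_le0 ltW.
  move=> nl; have [zl|zl] := eqVneq (lorentz z (v l)) 0; last first.
    by exists 1 => // t _ E; rewrite E eqxx in zl.
  have yl : lorentz y (v l) < 0.
    rewrite lt_neqAle yv // andbT; apply: contra nl => /eqP yl.
    exact/abc.
  have [d d0 dP] := neg_perturb (lorentz e (v l)) yl.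
  by exists d => // t td _; rewrite !lorentz_lin ltW // dP.
set w := y + d *: e.
have wK : tangent_cone w.
  split; first by rewrite !lorentz_lin yz ez mulr0 addr0.
  by move=> l zl; apply: dP => //; rewrite d0 lexx.
have wc : lorentz w (v c) = - d by rewrite !lorentz_lin yc ec mulrN1 add0r.
have wab l : [set a; b] l -> lorentz z (v l) = 0 /\ lorentz w (v l) = 0.
  by case=> ->; rewrite !lorentz_lin ?ya ?yb ?ea ?eb mulr0 addr0.
have yab l : [set a; b] l -> lorentz z (v l) = 0 /\ lorentz y (v l) = 0.
  by case=> ->.
have yK : tangent_cone y by [].
have dim2 : has_hdim (face v [set a; b]) 2.
  apply: (@hdim_tangent _ _ _ z _ (fun i : 'I_2 => if i == ord0 then y else w)) => //.
  - by split=> // l /yab[].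
  - by move=> i; case: ifP => _ //; case: wK.
  - by move=> i; case: ifP => _; apply: face_move.
  - move=> q; rewrite big_ord_recl big_ord1 /= => qE.
    have q1 : q (lift ord0 ord0) = 0.
      have := congr1 (fun x => lorentz x (v c)) qE.
      rewrite /= lorentz0l lorentzDl !lorentzZl wc yc mulr0 add0r => /eqP.
      by rewrite mulf_eq0 oppr_eq0 (gt_eqF d0) orbF => /eqP.
    move: qE; rewrite q1 scale0r addr0 => /eqP; rewrite scaler_eq0 (negbTE y0) orbF.
    move=> /eqP q0 i; case: (unliftP ord0 i) => [j ->|->] //.
    by rewrite ord1.
  move=> x [Px xab].
  have [xa xb] : lorentz x (v a) = 0 /\ lorentz x (v b) = 0.
    by split; apply: xab; [left|right].
  set u := x + lorentz x z *: z.
  have uz : lorentz u z = 0.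
    by rewrite !lorentz_lin (_ : lorentz z z = -1) ?mulrN1 ?subrr //; case: hz.
  have [||t ut] := yext (u + lorentz u (v c) *: e).
  - by rewrite lorentzDl lorentzZl uz ez mulr0 addr0.
  - move=> l zl yl; have /abc := conj zl yl; rewrite !inE.
    rewrite lorentzDl lorentzZl.
    case/or3P => /eqP ->; last by rewrite ec mulrN1 subrr.
      by rewrite ea mulr0 addr0 !lorentz_lin xa za mulr0 addr0.
    by rewrite eb mulr0 addr0 !lorentz_lin xb zb mulr0 addr0.
  exists (fun i => if i == ord0 then t + lorentz u (v c) / d else - lorentz u (v c) / d).
  rewrite big_ord_recl big_ord1 /= /w scalerDr addrA -scalerDl scalerA.
  rewrite mulNr addrK mulNr divfK ?lt0r_neq0 // -ut scaleNr addrK //.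
split.
- by split=> //; exists [set a; b].
- apply: (right_angle cv rav _ Pz za zb dim2).
  by move: uabc; rewrite /= !inE negb_or => /andP[/andP[]].
move=> x zx abx.
have [t [t0 tY [Pt tab]]] := face_move yK yab.
have [_ /(_ x erefl)] := abx _ (conj Pt tab).
have ft := future_tangent hz yz tY.
rewrite lorentzZl => /eqP; rewrite mulf_eq0 (gt_eqF (normalize_factor_gt0 ft)) /=.
rewrite !lorentz_lin zx add0r mulf_eq0 (gt_eqF t0) /= => /eqP yx.
have /abc : lorentz z (v x) = 0 /\ lorentz y (v x) = 0 by [].
rewrite !inE => /or3P[]/eqP; [by left|by right|move=> xc].
have [t' [t'0 t'Y [Pt' t'ab]]] := face_move wK wab.
have [_ /(_ x erefl)] := abx _ (conj Pt' t'ab).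
have ft' := future_tangent hz wK.1 t'Y.
rewrite lorentzZl => /eqP; rewrite mulf_eq0 (gt_eqF (normalize_factor_gt0 ft')) /=.
rewrite lorentzDl lorentzZl zx add0r mulf_eq0 (gt_eqF t'0) /= xc wc oppr_eq0.
by rewrite (gt_eqF d0).
Qed.

End Vertex.

Section VertexStructure.
Variables (R : realType) (m : nat) (v : 'I_m -> 'cV[R]_5).
Hypothesis cv : compact_polytope v.
Hypothesis rav : right_angled v.
Hypothesis sv : schlafli4 v 5 3 3.
Implicit Types (x y z : 'cV[R]_5) (a b c d l : 'I_m).
Local Notation P := (poly_of v).

Let v1 l : lorentz (v l) (v l) = 1. Proof. by case: cv. Qed.

Variable z : 'cV[R]_5.
Hypothesis vz : is_vertex v z.

Let Pz : P z. Proof. by case: vz. Qed.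
Let hz : hyperbolic z. Proof. by case: Pz. Qed.
Let fz : future z. Proof. exact: hyperbolic_future. Qed.

Local Notation triple := (triple v z).

(** The other edge of the ridge of the facets a and b: the facet c is replaced
   by another facet d. *)
Lemma next_ray y a b c : triple y a b c -> exists d t,
  [/\ lorentz z (v d) = 0, lorentz y (v d) < 0 & triple (t *: y - v c) a b d].
Proof.
move=> tr; have [[[yz yv] y0 yext] uabc abc] := tr.
have [[za ya] [zb yb] [zc yc]] : [/\ lorentz z (v a) = 0 /\ lorentz y (v a) = 0,
    lorentz z (v b) = 0 /\ lorentz y (v b) = 0 &
    lorentz z (v c) = 0 /\ lorentz y (v c) = 0].
  by split; apply/abc; rewrite !inE eqxx ?orbT.
have [_ gac _] := triple_face cv rav vz (triple_sym2 tr).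
have [_ gbc _] := triple_face cv rav vz (triple_sym2 (triple_sym1 tr)).
pose Q l := (lorentz z (v l) == 0) && (lorentz y (v l) < 0).
have [l0 Q0] : exists l, Q l.
  apply: contrapT => no; move/eqP: y0; apply; apply: vz.2 => // l zl.
  apply/eqP; rewrite eq_le yv //= leNgt; apply/negP => yl.
  by apply: no; exists l; rewrite /Q zl eqxx.
pose r l := lorentz (v c) (v l) / lorentz y (v l).
case: (Order.TotalTheory.arg_maxP r Q0) => d /andP[/eqP zd yd] rd.
pose t := r d; pose y' := t *: y - v c.
have y'E u : lorentz y' u = t * lorentz y u - lorentz (v c) u by rewrite !lorentz_lin.
have y'K : tangent_cone v z y'.
  split; first by rewrite y'E yz mulr0 lorentzC zc subrr.
  move=> l zl; rewrite y'E; have [yl|yl] := ltP (lorentz y (v l)) 0.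
    have : r l <= t by apply: rd; rewrite /Q zl eqxx.
    by rewrite /r ler_ndivrMr //; lra.
  have yl0 : lorentz y (v l) = 0 by apply/eqP; rewrite eq_le yl yv.
  rewrite yl0 mulr0 sub0r oppr_le0; have /abc := conj zl yl0.
  rewrite !inE => /or3P[]/eqP ->; last by rewrite v1.
    by rewrite lorentzC gac.
  by rewrite lorentzC gbc.
have y'c : lorentz y' (v c) = -1 by rewrite y'E yc mulr0 v1 sub0r.
have y'a : lorentz y' (v a) = 0 by rewrite y'E ya lorentzC gac mulr0 subrr.
have y'b : lorentz y' (v b) = 0 by rewrite y'E yb lorentzC gbc mulr0 subrr.
have y'd : lorentz y' (v d) = 0.
  by rewrite y'E /t /r divfK ?subrr // lt_eqF.
have y'0 : y' != 0.
  by apply: contra_eq_neq y'c => ->; rewrite lorentz0l eq_sym oppr_eq0 oner_neq0.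
have ey' : extreme_ray v z y'.
  split=> // u uz uy'.
  have [|l zl yl|q uq] := yext (u + lorentz u (v c) *: y').
  - by rewrite lorentzDl lorentzZl uz y'E yz [lorentz (v c) z]lorentzC zc; ring.
  - have /abc := conj zl yl; rewrite !inE lorentzDl lorentzZl.
    case/or3P => /eqP ->; last by rewrite y'c mulrN1 subrr.
      by rewrite y'a uy' // mulr0 addr0.
    by rewrite y'b uy' // mulr0 addr0.
  have := uy' d zd y'd; have : lorentz (u + lorentz u (v c) *: y') (v d) = q * lorentz y (v d).
    by rewrite uq lorentzZl.
  rewrite lorentzDl lorentzZl y'd mulr0 addr0 => -> /eqP.
  rewrite mulf_eq0 (lt_eqF yd) orbF => /eqP q0.
  exists (- lorentz u (v c)); move/eqP: uq; rewrite q0 scale0r addr_eq0 => /eqP ->.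
  by rewrite scaleNr lorentzNl lorentzZl y'c mulrN1 !opprK.
have uabd : uniq [:: a; b; d].
  move: uabc; rewrite /= !inE !negb_or => /and3P[/andP[-> _] _ _] /=.
  by rewrite !andbT; apply/andP; split; apply: contraTneq yd => <-; rewrite ?ya ?yb ltxx.
exists d, t; split=> //; split=> // l.
have [p [q [s [_ upqs pqs]]]] := extreme_triple cv sv vz ey'.
have sub : {subset [:: a; b; d] <= [:: p; q; s]}.
  move=> x; rewrite !inE => xabd; have : lorentz z (v x) = 0 /\ lorentz y' (v x) = 0.
    by case/or3P: xabd => /eqP ->.
  by move/pqs; rewrite !inE.
by rewrite -pqs; have [_ ->] := uniq_min_size uabd sub (leqnn _).
Qed.

(** The link of a vertex is a right-angled simplex: the three edges next to
   a given one lie in a common fourth facet, since a facet has only three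
   ridges at the vertex. *)
Lemma common_facet y a b c d d' t t' : triple y a b c ->
  lorentz z (v d) = 0 -> lorentz y (v d) < 0 -> triple (t *: y - v c) a b d ->
  lorentz z (v d') = 0 -> lorentz y (v d') < 0 -> triple (t' *: y - v b) a c d' ->
  d = d'.
Proof.
move=> tr zd yd trd zd' yd' trd'; apply/eqP/negPn/negP => dd'.
have [[[yz yv] y0 yext] uabc abc] := tr.
have [Fab _ Iab] := triple_face cv rav vz tr.
have [Fac _ Iac] := triple_face cv rav vz (triple_sym2 tr).
have [Fad _ Iad] := triple_face cv rav vz (triple_sym2 trd).
have [Fad' _ Iad'] := triple_face cv rav vz (triple_sym2 trd').
have yabc l : l \in [:: a; b; c] -> lorentz z (v l) = 0 /\ lorentz y (v l) = 0.
  by move/abc.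
have za : lorentz z (v a) = 0 by case: (yabc a); rewrite ?inE ?eqxx.
have zc : lorentz z (v c) = 0 by case: (yabc c); rewrite ?inE ?eqxx ?orbT.
have zb : lorentz z (v b) = 0 by case: (yabc b); rewrite ?inE ?eqxx ?orbT.
have nd l : l \in [:: a; b; c] -> l <> d /\ l <> d'.
  move=> /yabc[_ yl]; split=> E; first by move: yd; rewrite -E yl ltxx.
  by move: yd'; rewrite -E yl ltxx.
have [ad ad'] : a <> d /\ a <> d' by apply: nd; rewrite !inE eqxx.
have [bd bd'] : b <> d /\ b <> d' by apply: nd; rewrite !inE eqxx orbT.
have [cd cd'] : c <> d /\ c <> d' by apply: nd; rewrite !inE eqxx !orbT.
have [ab ac bc] : [/\ a <> b, a <> c & b <> c].
  move: uabc; rewrite /= !inE !negb_or => /and3P[/andP[/eqP ? /eqP ?] /eqP ? _].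
  by split.
pose V := face v [set l | lorentz z (v l) = 0].
have Vz : V z by split.
have Vx x : V x -> x = z.
  move=> [Px xV]; have : x + lorentz x z *: z = 0.
    apply: vz.2.
      by rewrite !lorentz_lin (_ : lorentz z z = -1) ?mulrN1 ?subrr //; case: hz.
    by move=> l zl; rewrite !lorentz_lin zl mulr0 addr0 xV.
  move=> /eqP; rewrite addr_eq0 => /eqP xE.
  have hx : hyperbolic x by case: Px.
  have xz := future_lorentz_lt0 (hyperbolic_future hx) fz.
  have zz : lorentz z z = -1 by case: hz.
  have : lorentz x x = -1 by case: hx.
  rewrite {1 2}xE !lorentz_lin zz => h; rewrite xE (_ : lorentz x z = -1) ?scaleN1r ?opprK //.
  nra.
have F0 : is_face v 0 V.
  split; first by exists [set l | lorentz z (v l) = 0].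
  apply: (@hdim_tangent _ _ _ z _ (fun=> 0)) => //; try by case.
  - by move=> c' _ [].
  - move=> x /Vx ->; exists (fun=> 0); rewrite big_ord0.
    by rewrite (_ : lorentz z z = -1) ?scaleN1r ?subrr //; case: hz.
case: sv => _ /(_ V (face v [set a]) F0 (facet_face cv a)) card3 _.
have VF : V `<=` face v [set a] by move=> x /Vx ->; split=> // _ ->.
have sub l : face v [set a; l] `<=` face v [set a].
  by move=> x [Px xal]; split=> // _ ->; apply: xal; left.
have Vsub l : lorentz z (v l) = 0 -> V `<=` face v [set a; l].
  by move=> zl x /Vx ->; split=> // _ [->|->].
have subr l : face v [set a; l] `<=` face v [set l].
  by move=> x [Px xal]; split=> // _ ->; apply: xal; right.
apply: (card_eq_lt (g := fun i => face v [set a; nth a [:: b; c; d; d'] i])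
  (card3 VF)).
  by move=> [|[|[|[|//]]]] _ /=; split=> //; exact: Vsub.
have key l l' : face v [set a; l] = face v [set a; l'] -> face v [set a; l] `<=` face v [set l'].
  by move=> ->; exact: subr.
move=> i j /andP[+ +].
case: i => [|[|[|[|i]]]]; case: j => [|[|[|[|j]]]] //= _ _ /key.
- by move=> /(Iab c zc)[/esym|/esym].
- by move=> /(Iab d zd)[/esym|/esym].
- by move=> /(Iab d' zd')[/esym|/esym].
- by move=> /(Iac d zd)[/esym|/esym].
- by move=> /(Iac d' zd')[/esym|/esym].
- by move=> /(Iad d' zd')[/esym//|/esym E]; rewrite E eqxx in dd'.
Qed.

(** By [common_facet] a fourth facet d, together with any two of a, b, c, determines
   an edge. The four facets are pairwise orthogonal, so that their normals and z
   form a basis; the normal of any other facet through z has nonnegative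
   coordinates in it, and such a facet would be contained in one of the four. *)
Theorem vertex_structure : exists f : 'I_4 -> 'I_m,
  (forall r s, lorentz (v (f r)) (v (f s)) = (r == s)%:R) /\
  forall l, lorentz z (v l) = 0 <-> exists r, l = f r.
Proof.
have zz : lorentz z z = -1 by case: hz.
have [l0 zl0] : exists l, lorentz z (v l) = 0.
  apply: contrapT => no.
  have [u u0 uP] := @exists_orthogonal R 4 1 (fun=> z) isT.
  move/eqP: u0; apply; apply: vz.2; first exact: (uP ord0).
  by move=> l zl; case: no; exists l.
have [p pP] := poly_interior cv.
have [y ey] : exists y, extreme_ray v z y.
  have pl l : lorentz z (v l) = 0 ->
      lorentz (p + lorentz p z *: z) (v l) = lorentz p (v l).
    by move=> zl; rewrite !lorentz_lin zl mulr0 addr0.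
  apply: (@extreme_above _ _ v z vz (p + lorentz p z *: z)).
    split; first by rewrite !lorentz_lin zz mulrN1 subrr.
    by move=> l zl; rewrite pl // ltW.
  apply: contraTneq (pP l0) => p0.
  by rewrite -pl // p0 lorentz0l ltxx.
have [a [b [c tr]]] := extreme_triple cv sv vz ey.
have trs := triple_sym2 tr.
have trr := triple_sym2 (triple_sym1 tr).
have [d [t1 [zd yd tr1]]] := next_ray tr.
have [d2 [t2 [zd2 yd2 tr2]]] := next_ray trs.
have [d3 [t3 [zd3 yd3 tr3]]] := next_ray trr.
have E2 : d = d2 := common_facet tr zd yd tr1 zd2 yd2 tr2.
have E3 : d = d3 := common_facet (triple_sym1 tr) zd yd (triple_sym1 tr1) zd3 yd3 tr3.
move: tr2 tr3; rewrite -{}E2 -{}E3 => tr2 tr3.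
have [_ gab _] := triple_face cv rav vz tr.
have [_ gac _] := triple_face cv rav vz trs.
have [_ gbc _] := triple_face cv rav vz trr.
have [_ gad _] := triple_face cv rav vz (triple_sym2 tr1).
have [_ gbd _] := triple_face cv rav vz (triple_sym2 (triple_sym1 tr1)).
have [_ gcd _] := triple_face cv rav vz (triple_sym2 (triple_sym1 tr2)).
have [[[yz yv] y0 _] _ abc] := tr.
have tight l : l \in [:: a; b; c] -> lorentz z (v l) = 0 /\ lorentz y (v l) = 0.
  by move/abc.
have [[za ya] [zb yb] [zc yc]] : [/\ lorentz z (v a) = 0 /\ lorentz y (v a) = 0,
    lorentz z (v b) = 0 /\ lorentz y (v b) = 0 &
    lorentz z (v c) = 0 /\ lorentz y (v c) = 0].
  by split; apply: tight; rewrite !inE eqxx ?orbT.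
pose f (r : 'I_4) := nth a [:: a; b; c; d] r.
have fO r s : lorentz (v (f r)) (v (f s)) = (r == s)%:R.
  rewrite -val_eqE; move: r s.
  move=> [[|[|[|[|//]]]] ?] [[|[|[|[|//]]]] ?]; rewrite /f /= ?v1 ?mulr1n ?mulr0n //.
  all: try by rewrite lorentzC.
have fz0 r : lorentz z (v (f r)) = 0 by move: r => [[|[|[|[|//]]]] ?].
have basis u : lorentz u z = 0 -> (forall r, lorentz u (v (f r)) = 0) -> u = 0.
  move=> uz uf; apply: (@orthogonal_basis R 4
    (fun i => if unlift ord0 i is Some r then v (f r) else z)).
  - move=> i j; case: (unliftP ord0 i) => [r ->|->];
      case: (unliftP ord0 j) => [s ->|->]; rewrite ?eqxx ?liftK ?unlift_none //.
    + by rewrite (inj_eq (@lift_inj _ _)) fO => /negbTE ->.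
    + by rewrite lorentzC fz0.
  - by move=> i; case: unliftP => [r _|_]; rewrite ?v1 ?zz ?oppr_eq0 oner_neq0.
  - by move=> i; case: unliftP => [r _|_].
have ge0 (x e e' : 'I_m) t : lorentz (v x) (v d) = 0 -> triple (t *: y - v x) e e' d ->
    forall l, lorentz z (v l) = 0 -> 0 <= lorentz (v x) (v l).
  move=> gxd [[[_ yK] _ _] _ tri] l zl.
  have [_ td] : lorentz z (v d) = 0 /\ lorentz (t *: y - v x) (v d) = 0.
    by apply/tri; rewrite !inE eqxx !orbT.
  move: td (yK l zl); rewrite !lorentz_lin gxd subr0 => /eqP.
  rewrite mulf_eq0 (lt_eqF yd) orbF => /eqP ->.
  by rewrite mul0r sub0r oppr_le0.
have yE : y = lorentz y (v d) *: v d.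
  apply/eqP; rewrite -subr_eq0; apply/eqP; apply: basis.
    by rewrite !lorentz_lin yz [lorentz (v d) z]lorentzC zd; ring.
  move=> [[|[|[|[|//]]]] ?]; rewrite /f /= !lorentz_lin.
  - by rewrite ya [lorentz (v d) _]lorentzC gad; ring.
  - by rewrite yb [lorentz (v d) _]lorentzC gbd; ring.
  - by rewrite yc [lorentz (v d) _]lorentzC gcd; ring.
  - by rewrite v1; ring.
have f_ge0 l r : lorentz z (v l) = 0 -> 0 <= lorentz (v (f r)) (v l).
  move=> zl; move: r => [[|[|[|[|//]]]] ?]; rewrite /f /=.
  - exact: ge0 gad tr3 l zl.
  - exact: ge0 gbd tr2 l zl.
  - exact: ge0 gcd tr1 l zl.
  - by have := yv l zl; rewrite {1}yE lorentz_lin nmulr_rle0.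
exists f; split=> // l; split=> [zl|[r ->]]; last exact: fz0.
have lE : v l = \sum_r lorentz (v (f r)) (v l) *: v (f r).
  apply/eqP; rewrite -subr_eq0; apply/eqP; apply: basis.
    rewrite !lorentz_lin lorentzC zl lorentz_suml big1 ?subr0 // => r _.
    by rewrite lorentz_lin [lorentz (v (f r)) z]lorentzC fz0 mulr0.
  move=> s; rewrite !lorentz_lin lorentz_suml (bigD1 s) //= lorentz_lin v1 mulr1.
  rewrite big1 ?addr0; first by rewrite lorentzC subrr.
  by move=> r rs; rewrite lorentz_lin fO (negbTE rs) mulr0.
have [r fr] : exists r, lorentz (v (f r)) (v l) != 0.
  apply: contrapT => no; have := v1 l; rewrite {1}lE lorentz_suml big1.
    by move=> /esym/eqP; rewrite oner_eq0.
  move=> r _; rewrite lorentz_lin.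
  have [->|ne] := eqVneq (lorentz (v (f r)) (v l)) 0; first by rewrite mul0r.
  by case: no; exists r.
exists r; apply: (facet_inj cv) => // x Px xl.
have : \sum_r - (lorentz (v (f r)) (v l) * lorentz x (v (f r))) == 0.
  rewrite sumrN oppr_eq0 -[X in _ == X]xl [X in _ == lorentz _ X]lE.
  rewrite [X in _ == X]lorentzC lorentz_suml; apply/eqP/eq_bigr => s _.
  by rewrite lorentz_lin [lorentz x _]lorentzC.
rewrite psumr_eq0; last first.
  by move=> s _; rewrite oppr_ge0 mulr_ge0_le0 //; [exact: f_ge0|exact: Px.2].
move=> /allP/(_ r); rewrite mem_index_enum oppr_eq0 mulf_eq0 (negbTE fr) /=.
by move=> /(_ isT)/eqP.
Qed.

End VertexStructure.

(** * Walking along the edges *)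

Section Frames.
Variables (R : realType) (m : nat) (v : 'I_m -> 'cV[R]_5).
Hypothesis cv : compact_polytope v.
Hypothesis rav : right_angled v.
Hypothesis sv : schlafli4 v 5 3 3.
Implicit Types (x y z : 'cV[R]_5) (l : 'I_m) (r s : 'I_4) (f g : 'I_4 -> 'I_m).
Local Notation P := (poly_of v).

Let v1 l : lorentz (v l) (v l) = 1. Proof. by case: cv. Qed.

(** A vertex z with an ordering of the four facets through it; by
   [vertex_structure] their normals and z form an orthonormal basis. *)
Definition frame z f := [/\ P z,
  forall r s, lorentz (v (f r)) (v (f s)) = (r == s)%:R &
  forall l, lorentz z (v l) = 0 <-> exists r, l = f r].

Lemma frame_tight z f r : frame z f -> lorentz z (v (f r)) = 0.
Proof. by move=> [_ _ zf]; apply/zf; exists r. Qed.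

Lemma tangent_basis z f u : lorentz z z = -1 ->
  (forall r s, lorentz (v (f r)) (v (f s)) = (r == s)%:R) ->
  (forall r, lorentz z (v (f r)) = 0) ->
  lorentz u z = 0 -> (forall r, lorentz u (v (f r)) = 0) -> u = 0.
Proof.
move=> zz fO fz0 uz uf; apply: (@orthogonal_basis R 4
  (fun i => if unlift ord0 i is Some r then v (f r) else z)).
- move=> i j; case: (unliftP ord0 i) => [r ->|->];
    case: (unliftP ord0 j) => [s ->|->]; rewrite ?eqxx ?liftK ?unlift_none //.
  + by rewrite (inj_eq (@lift_inj _ _)) fO => /negbTE ->.
  + by rewrite lorentzC fz0.
- by move=> i; case: unliftP => [r _|_]; rewrite ?v1 ?zz ?oppr_eq0 oner_neq0.
- by move=> i; case: unliftP => [r _|_].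
Qed.

Lemma frame_basis z f u : frame z f ->
  lorentz u z = 0 -> (forall r, lorentz u (v (f r)) = 0) -> u = 0.
Proof.
move=> fr; have [[[zz _] _] fO _] := fr.
by apply: tangent_basis => // r; exact: frame_tight fr.
Qed.

Lemma frame_inj z f : frame z f -> injective f.
Proof.
move=> [_ fO _] r s E; apply/eqP; have := fO r s.
by rewrite E v1; case: eqP => // _ /eqP; rewrite oner_eq0.
Qed.

Lemma frame_perm z f (g : 'I_4 -> 'I_4) : frame z f -> injective g -> frame z (f \o g).
Proof.
move=> [Pz fO zf] gi; split=> // [r s|l]; first by rewrite /= fO (inj_eq gi).
rewrite zf; split=> [[r ->]|[r ->]]; last by exists (g r).
by exists (invF gi r); rewrite /= f_invF.
Qed.

Lemma frame_of_vertex z f : is_vertex v z ->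
  (forall r s, lorentz (v (f r)) (v (f s)) = (r == s)%:R) ->
  (forall r, lorentz z (v (f r)) = 0) -> frame z f.
Proof.
move=> vz fO fz0; have Pz : P z by case: vz.
have zz : lorentz z z = -1 by case: Pz.1.
have [g [gO zg]] := vertex_structure cv rav sv vz.
split=> // l; split=> [zl|[r ->]]; last exact: fz0.
apply: contrapT => no; have := v1 l.
have vl0 : v l = 0; last by rewrite vl0 lorentz0l => /eqP; rewrite eq_sym oner_eq0.
apply: (tangent_basis zz fO fz0); first by rewrite lorentzC.
move=> r; have [a la] := (zg l).1 zl; have [b rb] := (zg (f r)).1 (fz0 r).
rewrite la rb gO; case: eqP => // ab; case: no; exists r.
by rewrite la rb ab.
Qed.

Lemma frame_exists l : exists z f, frame z f.
Proof.
have [x [Px _]] := facet_nonempty cv l.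
have [z [vz _]] := vertex_above cv Px; exists z.
have [f [fO zf]] := vertex_structure cv rav sv vz; exists f.
by split=> //; case: vz.
Qed.

Definition replace f r l : 'I_4 -> 'I_m := fun s => if s == r then l else f s.

(** Along the edge of a vertex z which leaves the facet r, the next vertex
   [z'] lies at distance d with ka = cosh d and mu = sinh d. *)
Lemma frame_cross z f r : frame z f -> exists l ka mu,
  [/\ 0 < ka, 0 < mu, ka ^+ 2 = 1 + mu ^+ 2, v l = mu *: z - ka *: v (f r) &
      frame (ka *: z - mu *: v (f r)) (replace f r l)].
Proof.
move=> fr; have [Pz fO zf] := fr; have zt s := frame_tight s fr.
have hz : hyperbolic z by case: Pz.
have zz : lorentz z z = -1 by case: hz.
have [||t [l [t0 Pw fw yl wl]]] := @exit_ray _ _ _ _ cv z (- v (f r)) Pz.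
- by rewrite lorentz_lin lorentzC zt oppr0.
- rewrite oppr_eq0; apply: contra_eq_neq (v1 (f r)) => ->.
  by rewrite lorentz0l eq_sym oner_neq0.
set mu := - lorentz z (v l); set ka := - lorentz (v (f r)) (v l).
have ka0 : 0 < ka by rewrite /ka -lorentz_lin.
have zl : lorentz z (v l) = - (t * ka).
  by move: wl; rewrite !lorentz_lin /ka; lra.
have muE : mu = t * ka by rewrite /mu zl opprK.
have lnf s : l <> f s.
  move=> ls; move: yl; rewrite ls lorentz_lin fO.
  by case: eqP => _; rewrite oppr_gt0 ?ltr10 ?ltxx.
have t_gt0 : 0 < t.
  rewrite lt_neqAle t0 andbT eq_sym; apply/eqP => t00.
  have /zf[s ls] : lorentz z (v l) = 0 by rewrite zl t00 mul0r oppr0.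
  by case: (lnf s).
have mu0 : 0 < mu by rewrite muE mulr_gt0.
have t1 : t ^+ 2 < 1.
  by case: fw => + _; rewrite !lorentz_lin zz v1 zt [lorentz (v (f r)) z]lorentzC zt; lra.
set w := z + t *: - v (f r) in Pw fw wl.
set z1 := normalize w in Pw.
have h1 : hyperbolic z1 by case: Pw.
have [q q0 z1E] : exists2 q, 0 < q & z1 = q *: w.
  by exists (Num.sqrt (- lorentz w w))^-1; first exact: normalize_factor_gt0.
have wf s : s != r -> lorentz w (v (f s)) = 0.
  by move=> sr; rewrite !lorentz_lin zt fO eq_sym (negbTE sr); rewrite /=; ring.
have z1l : lorentz z1 (v l) = 0 by rewrite z1E lorentzZl wl mulr0.
have z1f s : s != r -> lorentz z1 (v (f s)) = 0.
  by move=> sr; rewrite z1E lorentzZl wf // mulr0.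
have vz1 : is_vertex v z1.
  split=> // y yz1 ytight.
  have yl0 := ytight l z1l; have yf s : s != r -> lorentz y (v (f s)) = 0.
    by move=> /z1f /ytight.
  have yE : y = - lorentz y z *: z + lorentz y (v (f r)) *: v (f r).
    apply/eqP; rewrite -subr_eq0; apply/eqP; apply: (frame_basis fr).
      by rewrite !lorentz_lin zz [lorentz (v (f r)) z]lorentzC zt; rewrite /=; ring.
    move=> s; rewrite !lorentz_lin zt fO; have [<-|sr] := eqVneq r s; first by (rewrite /=; ring).
    by rewrite yf 1?eq_sym //; rewrite /=; ring.
  have yw : lorentz y z = t * lorentz y (v (f r)).
    move/eqP: yz1; rewrite z1E lorentzZr mulf_eq0 (gt_eqF q0) /= => /eqP.
    by rewrite /w !lorentz_lin; lra.
  have : lorentz y (v (f r)) = 0.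
    move: yl0; rewrite {1}yE !lorentz_lin zl yw.
    have -> : lorentz (v (f r)) (v l) = - ka by rewrite opprK.
    move=> h; have /eqP : lorentz y (v (f r)) * (ka * (1 - t ^+ 2)) = 0 by lra.
    have kt : ka * (1 - t ^+ 2) != 0 by rewrite lt0r_neq0 // mulr_gt0 // subr_gt0.
    by rewrite mulf_eq0 (negbTE kt) orbF => /eqP.
  by move=> yr; rewrite yE yw yr mulr0 oppr0 !scale0r addr0.
have [g [gO zg]] := vertex_structure cv rav sv vz1.
have orth a b : a <> b -> lorentz z1 (v a) = 0 -> lorentz z1 (v b) = 0 ->
    lorentz (v a) (v b) = 0.
  move=> ab /zg[a' aE] /zg[b' bE]; rewrite aE bE gO; case: eqP => // E.
  by case: ab; rewrite aE bE E.
have lf s : s != r -> lorentz (v l) (v (f s)) = 0.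
  by move=> sr; apply: orth => //; exact: z1f.
have vlE : v l = mu *: z - ka *: v (f r).
  apply/eqP; rewrite -subr_eq0; apply/eqP; apply: (frame_basis fr).
    rewrite !lorentz_lin zz [lorentz (v (f r)) z]lorentzC zt lorentzC /mu; rewrite /=; ring.
  move=> s; rewrite !lorentz_lin zt fO; have [<-|sr] := eqVneq r s.
    by rewrite lorentzC /ka; rewrite /=; ring.
  by rewrite lf 1?eq_sym //; rewrite /=; ring.
have kamu : ka ^+ 2 = 1 + mu ^+ 2.
  have := v1 l; rewrite {1 2}vlE !lorentz_lin zz v1 zt.
  by rewrite [lorentz (v (f r)) z]lorentzC zt; lra.
have qka : q = ka.
  have : lorentz z1 z1 = -1 by case: h1.
  rewrite z1E /w !lorentz_lin zz v1 zt [lorentz (v (f r)) z]lorentzC zt => h.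
  have qt : q ^+ 2 * (1 - t ^+ 2) = 1 by lra.
  have kt : ka ^+ 2 * (1 - t ^+ 2) = 1.
    by have : ka ^+ 2 - mu ^+ 2 = 1 by [lra]; rewrite muE exprMn; lra.
  have qk : q ^+ 2 = ka ^+ 2.
    apply: (mulIf (x := 1 - t ^+ 2)); last by rewrite qt kt.
    by apply: lt0r_neq0; lra.
  by apply/eqP; rewrite -(@eqrXn2 _ 2) ?qk ?ltW.
exists l, ka, mu; split=> //.
have -> : ka *: z - mu *: v (f r) = z1.
  by rewrite z1E qka scalerDr scalerN scalerN scalerA muE [t * ka]mulrC.
apply: frame_of_vertex => //; last first.
  by move=> s; rewrite /replace; case: eqVneq => [//|]; exact: z1f.
move=> a b; rewrite /replace.
have [aE|ar] := boolP (a == r); have [bE|br] := boolP (b == r).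
- by rewrite v1 (eqP aE) (eqP bE) eqxx.
- by rewrite lf // (eqP aE) eq_sym (negbTE br).
- by rewrite lorentzC lf // (eqP bE) (negbTE ar).
- exact: fO.
Qed.

(** ** Flags *)

(** The faces at a vertex which form a flag in the order of the facets. *)
Definition flag_face f (d : nat) := face v [set l | exists2 s : 'I_4, (d <= s)%N & l = f s].

Lemma flag_face_move z f (I : set 'I_m) k : frame z f ->
  (forall l, I l -> exists2 s : 'I_4, s != k & l = f s) ->
  exists t, [/\ 0 < t, t ^+ 2 < 1 & face v I (normalize (z + t *: - v (f k)))].
Proof.
move=> fr If; have [Pz fO zf] := fr; have hz : hyperbolic z by case: Pz.
have yz : lorentz (- v (f k)) z = 0.
  by rewrite lorentz_lin lorentzC (frame_tight _ fr) oppr0.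
have yv l : lorentz z (v l) = 0 -> lorentz (- v (f k)) (v l) <= 0.
  by move=> /zf[s ->]; rewrite lorentz_lin fO oppr_le0 ler0n.
have [t t0 tP] := tangent_move Pz yz yv.
have [|tY Pt _] := tP t; first by rewrite t0 lexx.
have t1 : t ^+ 2 < 1 by move: tY; rewrite !lorentz_lin v1; lra.
exists t; split=> //; split=> // l /If[s sk ->].
apply: lorentz_normalize_eq0; first exact: future_tangent hz yz tY.
by rewrite !lorentz_lin (frame_tight _ fr) fO eq_sym (negbTE sk); rewrite /=; ring.
Qed.

Lemma flag_face_dim z f d : (d <= 4)%N -> frame z f -> is_face v d (flag_face f d).
Proof.
move=> d4 fr; have [Pz fO zf] := fr; have hz : hyperbolic z by case: Pz.
split; first by eexists.
pose w (k : 'I_d) : 'I_4 := widen_ord d4 k.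
have winj : injective w by move=> a b /(congr1 val)/= /val_inj.
apply: (@hdim_tangent _ _ _ z _ (fun k => - v (f (w k)))) => //.
- by split=> // l [s _ ->]; exact: frame_tight fr.
- by move=> k; rewrite lorentz_lin lorentzC (frame_tight _ fr) oppr0.
- move=> k; have [|t [t0 t1 tF]] := @flag_face_move z f
      [set l | exists2 s : 'I_4, (d <= s)%N & l = f s] (w k) fr.
    move=> l [s ds ->]; exists s => //; apply: contraTneq ds => ->.
    by rewrite -ltnNge /=.
  by exists t; split=> //; rewrite !lorentz_lin v1; lra.
- move=> c cE k; have := congr1 (fun x => lorentz x (v (f (w k)))) cE.
  rewrite /= lorentz0l lorentz_suml (bigD1 k) //= !lorentz_lin v1 big1 ?addr0.
    by move=> /eqP; rewrite mulrN1 oppr_eq0 => /eqP.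
  by move=> j jk; rewrite !lorentz_lin fO (inj_eq winj) (negbTE jk) oppr0 mulr0.
move=> x [Px xF]; exists (fun k => - lorentz x (v (f (w k)))).
apply/eqP; rewrite -subr_eq0; apply/eqP; apply: (frame_basis fr).
  rewrite !lorentz_lin (_ : lorentz z z = -1); last by case: hz.
  rewrite lorentz_suml big1; first by (rewrite /=; ring).
  by move=> k _; rewrite !lorentz_lin [lorentz _ z]lorentzC (frame_tight _ fr); rewrite /=; ring.
move=> s; rewrite !lorentz_lin (frame_tight _ fr) mulr0 addr0 lorentz_suml.
have [ds|sd] := leqP d s.
  rewrite xF; last by exists s.
  rewrite big1 ?subr0 // => k _; rewrite !lorentz_lin fO.
  case: eqP => [E|_]; last by rewrite oppr0 mulr0.
  by move: (ltn_ord k); rewrite -[nat_of_ord k]/(nat_of_ord (w k)) E ltnNge ds.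
have fs : f s = f (w (Ordinal sd)) by congr (f _); exact: val_inj.
rewrite fs (bigD1 (Ordinal sd)) //= !lorentz_lin v1 big1; first by ring.
by move=> k ks; rewrite !lorentz_lin fO (inj_eq winj) (negbTE ks) oppr0 mulr0.
Qed.

Lemma frame_flag z f : frame z f -> is_flag v (fun d => flag_face f d).
Proof.
move=> fr; split=> [d|d e de x [Px xd]].
  by apply: flag_face_dim fr; exact: ltnW.
split=> // l [s es ->]; apply: xd; exists s => //; exact: leq_trans es.
Qed.

(** On the edge which leaves the facet 0, the end different from z is the
   farthest point from z. *)
Lemma edge_bound z f l ka mu x : frame z f -> 0 < ka -> 0 < mu ->
  ka ^+ 2 = 1 + mu ^+ 2 -> v l = mu *: z - ka *: v (f ord0) ->
  flag_face f 1 x -> - lorentz z x <= ka.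
Proof.
move=> fr ka0 mu0 kamu vl [Px xF]; have [Pz fO zf] := fr.
have zz : lorentz z z = -1 by case: Pz.1.
have xz : x = - lorentz x z *: z + lorentz x (v (f ord0)) *: v (f ord0).
  apply/eqP; rewrite -subr_eq0; apply/eqP; apply: (frame_basis fr).
    by rewrite !lorentz_lin zz [lorentz (v _) z]lorentzC (frame_tight _ fr); rewrite /=; ring.
  move=> s; rewrite !lorentz_lin (frame_tight _ fr) fO.
  have [<-|sr] := eqVneq ord0 s; first by (rewrite /=; ring).
  by rewrite xF; [rewrite /=; ring|exists s => //; rewrite lt0n eq_sym].
have xx : lorentz x x = -1 by case: Px.1.
have := Px.2 l; rewrite vl !lorentz_lin.
have := Px.2 (f ord0).
have : lorentz x x = - lorentz x z ^+ 2 + lorentz x (v (f ord0)) ^+ 2.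
  by rewrite {2}xz !lorentz_lin; rewrite /=; ring.
rewrite xx [lorentz z x]lorentzC.
move: (lorentz x z) (lorentz x (v (f ord0))) => p q pq q0 le.
have [|p0] := leP (- p) 0; first by lra.
rewrite -ler_sqr ?nnegrE ?sqrrN; [|exact: ltW|exact: ltW].
have h1 : 0 <= - (ka * q) by rewrite oppr_ge0 mulr_ge0_le0 // ltW.
have h2 : - (ka * q) <= - (mu * p) by lra.
have : (- (ka * q)) ^+ 2 <= (- (mu * p)) ^+ 2.
  by rewrite ler_sqr ?nnegrE //; exact: le_trans h2.
have q2 : q ^+ 2 = p ^+ 2 - 1 by lra.
have mu2 : mu ^+ 2 = ka ^+ 2 - 1 by lra.
rewrite !sqrrN !exprMn q2 mu2; lra.
Qed.

Hypothesis regv : regular v.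

(** A symmetry between the flags of the two frames sends the first edge to the
   second one, and its end to a point at the same distance, which [edge_bound]
   compares with the length of the second edge. *)
Lemma edge_length_le z f l ka mu w g l' ka' mu' : frame z f -> frame w g ->
  0 < ka -> 0 < mu -> ka ^+ 2 = 1 + mu ^+ 2 -> v l = mu *: z - ka *: v (f ord0) ->
  frame (ka *: z - mu *: v (f ord0)) (replace f ord0 l) ->
  0 < ka' -> 0 < mu' -> ka' ^+ 2 = 1 + mu' ^+ 2 -> v l' = mu' *: w - ka' *: v (g ord0) ->
  ka <= ka'.
Proof.
move=> frz frw ka0 mu0 kamu vl frz' ka'0 mu'0 kamu' vl'.
have [h [[hO _] hF]] := regv (frame_flag frz) (frame_flag frw).
have zz : lorentz z z = -1 by case: frz => -[[]].
set z' := ka *: z - mu *: v (f ord0) in frz'.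
have z'F : flag_face f 1 z'.
  split; first by case: frz'.
  move=> _ [s s1 ->]; have := frame_tight s frz'; rewrite /replace ifN //.
  by apply: contraTneq s1 => ->.
have hz : h *m z = w.
  have : (mulmx h @` flag_face f 0) (h *m z).
    exists z => //; split; first by case: frz.
    by move=> _ [s _ ->]; exact: frame_tight frz.
  rewrite (hF ord0).
  move=> [Phz hzF]; have Pw : P w by case: frw.
  have ww : lorentz w w = -1 by case: Pw.1.
  have : h *m z + lorentz (h *m z) w *: w = 0.
    apply: (frame_basis frw); first by rewrite !lorentz_lin ww; rewrite /=; ring.
    move=> s; rewrite !lorentz_lin (frame_tight _ frw) hzF ?mulr0 ?addr0 //.
    by exists s.
  move=> /eqP; rewrite addr_eq0 => /eqP hzE.
  have neg := future_lorentz_lt0 (poly_future Phz) (poly_future Pw).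
  have : lorentz (h *m z) (h *m z) = -1 by case: Phz.1.
  rewrite {1 2}hzE !lorentz_lin ww => sq; rewrite hzE.
  have -> : lorentz (h *m z) w = -1 by nra.
  by rewrite scaleN1r opprK.
have hz'F : (mulmx h @` flag_face f 1) (h *m z') by exists z'.
rewrite (hF (Ordinal (isT : (1 < 4)%N))) in hz'F.
have := edge_bound frw ka'0 mu'0 kamu' vl' hz'F.
rewrite -hz; move/On1P: hO => ->.
by rewrite /z' !lorentz_lin zz (frame_tight _ frz); lra.
Qed.

Lemma uniform_cross (l0 : 'I_m) : exists ka mu, [/\ 0 < ka, 0 < mu, ka ^+ 2 = 1 + mu ^+ 2 &
  forall z f r, frame z f -> exists2 l, v l = mu *: z - ka *: v (f r) &
     frame (ka *: z - mu *: v (f r)) (replace f r l)].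
Proof.
have [z0 [f0 fr0]] := frame_exists l0.
have [l1 [ka [mu [ka0 mu0 kamu vl1 fr1]]]] := frame_cross ord0 fr0.
exists ka, mu; split=> // z f r fr.
have [l [ka' [mu' [ka'0 mu'0 kamu' vl fr']]]] := frame_cross r fr.
pose g s := if s == ord0 then r else if s == r then ord0 else s.
have gi : injective g.
  apply: inv_inj => s; rewrite /g; have [->|s0] := eqVneq s ord0.
    by rewrite eqxx; case: eqP.
  by have [->|sr] := eqVneq s r; rewrite ?eqxx // (negbTE s0) (negbTE sr).
have frg := frame_perm fr gi.
have g0 : (f \o g) ord0 = f r by [].
have [l2 [ka2 [mu2 [ka20 mu20 kamu2 vl2 fr2]]]] := frame_cross ord0 frg.
have e1 : ka2 = ka.
  apply/eqP; rewrite eq_le; apply/andP; split.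
    exact: (edge_length_le frg fr0 ka20 mu20 kamu2 vl2 fr2 ka0 mu0 kamu vl1).
  exact: (edge_length_le fr0 frg ka0 mu0 kamu vl1 fr1 ka20 mu20 kamu2 vl2).
have e2 : ka' = ka2.
  rewrite g0 in vl2 fr2.
  have vl' : v l = mu' *: z - ka' *: v ((f \o g) ord0) by rewrite g0.
  have fr'' : frame (ka' *: z - mu' *: v ((f \o g) ord0)) (replace (f \o g) ord0 l).
    rewrite g0; have := frame_perm fr' gi; congr frame.
    apply/funext => s; rewrite /replace /=.
    by rewrite -(inj_eq gi s ord0).
  rewrite -g0 in vl2 fr2.
  apply/eqP; rewrite eq_le; apply/andP; split.
    exact: (edge_length_le frg frg ka'0 mu'0 kamu' vl' fr'' ka20 mu20 kamu2 vl2).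
  exact: (edge_length_le frg frg ka20 mu20 kamu2 vl2 fr2 ka'0 mu'0 kamu' vl').
have e3 : ka' = ka by rewrite e2.
have e4 : mu' = mu.
  by apply/eqP; rewrite -(@eqrXn2 _ 2) ?ltW //; rewrite e3 in kamu'; apply/eqP; lra.
by rewrite e3 e4 in vl fr'; exists l.
Qed.

End Frames.

Section Pentagon.
Variables (R : realType) (m : nat) (v : 'I_m -> 'cV[R]_5).
Hypothesis cv : compact_polytope v.
Hypothesis rav : right_angled v.
Hypothesis sv : schlafli4 v 5 3 3.
Hypothesis regv : regular v.
Implicit Types (x y z : 'cV[R]_5) (l k p q : 'I_m) (r s : 'I_4) (f g : 'I_4 -> 'I_m).
Local Notation P := (poly_of v).
Local Notation r0 := (ord0 : 'I_4).
Local Notation r1 := (Ordinal (isT : (1 < 4)%N)).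
Local Notation r2 := (Ordinal (isT : (2 < 4)%N)).
Local Notation r3 := (Ordinal (isT : (3 < 4)%N)).

Let v1 l : lorentz (v l) (v l) = 1. Proof. by case: cv. Qed.

(** The edge of the 2-face of the facets p and q lying in the facet k. *)
Definition edge p q k := face v [set l | [\/ l = k, l = p | l = q]].

Lemma edge_r1 z f : frame v z f -> is_face v 1 (edge (f r2) (f r3) (f r1)) /\
  forall l, edge (f r2) (f r3) (f r1) `<=` face v [set l] ->
    [\/ l = f r1, l = f r2 | l = f r3].
Proof.
move=> fr; have [Pz fO zf] := fr.
have E : edge (f r2) (f r3) (f r1) = flag_face v f 1.
  congr face; apply/seteqP; split=> l /=.
    by case=> ->; [exists r1|exists r2|exists r3].
  case=> -[[|[|[|[|//]]]] s4] //= _ ->.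
  - by apply: Or31; congr (f _); exact: val_inj.
  - by apply: Or32; congr (f _); exact: val_inj.
  - by apply: Or33; congr (f _); exact: val_inj.
split; first by rewrite E; exact: flag_face_dim fr.
move=> l sub; have Ez : edge (f r2) (f r3) (f r1) z.
  by split=> // l' [] ->; exact: frame_tight fr.
have [_ /(_ l erefl) /zf[s ls]] := sub z Ez.
have [|t [t0 t1 tE]] := flag_face_move cv
    (I := [set l | [\/ l = f r1, l = f r2 | l = f r3]]) (k := r0) fr.
  by move=> l' []->; [exists r1|exists r2|exists r3].
have [_ /(_ l erefl)] := sub _ tE.
have hz : hyperbolic z by case: Pz.
have ft : future (z + t *: - v (f r0)).
  apply: future_tangent => //; last by rewrite !lorentz_lin v1; lra.
  by rewrite lorentz_lin lorentzC (frame_tight _ fr) oppr0.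
rewrite lorentzZl => /eqP; rewrite mulf_eq0 (gt_eqF (normalize_factor_gt0 ft)) /=.
rewrite ls !lorentz_lin (frame_tight _ fr) fO => {sub Ez tE ft}.
case: s ls => [[|[|[|[|//]]]] s4] ls /=.
- by rewrite add0r mulf_eq0 oppr_eq0 oner_eq0 orbF gt_eqF.
- by move=> _; apply: Or31; congr (f _); exact: val_inj.
- by move=> _; apply: Or32; congr (f _); exact: val_inj.
- by move=> _; apply: Or33; congr (f _); exact: val_inj.
Qed.

Lemma edge_r0 z f : frame v z f -> is_face v 1 (edge (f r2) (f r3) (f r0)) /\
  forall l, edge (f r2) (f r3) (f r0) `<=` face v [set l] ->
    [\/ l = f r0, l = f r2 | l = f r3].
Proof.
pose g s := if s == r0 then r1 else if s == r1 then r0 else s.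
have gi : injective g.
  apply: inv_inj => s; rewrite /g; have [->|s0] := eqVneq s r0; first by [].
  by have [->|sr] := eqVneq s r1; rewrite ?eqxx // (negbTE s0) (negbTE sr).
by move=> /frame_perm/(_ gi)/edge_r1.
Qed.

Section Walk.
Variables (ka mu : R).
Hypotheses (ka0 : 0 < ka) (mu0 : 0 < mu) (kamu : ka ^+ 2 = 1 + mu ^+ 2).

(** The turn of the walk around a 2-face, in terms of the normals of its
   consecutive sides: k, k' meet at z and the next two sides are l, l'. *)
Lemma walk_products z z' k k' l l' :
  lorentz z z = -1 -> lorentz (v k) (v k') = 0 -> lorentz z (v k) = 0 ->
  lorentz z (v k') = 0 ->
  v l = mu *: z - ka *: v k -> z' = ka *: z - mu *: v k ->
  v l' = mu *: z' - ka *: v k' ->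
  [/\ lorentz (v k) (v l) = - ka, lorentz (v k) (v l') = - mu ^+ 2 &
      lorentz (v k) z' = - mu].
Proof.
move=> zz kk' zk zk' -> -> ->.
by rewrite !lorentz_lin v1 kk' [lorentz (v k) z]lorentzC zk; split; ring.
Qed.

Hypothesis cross : forall z f r, frame v z f -> exists2 l,
  v l = mu *: z - ka *: v (f r) & frame v (ka *: z - mu *: v (f r)) (replace f r l).

(** Among six consecutive sides of a pentagon two coincide. The products of their
   normals, polynomials in ka, exclude all coincidences except that of the first
   side with the sixth, which happens only if ka is the golden ratio. *)
Lemma golden_edge : (0 < m)%N -> ka ^+ 2 = ka + 1.
Proof.
move=> m0; apply: contrapT => nk.
have kap := ka0; have mup := mu0; have kamu1 := kamu.
have [z0 [f0 fr0]] := frame_exists cv rav sv (Ordinal m0).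
have [k2 V2 fr1] := cross r0 fr0.
have [k3 V3 fr2] := cross r1 fr1.
have [k4 V4 fr3] := cross r0 fr2.
have [k5 V5 fr4] := cross r1 fr3.
set z1 := ka *: z0 - _ in fr1 V3 fr2 V4 fr3 V5 fr4.
set z2 := ka *: z1 - _ in fr2 V4 fr3 V5 fr4.
set z3 := ka *: z2 - _ in fr3 V5 fr4.
set z4 := ka *: z3 - _ in fr4.
have E1 : z1 = ka *: z0 - mu *: v (f0 r0) by [].
have E2 : z2 = ka *: z1 - mu *: v (f0 r1) by [].
have E3 : z3 = ka *: z2 - mu *: v k2 by [].
clearbody z4 z3 z2 z1.
move: V3 V4 V5; rewrite /replace /= => V3 V4 V5.
pose k0 := f0 r0; pose k1 := f0 r1; pose p := f0 r2; pose q := f0 r3.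
have zz z f : frame v z f -> lorentz z z = -1 by case=> -[[]].
have o01 : lorentz (v k0) (v k1) = 0 by case: fr0 => _ /(_ r0 r1).
have o21 : lorentz (v k2) (v k1) = 0 by case: fr1 => _ /(_ r0 r1).
have o23 : lorentz (v k2) (v k3) = 0 by case: fr2 => _ /(_ r0 r1).
have o43 : lorentz (v k4) (v k3) = 0 by case: fr3 => _ /(_ r0 r1).
have o45 : lorentz (v k4) (v k5) = 0 by case: fr4 => _ /(_ r0 r1).
have [a02 a03 _] := walk_products (zz _ _ fr0) o01 (frame_tight r0 fr0)
  (frame_tight r1 fr0) V2 E1 V3.
have [a13 a14 b1] := walk_products (zz _ _ fr1) (etrans (lorentzC _ _) o21)
  (frame_tight r1 fr1) (frame_tight r0 fr1) V3 E2 V4.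
have [a24 a25 _] := walk_products (zz _ _ fr2) o23
  (frame_tight r0 fr2) (frame_tight r1 fr2) V4 E3 V5.
have a35 : lorentz (v k3) (v k5) = - ka.
  by rewrite V5 !lorentz_lin v1 lorentzC (frame_tight r1 fr3); ring.
have a15 : lorentz (v k1) (v k5) = ka * (ka - mu ^+ 2).
  by rewrite V5 E3 !lorentz_lin a13 b1 [lorentz (v k1) (v k2)]lorentzC o21; ring.
have ne a b : lorentz (v a) (v b) <> 1 -> a <> b by move=> + ab; rewrite ab v1.
have mu2 : 0 < mu ^+ 2 by rewrite exprn_gt0.
have n0 : (0 : R) <> 1 by move/eqP; rewrite eq_sym oner_eq0.
have nka : - ka <> 1 by apply/eqP; rewrite lt_eqF //; lra.
have nmu : - mu ^+ 2 <> 1 by apply/eqP; rewrite lt_eqF //; lra.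
pose kk i := nth k0 [:: k0; k1; k2; k3; k4; k5] i.
have kk_ne i j : (i < j <= 5)%N -> kk i <> kk j.
  move=> /andP[+ +]; rewrite /kk.
  case: i => [|[|[|[|[|[|i]]]]]]; case: j => [|[|[|[|[|[|j]]]]]] //= _ _.
  - by apply: ne; rewrite o01.
  - by apply: ne; rewrite a02.
  - by apply: ne; rewrite a03.
  - move=> E; move: a03; rewrite E o43; lra.
  - move=> E; move: a15; rewrite -E lorentzC o01 => /esym/eqP.
    by rewrite mulf_eq0 gt_eqF //= subr_eq0 => /eqP kE; apply: nk; lra.
  - by apply: ne; rewrite lorentzC o21.
  - by apply: ne; rewrite a13.
  - by apply: ne; rewrite a14.
  - by move=> E; move: a14; rewrite E lorentzC o45; lra.
  - by apply: ne; rewrite o23.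
  - by apply: ne; rewrite a24.
  - by apply: ne; rewrite a25.
  - by apply: ne; rewrite lorentzC o43.
  - by apply: ne; rewrite a35.
  - by apply: ne; rewrite o45.
have key (e := edge p q) (a b : 'I_m) z f g w :
    frame v z f -> f r2 = p -> f r3 = q -> (a = f r0 \/ a = f r1) ->
    frame v w g -> g r2 = p -> g r3 = q -> (b = g r0 \/ b = g r1) ->
    e a = e b -> a = b.
  move=> fr fp fq af gr gp gq bg eab.
  have sub : e b `<=` face v [set a].
    by rewrite -eab => x [Px xa]; split=> // _ ->; apply: xa; exact: Or31.
  have fi := frame_inj cv fr.
  have ap : a <> p by rewrite -fp; case: af => -> /fi.
  have aq : a <> q by rewrite -fq; case: af => -> /fi.
  have : [\/ a = b, a = p | a = q]; last by case.
  case: bg sub => -> sub.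
    by have [_ /(_ a)] := edge_r0 gr; rewrite gp gq; apply.
  by have [_ /(_ a)] := edge_r1 gr; rewrite gp gq; apply.
have F2 := flag_face_dim cv (isT : (2 <= 4)%N) fr0.
case: sv => /(_ _ F2) card5 _ _.
apply: (card_eq_lt (g := fun i => edge p q (kk i)) card5).
  have sub k : edge p q k `<=` flag_face v f0 2.
    move=> x [Px xk]; split=> // l [[[|[|[|[|//]]]] s4] //= _ ->]; apply: xk.
      by apply: Or32; congr (f0 _); exact: val_inj.
    by apply: Or33; congr (f0 _); exact: val_inj.
  move=> [|[|[|[|[|[|i]]]]]] //= _; split=> //.
  - exact: (edge_r0 fr0).1.
  - exact: (edge_r1 fr0).1.
  - exact: (edge_r0 fr1).1.
  - exact: (edge_r1 fr2).1.
  - exact: (edge_r0 fr3).1.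
  - exact: (edge_r1 fr4).1.
have kf i : (i <= 5)%N -> exists z f, [/\ frame v z f, f r2 = p, f r3 = q &
    kk i = f r0 \/ kk i = f r1].
  move: i => [|[|[|[|[|[|i]]]]]] //= _.
  - by exists z0, f0; split=> //; left.
  - by exists z0, f0; split=> //; right.
  - by exists z1, (replace f0 r0 k2); split=> //; left.
  - by exists z2, (replace (replace f0 r0 k2) r1 k3); split=> //; right.
  - by exists z3, (replace (replace (replace f0 r0 k2) r1 k3) r0 k4); split=> //; left.
  - by exists z4, (replace (replace (replace (replace f0 r0 k2) r1 k3) r0 k4) r1 k5);
      split=> //; right.
move=> i j /andP[ij j5] eij; apply: (kk_ne i j); first by rewrite ij.
have [z [f [fr fp fq af]]] := kf i (leq_trans (ltnW ij) j5).
have [w [g [gr gp gq bg]]] := kf j j5.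
exact: key fr fp fq af gr gp gq bg eij.
Qed.

End Walk.

(** The combinatorics of the walk along the edges: crossing the edge opposite
   to the facet r replaces the normal v_r by z - phi v_r, where z is the
   position of the vertex, rescaled by the square root of phi. *)
Theorem golden_cross : (0 < m)%N -> exists phi mu : R,
  [/\ 0 < phi, 0 < mu, phi ^+ 2 = phi + 1 & mu ^+ 2 = phi] /\
  forall z f r, frame v z f -> exists2 l, v l = mu *: z - phi *: v (f r) &
    frame v (phi *: z - mu *: v (f r)) (replace f r l).
Proof.
move=> m0.
have [ka [mu [ka0 mu0 kamu cross]]] := uniform_cross cv rav sv regv (Ordinal m0).
have gold := golden_edge ka0 mu0 kamu cross m0.
by exists ka, mu; split=> //; split=> //; lra.
Qed.

End Pentagon.

(** * The 600-cell *)

Section Icosians.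
(** The computations take place in the ring of integers of the field of the golden
   ratio phi: the pair (a, b) stands for a + b phi. *)
Definition zphi := (int * int)%type.

Definition zadd (p q : zphi) : zphi := (p.1 + q.1, p.2 + q.2).
Definition zopp (p : zphi) : zphi := (- p.1, - p.2).
Definition zmul (p q : zphi) : zphi :=
  (p.1 * q.1 + p.2 * q.2, p.1 * q.2 + p.2 * q.1 + p.2 * q.2).

Definition zvec := seq zphi.
Definition vadd (x y : zvec) : zvec := mkseq (fun i => zadd x`_i y`_i) 4.
Definition vscale (c : zphi) (x : zvec) : zvec := mkseq (fun i => zmul c x`_i) 4.
Definition zdot (x y : zvec) : zphi :=
  foldr (fun i => zadd (zmul x`_i y`_i)) 0 (iota 0 4).

(** Four mutually adjacent vertices of the 600-cell, multiplied by 2. *)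
Definition tetrahedron : seq zvec :=
  [:: [:: (2, 0); (0, 0); (0, 0); (0, 0)];
      [:: (0, 1); (1, 0); (-1, 1); (0, 0)];
      [:: (0, 1); (1, 0); (1, -1); (0, 0)];
      [:: (0, 1); (-1, 1); (0, 0); (1, 0)]].

Definition combination (c : nat -> zphi) (F : seq zvec) : zvec :=
  foldr (fun s => vadd (vscale (c s) (nth [::] F s))) (nseq 4 (0, 0)) (iota 0 4).

Definition of_coords (y : zvec) : zvec := combination (nth (0, 0) y) tetrahedron.

(** The reflection of the vertex r of a tetrahedron in the opposite face is
   (phi - 1) times the sum of the other three vertices, minus the vertex r. *)
Definition new_vertex (F : seq zvec) (r : nat) : zvec :=
  combination (fun s => if s == r then (-1, 0) else (-1, 1)) F.

Definition move (F : seq zvec) (r : nat) : seq zvec :=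
  mkseq (fun s => if s == r then new_vertex F r else (nth [::] F s)) 4.

Definition explore_step (F : seq zvec) (st : seq (seq zvec) * seq zvec) (r : nat) :=
  let y := new_vertex F r in
  if y \in st.2 then st else (move F r :: st.1, y :: st.2).

(** Depth-first search of the vertices, through tetrahedra with a common face. *)
Fixpoint explore (fuel : nat) (todo : seq (seq zvec)) (seen : seq zvec) : seq zvec :=
  match fuel, todo with
  | fuel'.+1, F :: todo' =>
      let st := foldl (explore_step F) (todo', seen) (iota 0 4) in
      explore fuel' st.1 st.2
  | _, _ => seen
  end.

Definition unit_frame : seq zvec :=
  mkseq (fun r => mkseq (fun s => ((r == s)%:Z, 0)) 4) 4.

Definition cell600 : seq zvec := explore 120 [:: unit_frame] unit_frame.

(** The 600-cell is the union of five 24-cells, the cosets in the binary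
   icosahedral group of the units of the Hurwitz quaternions.  With x doubled,
   the coset is found by multiplying by a quaternion of order ten until all
   coordinates are rational. *)
Definition zhalf (a : int) : int :=
  match a with Posz n => Posz n./2 | Negz n => Negz n./2 end.

Definition qmul_half (x y : zvec) : zvec :=
  let m i j := zmul x`_i y`_j in
  let comb p q r s := let t := zadd (zadd p q) (zadd r s) in (zhalf t.1, zhalf t.2) in
  [:: comb (m 0 0) (zopp (m 1 1)) (zopp (m 2 2)) (zopp (m 3 3));
      comb (m 0 1) (m 1 0) (m 2 3) (zopp (m 3 2));
      comb (m 0 2) (zopp (m 1 3)) (m 2 0) (m 3 1);
      comb (m 0 3) (m 1 2) (zopp (m 2 1)) (m 3 0)]%N.

Definition omega_bar : zvec := [:: (0, 1); (-1, 0); (1, -1); (0, 0)].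

Definition colour (x : zvec) : nat :=
  find (fun k => all (fun c : zphi => c.2 == 0) (iter k (qmul_half omega_bar) x))
    (iota 0 5).

Definition xdot (y y' : zvec) : zphi := zdot (of_coords y) (of_coords y').

(** In doubled coordinates the products of distinct vertices take eight values, of
   which 2 phi characterizes adjacency. The five 24-cells give a proper
   colouring of the adjacency graph. *)
Definition check_pair (p p' : zvec * nat) : bool :=
  let d := zdot p.1 p'.1 in
  if d == (0, 2) then p.2 != p'.2
  else d \in [:: (2, 0); (-2, 2); (0, 0); (2, -2); (-2, 0); (0, -2); (-4, 0)].

Definition check_point (p : zvec * nat) : bool := (zdot p.1 p.1 == (4, 0)) && (p.2 < 5)%N.

Definition check_cell600 : bool :=
  let points := [seq let x := of_coords y in (x, colour x) | y <- cell600] in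
  [&& size points == 120%N, all check_point points & pairwise check_pair points].

Lemma check_cell600_true : check_cell600.
Proof. by vm_compute. Qed.

Lemma explore_invariant (good_frame : seq zvec -> Prop) (good : zvec -> Prop) :
  (forall F (r : 'I_4), good_frame F -> good (new_vertex F r) /\ good_frame (move F r)) ->
  forall fuel todo seen,
    {in todo, forall F, good_frame F} -> {in seen, forall y, good y} ->
    {in explore fuel todo seen, forall y, good y}.
Proof.
move=> mv; elim=> [|fuel IH] [|F todo] seen todoP seenP //=.
have FP : good_frame F by apply: todoP; rewrite mem_head.
have st rs st0 : all (ltn^~ 4%N) rs ->
    {in st0.1, forall F, good_frame F} -> {in st0.2, forall y, good y} ->
    let st := foldl (explore_step F) st0 rs in
    {in st.1, forall F, good_frame F} /\ {in st.2, forall y, good y}.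
  elim: rs st0 => [|r rs IHr] st0 //= /andP[r4 rs4] h1 h2.
  have [gy gF] := mv F (Ordinal r4) FP.
  apply: IHr => //; rewrite /explore_step; case: ifP => //= _ w;
    by rewrite in_cons => /predU1P[->|]//; (exact: h1 || exact: h2).
have [|h1 h2] := st (iota 0 4) (todo, seen) isT _ seenP; last exact: IH.
by move=> G GT; apply: todoP; rewrite in_cons GT orbT.
Qed.

Section Values.
Variables (R : realType) (phi : R).
Hypothesis phi2 : phi ^+ 2 = phi + 1.

Definition val_phi (p : zphi) : R := p.1%:~R + p.2%:~R * phi.

Lemma val_zadd p q : val_phi (zadd p q) = val_phi p + val_phi q.
Proof. by rewrite /val_phi /= !intrD; ring. Qed.

Lemma val_zmul p q : val_phi (zmul p q) = val_phi p * val_phi q.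
Proof.
rewrite /val_phi /= !intrD !intrM; move: phi2 => h.
transitivity (p.1%:~R * q.1%:~R + (p.1%:~R * q.2%:~R + p.2%:~R * q.1%:~R) * phi
  + p.2%:~R * q.2%:~R * (phi ^+ 2)); last by ring.
by rewrite h; ring.
Qed.

Lemma val_phi0 : val_phi (0, 0) = 0. Proof. by rewrite /val_phi mul0r addr0. Qed.

Lemma val_zdot x y : val_phi (zdot x y) = \sum_(i < 4) val_phi x`_i * val_phi y`_i.
Proof.
rewrite /zdot /= !val_zadd !val_zmul !big_ord_recl big_ord0.
by rewrite [val_phi 0]val_phi0.
Qed.

Lemma val_vadd x y (i : 'I_4) : val_phi (vadd x y)`_i = val_phi x`_i + val_phi y`_i.
Proof. by rewrite /vadd nth_mkseq // val_zadd. Qed.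

Lemma val_vscale c x (i : 'I_4) : val_phi (vscale c x)`_i = val_phi c * val_phi x`_i.
Proof. by rewrite /vscale nth_mkseq // val_zmul. Qed.

Lemma val_nseq0 (i : 'I_4) : val_phi (nseq 4 (0, 0))`_i = 0.
Proof. by rewrite nth_nseq; case: ifP => _; rewrite ?val_phi0. Qed.

Lemma val_combination c F (i : 'I_4) : val_phi (combination c F)`_i =
  \sum_(s < 4) val_phi (c s) * val_phi (nth [::] F s)`_i.
Proof.
rewrite /combination -(big_mkord predT (fun s => val_phi (c s) * val_phi (nth [::] F s)`_i)).
rewrite /index_iota subn0; elim: (iota 0 4) => [|s rs IH].
  by rewrite big_nil val_nseq0.
by rewrite big_cons val_vadd val_vscale IH.
Qed.

Lemma val_new_vertex F (r i : 'I_4) : val_phi (new_vertex F r)`_i =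
  (phi - 1) * (\sum_(s < 4) val_phi (nth [::] F s)`_i) - phi * val_phi (nth [::] F r)`_i.
Proof.
rewrite val_combination (bigD1 r) //= eqxx [in RHS](bigD1 r) //=.
rewrite [in RHS]mulrDr mulr_sumr.
rewrite (eq_bigr (fun s : 'I_4 => (phi - 1) * val_phi (nth [::] F s)`_i)).
  by rewrite (_ : val_phi (-1, 0) = -1); [ring | rewrite /val_phi /=; ring].
move=> s /negbTE; rewrite -val_eqE /= => ->.
by congr (_ * _); rewrite /val_phi /=; ring.
Qed.

(** The Gram matrix of [tetrahedron] has the entries 4 on the diagonal and 2 phi
   elsewhere. *)
Lemma val_xdot y y' : val_phi (xdot y y') =
  2 * phi * (\sum_(s < 4) val_phi y`_s) * (\sum_(s < 4) val_phi y'`_s)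
  + (4 - 2 * phi) * (\sum_(s < 4) val_phi y`_s * val_phi y'`_s).
Proof.
have tet x (i : 'I_4) : val_phi (of_coords x)`_i =
    \sum_(s < 4) val_phi x`_s * val_phi (nth [::] tetrahedron s)`_i.
  exact: val_combination.
rewrite /xdot val_zdot (eq_bigr _ (fun i _ => congr2 *%R (tet y i) (tet y' i))).
rewrite !big_ord_recl !big_ord0 /=.
have [-> -> -> -> ->] : [/\ val_phi (2, 0) = 2, val_phi (0, 0) = 0,
    val_phi (0, 1) = phi, val_phi (1, 0) = 1 & val_phi (-1, 1) = phi - 1].
  by rewrite /val_phi /=; split; ring.
have -> : val_phi (1, -1) = 1 - phi by rewrite /val_phi /=; ring.
rewrite /bump /= !add1n.
move: (val_phi y`_0) (val_phi y`_1) (val_phi y`_2) (val_phi y`_3) => a0 a1 a2 a3.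
move: (val_phi y'`_0) (val_phi y'`_1) (val_phi y'`_2) (val_phi y'`_3) => b0 b1 b2 b3.
apply/eqP; rewrite -subr_eq0; apply/eqP.
transitivity ((phi ^+ 2 - phi - 1) * (2 * (a1 * b1 + a2 * b2 + a3 * b3)
  + (a1 + a2) * b3 + a3 * (b1 + b2))); first by ring.
by rewrite phi2; ring.
Qed.

Lemma val_xdotC y y' : val_phi (xdot y y') = val_phi (xdot y' y).
Proof. by rewrite /xdot !val_zdot; apply: eq_bigr => i _; rewrite mulrC. Qed.

(** What is used of the 600-cell: its 120 vertices are distinguished by their
   products, adjacent ones have different colours, and the last clause is an
   induction principle along tetrahedra with a common face. *)
Lemma cell600_exists : 0 < phi -> exists C : seq zvec, [/\ size C = 120%N,
  {in C, forall y, val_phi (xdot y y) = 4 /\ (colour (of_coords y) < 5)%N},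
  forall i j, (i < j < 120)%N -> let y := nth [::] C i in let y' := nth [::] C j in
    (val_phi (xdot y y') = 2 * phi /\ colour (of_coords y) <> colour (of_coords y'))
    \/ val_phi (xdot y y') <= 2 &
  forall (good_frame : seq zvec -> Prop) (good : zvec -> Prop),
    (forall F (r : 'I_4), good_frame F -> good (new_vertex F r) /\ good_frame (move F r)) ->
    good_frame unit_frame -> {in unit_frame, forall y, good y} ->
    {in C, forall y, good y}].
Proof.
move=> phi0; exists cell600.
have phi_le2 : phi <= 2 by move: phi2 phi0 => h h0; nra.
have reach (gf : seq zvec -> Prop) (g : zvec -> Prop) :
    (forall F (r : 'I_4), gf F -> g (new_vertex F r) /\ gf (move F r)) ->
    gf unit_frame -> {in unit_frame, forall y, g y} -> {in cell600, forall y, g y}.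
  move=> mv F0 y0; rewrite /cell600; apply: (explore_invariant mv) => // F.
  by rewrite inE => /eqP ->.
move: check_cell600_true reach; rewrite /check_cell600; move: cell600 => C.
rewrite all_map pairwise_map size_map => /and3P[/eqP sC /allP selfC /pairwiseP pairC] reach.
split; [exact: sC | | | exact: reach].
  move=> y /selfC /andP[/eqP /= xy cy].
  by split=> //; rewrite /xdot xy /val_phi /=; ring.
move=> i j /andP[ij j120].
have := pairC [::] i j; rewrite !inE !sC => /(_ (ltn_trans ij j120) j120 ij).
rewrite /= /check_pair /=; case: eqP => [xy|_ xy].
  by move/eqP=> cc; left; split=> //; rewrite /xdot xy /val_phi /=; ring.
right; move: xy; rewrite !inE /xdot.
by do ?[case/orP]; move=> /eqP ->; rewrite /val_phi /=; lra.
Qed.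

End Values.
End Icosians.

(** * The right-angled 120-cell *)

(** The vertices of a regular simplex in dimension 4: four of them are obtained from
   one another by permuting the coordinates, and phi / 4 solves the equation
   4 h ^ 2 - h - 1 / 4 = 0 which makes them unit vectors. *)
Definition simplex5 (R : realType) (phi : R) (k : nat) : 'I_4 -> R :=
  fun i => if k == 4 then - (1 / 2) else (1 / 2 - phi) * (k == i :> nat)%:R + phi / 4.

Lemma dot_simplex5 (R : realType) (phi : R) k l : phi ^+ 2 = phi + 1 ->
  (k < 5)%N -> (l < 5)%N ->
  dot (simplex5 phi k) (simplex5 phi l) = if k == l then 1 else - (1 / 4).
Proof.
move=> h; rewrite /dot /simplex5 !big_ord_recl big_ord0.
have cl (a b c : R) : a - b = c * (phi ^+ 2 - phi - 1) -> a = b.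
  by rewrite h => E; apply/eqP; rewrite -subr_eq0 E; apply/eqP; ring.
case: k => [|[|[|[|[|k]]]]] //; case: l => [|[|[|[|[|l]]]]] // _ _ /=;
  rewrite /bump /=;
   first [apply: (cl _ _ (3/4)); by field | apply: (cl _ _ (-(1/4))); by field
         | apply: (cl _ _ 0); by field].
Qed.

Section Cell120.
Variables (R : realType) (v : 'I_120 -> 'cV[R]_5).
Hypothesis cv : compact_polytope v.
Hypothesis rav : right_angled v.
Hypothesis sv : schlafli4 v 5 3 3.
Hypothesis regv : regular v.

Let v1 l : lorentz (v l) (v l) = 1. Proof. by case: cv. Qed.

Section Coordinates.
Variables (phi mu : R) (q : 'cV[R]_5) (u : 'I_4 -> 'cV[R]_5).
Hypothesis phi0 : 0 < phi.
Hypothesis phi2 : phi ^+ 2 = phi + 1.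
Hypothesis qq : lorentz q q = - phi ^+ 3.
Hypothesis qu : forall r, lorentz (u r) q = 0.
Hypothesis uu : forall r s, lorentz (u r) (u s) = (r == s)%:R + phi ^+ 3.

(** The vectors u s span the orthogonal complement of q, a Euclidean space, where
   they form, up to a factor, a tetrahedron of the 600-cell. The normals of the
   facets of the 120-cell centred at q are q plus the vertices of this 600-cell. *)
Definition realize (y : zvec) := q + \sum_(s < 4) val_phi phi y`_s *: u s.

Lemma lorentz_realize y y' : lorentz (realize y) (realize y') =
  - phi ^+ 3 + phi ^+ 2 / 2 * val_phi phi (xdot y y').
Proof.
rewrite /realize lorentzDl !lorentzDr qq.
rewrite lorentz_sumr big1 ?addr0; last first.
  by move=> s _; rewrite lorentzZr lorentzC qu mulr0.
rewrite !lorentz_suml big1 ?add0r; last by move=> s _; rewrite lorentzZl qu mulr0.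
congr (_ + _); rewrite val_xdot //.
transitivity (\sum_(r < 4) (val_phi phi y`_r * val_phi phi y'`_r +
    phi ^+ 3 * val_phi phi y`_r * \sum_(s < 4) val_phi phi y'`_s)).
  apply: eq_bigr => r _; rewrite lorentz_sumr mulr_sumr.
  rewrite (eq_bigr (fun s : 'I_4 => val_phi phi y`_r * val_phi phi y'`_s * (r == s)%:R +
      phi ^+ 3 * val_phi phi y`_r * val_phi phi y'`_s)); last first.
    by move=> s _; rewrite lorentzZl lorentzZr uu; ring.
  rewrite big_split /=; congr (_ + _).
  rewrite (bigD1 r) //= eqxx mulr1 big1 ?addr0 // => s.
  by rewrite eq_sym => /negbTE ->; rewrite mulr0.
rewrite big_split /= -mulr_suml -mulr_sumr.
set A := \sum_(s < 4) _; set B := \sum_(i < 4) _; set C := \sum_(s < 4) _.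
apply/eqP; rewrite -subr_eq0; apply/eqP.
transitivity ((phi ^+ 2 - phi - 1) * (phi - 1) * A); first by field.
by rewrite phi2; ring.
Qed.

Lemma realize_new_vertex F (r : 'I_4) : realize (new_vertex F r) =
  q + (phi - 1) *: (\sum_(s < 4) (realize (nth [::] F s) - q))
    - phi *: (realize (nth [::] F r) - q).
Proof.
have rq y : realize y - q = \sum_(s < 4) val_phi phi y`_s *: u s.
  by rewrite /realize addrAC subrr add0r.
rewrite rq (eq_bigr _ (fun s _ => rq _)) exchange_big /=.
rewrite -addrA; congr (_ + _).
rewrite scaler_sumr [phi *: _]scaler_sumr -sumrB; apply: eq_bigr => s _.
rewrite val_new_vertex // scalerBl -!scalerA; congr (_ - _).
by rewrite scaler_suml.
Qed.

(** A vertex of the 120-cell whose four facets are realized by the vertices of a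
   tetrahedron of the 600-cell. The last condition locates z in terms of the
   four normals; by [golden_cross] it implies that the facet at the other end of
   the edge opposite to r is realized by the reflected vertex. *)
Definition realized_frame (F : seq zvec) := exists z f, [/\ frame v z f,
  forall r : 'I_4, v (f r) = realize (nth [::] F r) &
  mu *: z = (5 - 3 * phi) *: q + (phi - 1) *: \sum_(s < 4) v (f s)].

Definition realized (y : zvec) := exists l, v l = realize y.

Hypothesis mu2 : mu ^+ 2 = phi.
Hypothesis cross : forall z f r, frame v z f ->
  exists2 l, v l = mu *: z - phi *: v (f r) &
    frame v (phi *: z - mu *: v (f r)) (replace f r l).

Lemma realized_move F (r : 'I_4) : realized_frame F ->
  realized (new_vertex F r) /\ realized_frame (move F r).
Proof.
move=> [z [f [fr fF zE]]]; have [l lE fr'] := cross r fr.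
have lN : v l = realize (new_vertex F r).
  rewrite realize_new_vertex lE zE.
  rewrite [\sum_(s < 4) (_ - _)](eq_bigr (fun s => v (f s) - q)); last by move=> s _; rewrite fF.
  rewrite -fF sumrB sumr_const card_ord -[q *+ 4]scaler_nat.
  set S := \sum_(s < 4) _.
  apply/colP => i; rewrite !mxE; ring.
split; first by exists l.
exists (phi *: z - mu *: v (f r)), (replace f r l); split=> //.
  move=> s; rewrite /replace /move nth_mkseq // -val_eqE.
  by case: eqP => // _; rewrite fF.
rewrite (bigD1 r) //= {1}/replace eqxx (eq_bigr (fun s => v (f s))); last first.
  by move=> s /negbTE sr; rewrite /replace sr.
rewrite (_ : \sum_(s < 4 | s != r) v (f s) = \sum_(s < 4) v (f s) - v (f r)); last first.
  by rewrite [in RHS](bigD1 r) //= addrAC subrr add0r.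
have -> : (5 - 3 * phi) *: q + (phi - 1) *: (v l + (\sum_(s < 4) v (f s) - v (f r))) =
    mu *: z + (phi - 1) *: (v l - v (f r)).
  by rewrite zE addrCA scalerDr addrA addrC addrCA.
rewrite lE; apply/colP => i; rewrite !mxE; apply/eqP; rewrite -subr_eq0; apply/eqP.
transitivity ((phi ^+ 2 - phi - 1) * v (f r) i 0 + (phi - mu ^+ 2) * v (f r) i 0); first by ring.
by rewrite phi2 mu2; ring.
Qed.

Hypothesis start : realized_frame unit_frame.

Let not_one x : x < 4 -> - phi ^+ 3 + phi ^+ 2 / 2 * x < 1.
Proof.
move: phi2 phi0 => h h0 x4.
have p3 : phi ^+ 3 = 2 * phi + 1 by rewrite exprS h mulrDr -expr2 h; ring.
rewrite p3 h; have : 0 < (4 - x) * (phi + 1) by rewrite mulr_gt0 ?subr_gt0 // addr_gt0.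
by lra.
Qed.

(** Every vertex of the 600-cell is realized by a facet, by induction along
   tetrahedra. Distinct vertices give distinct facets, because the product of
   the two normals is not 1. As there are 120 of both, every facet is obtained. *)
Lemma all_realized : exists y : 'I_120 -> zvec, [/\ forall l, v l = realize (y l),
  forall l, val_phi phi (xdot (y l) (y l)) = 4 /\ (colour (of_coords (y l)) < 5)%N &
  forall l l', l != l' ->
    (val_phi phi (xdot (y l) (y l')) = 2 * phi /\
       colour (of_coords (y l)) <> colour (of_coords (y l')))
    \/ val_phi phi (xdot (y l) (y l')) <= 2].
Proof.
have phi_lt2 : phi < 2 by move: phi2 phi0 => h h0; nra.
have lt4 x : x = 2 * phi \/ x <= 2 -> x < 4 by case=> h; lra.
have [C [sC selfC pairC reachC]] := cell600_exists phi2 phi0.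
have realC : {in C, forall y, realized y}.
  apply: (reachC _ _ realized_move start) => y.
  have [z [f [_ fF _]]] := start => /(nthP [::])[r r4 <-].
  by exists (f (Ordinal r4)); rewrite fF.
have /choice[g gP] : forall i : 'I_120, exists l', v l' = realize (nth [::] C i).
  by move=> i; apply: realC; rewrite mem_nth // sC.
have pairC' (i j : 'I_120) : i != j -> let y := nth [::] C i in let y' := nth [::] C j in
    (val_phi phi (xdot y y') = 2 * phi /\ colour (of_coords y) <> colour (of_coords y'))
    \/ val_phi phi (xdot y y') <= 2.
  rewrite -val_eqE neq_ltn => /orP[]ij /=; first by apply: pairC; rewrite ij ltn_ord.
  rewrite val_xdotC // => /=.
  have [|[xy cc]|] := pairC j i; first by rewrite ij ltn_ord.
    by left; split=> // /esym.
  by right.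
have gi : injective g.
  move=> i j gij; apply/eqP/negPn/negP => nij.
  have := lorentz_realize (nth [::] C i) (nth [::] C j).
  rewrite -!gP -gij v1 => /eqP; apply/negP; rewrite gt_eqF // not_one //.
  by apply: lt4; have [[-> _]|] := pairC' i j nij; [left|right].
exists (fun l => nth [::] C (invF gi l)); split=> [l|l|l l' ll'].
- by rewrite -gP f_invF.
- by apply: selfC; rewrite mem_nth // sC.
- by apply: pairC'; rewrite (inj_eq (can_inj (f_invF gi))).
Qed.

End Coordinates.

Lemma dot_val (phi : R) (y y' : zvec) : phi ^+ 2 = phi + 1 ->
  dot (fun i : 'I_4 => val_phi phi (of_coords y)`_i / 2) (fun i => val_phi phi (of_coords y')`_i / 2)
  = val_phi phi (xdot y y') / 4.
Proof.
move=> h; rewrite /xdot val_zdot // /dot mulr_suml; apply: eq_bigr => i _.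
by field.
Qed.

(** The centre q of the 120-cell is determined by the condition on z in
   [realized_frame], applied to one vertex. The products of the normals are then
   1 - 2 phi ^ 2 (1 - x.x') where x and x' are the corresponding vertices of the
   600-cell, which are therefore the directions required by
   [admits_of_model]; the other components are given by the five colours. *)
Theorem cell120_admits : admits_proper_action (reflection_group v) 8.
Proof.
have [phi [mu [[phi0 mu0 phi2 mu2] cross]]] := golden_cross cv rav sv regv isT.
have [z [f fr]] := frame_exists cv rav sv ord0.
have [[[zz _] _] fO _] := fr; have zf r := frame_tight r fr.
have p4 : phi ^+ 4 = 3 * phi + 2.
  by rewrite (exprM phi 2 2) phi2 sqrrD phi2; ring.
have p3 : phi ^+ 3 = 2 * phi + 1 by rewrite exprS phi2 mulrDr -expr2 phi2; ring.
have [Q QE] : exists Q, Q = mu *: z - (phi - 1) *: \sum_(r < 4) v (f r) by exists (mu *: z - (phi - 1) *: \sum_(r < 4) v (f r)).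
have fQ r : lorentz (v (f r)) Q = 1 - phi.
  rewrite QE !lorentz_lin [lorentz (v _) z]lorentzC zf lorentz_sumr (bigD1 r) //= fO eqxx.
  by rewrite big1 => [|s]; [rewrite /=; ring | rewrite fO eq_sym => /negbTE ->].
have QQ : lorentz Q Q = 8 - 5 * phi.
  rewrite {1}QE !lorentz_lin lorentz_suml (eq_bigr (fun _ => 1 - phi)); last by move=> s _; rewrite fQ.
  rewrite sumr_const card_ord QE !lorentz_lin zz lorentz_sumr big1; last by move=> s _; exact: zf.
  transitivity (- mu ^+ 2 + 4 * (phi ^+ 2) - 8 * phi + 4); first by ring.
  by rewrite mu2 phi2; ring.
pose q := phi ^+ 4 *: Q; pose u r := v (f r) - q.
have fq r : lorentz (v (f r)) q = - phi ^+ 3.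
  rewrite lorentzZr fQ p4 p3; apply/eqP; rewrite -subr_eq0; apply/eqP.
  transitivity (3 * (1 + phi - phi ^+ 2)); first by ring.
  by rewrite phi2; ring.
have qq : lorentz q q = - phi ^+ 3.
  rewrite lorentzZl lorentzZr QQ p4 p3; apply/eqP; rewrite -subr_eq0; apply/eqP.
  transitivity ((1 + phi - phi ^+ 2) * (45 * phi + 33)); first by ring.
  by rewrite phi2; ring.
have qu r : lorentz (u r) q = 0 by rewrite lorentzDl lorentzNl fq qq subrr.
have uu r s : lorentz (u r) (u s) = (r == s)%:R + phi ^+ 3.
  by rewrite lorentzDr lorentzNr qu subr0 lorentzDl lorentzNl fO [lorentz q _]lorentzC fq opprK.
have start : realized_frame phi mu q u unit_frame.
  exists z, f; split=> // [r|].
    rewrite /realize (bigD1 r) //= big1 ?addr0 => [|s].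
      by rewrite !nth_mkseq // eqxx /val_phi mul0r addr0 scale1r addrC subrK.
    rewrite !nth_mkseq // -val_eqE eq_sym => /negbTE ->.
    by rewrite /val_phi /= mul0r addr0 scale0r.
  rewrite scalerA (_ : _ * _ = 1); first by rewrite scale1r QE subrK.
  rewrite p4; apply/eqP; rewrite -subr_eq0; apply/eqP.
  transitivity (9 * (1 + phi - phi ^+ 2)); first by ring.
  by rewrite phi2; ring.
have [y [yE self pair]] := all_realized phi0 phi2 qq qu uu mu2 cross start.
have vy l l' : lorentz (v l) (v l') = - phi ^+ 3 + phi ^+ 2 / 2 * val_phi phi (xdot (y l) (y l')).
  by rewrite !yE lorentz_realize.
have [ov ovP] := poly_interior cv.
have phi_bounds : 3 / 2 < phi < 2 by move: phi2 phi0 => h h0; apply/andP; split; nra.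
have [lo hi] := andP phi_bounds.
apply: (@admits_of_model R 4 120 4 4 v
  (fun l i => val_phi phi (of_coords (y l))`_i / 2)
  (fun l => simplex5 phi (colour (of_coords (y l)))) (phi / 2) (- (1 / 4)) _ _ _ _ _ _ ov ovP) => //.
- by apply/andP; split; lra.
- by move=> l; rewrite dot_val //; have [-> _] := self l; field.
- by move=> l; rewrite dot_simplex5 // ?eqxx //; case: (self l).
- move=> l l' ll'; rewrite vy !dot_val //; have [[-> cc]|le2] := pair l l' ll'.
    left; split; [| by field |].
      by transitivity (phi ^+ 3 - phi ^+ 3); [field | rewrite subrr].
    by rewrite dot_simplex5 //; [case: eqP | case: (self l) | case: (self l')].
  right; move: (val_phi _ _) le2 => x le2.
  have -> : (1 - x / 4) / (1 - phi / 2) = 2 * phi ^+ 2 * (1 - x / 4).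
    apply: (canLR (mulfK _)); first by rewrite lt0r_neq0 //; lra.
    transitivity ((1 - x / 4) * (1 - (phi ^+ 2 - phi - 1) * (phi - 1))); first last.
      by field.
    by rewrite phi2; field.
  rewrite p3 phi2. split; nra.
Qed.

End Cell120.

Theorem proposition1p8 (R : realType) :
  (forall (k : nat) (v : 'I_k -> 'cV[R]_3),
     ~~ odd k -> (6 <= k)%N -> right_angled_polygon v ->
     admits_proper_action (reflection_group v) 3) /\
  (forall v : 'I_120 -> 'cV[R]_5,
     right_angled_120cell v ->
     admits_proper_action (reflection_group v) 8).
Proof.
split=> [k v ek k6 rv|v [cv regv sv rav]]; first exact: polygon_admits.
exact: cell120_admits.
Qed.
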